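(* There exists a non-resonant real analytic submanifold $M$ in $\mathbb C^6$ (of real dimension $6$, admitting the maximum number of deck transformations) with pure elliptic complex tangent at $0$ such that, if its corresponding $\sigma$ is transformed by a formal biholomorphic map into a formal map $\sigma^*$ which commutes with the linear part of $\sigma$ at the origin, then $\sigma^*$ must diverge.
   Context: Here $p=3$. Write $z=(z',z'')\in\mathbb C^p\times\mathbb C^p$. $M$ is a germ at $0$ of real analytic submanifold $z_{p+j}=E_j(z',\bar z')$, $1\le j\le p$, where $E_j$ vanishes at $0$ with its first derivatives; $q_j(\bar z')$ is the part of the quadratic part of $E_j$ depending only on $\bar z'$. The complexification is $\mathcal M=\{(z,w)\colon z_{p+j}=E_j(z',w'),\ w_{p+j}=\bar E_j(w',z')\}$ with coordinates $(z',w')$, $\pi_1(z,w)=z$, $\rho_0(z',w')=(\bar w',\bar z')$. A deck transformation is a germ of biholomorphism $F$ of $(\mathcal M,0)$ with $\pi_1F=\pi_1$. $M$ admits the maximum number of deck transformations if $q^{-1}(0)=\{0\}$ and there are exactly $2^p$ deck transformations. Then these form an abelian group of involutions with a unique set of $p$ generators $\tau_{11},\dots,\tau_{1p}$ each fixing a hypersurface pointwise; $\tau_1=\tau_{11}\cdots\tau_{1p}$, $\tau_2=\rho_0\tau_1\rho_0$, $\sigma=\tau_1\tau_2$ (a germ of biholomorphism of $(\mathbb C^{2p},0)$). $M$ is non-resonant if the eigenvalues $\mu_1,\dots,\mu_p,\mu_1^{-1},\dots,\mu_p^{-1}$ of the linear part of $\sigma$ at $0$ satisfy $\mu^Q\neq1$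 for all $Q\in\mathbb Z^p\setminus\{0\}$. The complex tangent is pure elliptic if all these eigenvalues are real (they are then positive and different from $1$). A formal map diverges if its power series do not converge in any neighborhood of $0$. *)

(* Defs.v *)
Set Warnings "-notation-overridden,-notation-incompatible-prefix,-ambiguous-paths".
From HB Require Import structures.
From mathcomp Require Import all_boot all_order all_algebra finmap.
From mathcomp Require Import mpoly complex.
From mathcomp Require Import boolp classical_sets cardinality reals.

Set Implicit Arguments.
Unset Strict Implicit.
Unset Printing Implicit Defensive.

Import Order.TTheory GRing.Theory Num.Theory.
Local Open Scope ring_scope.

(* ------------------------------------------------------------------------ *)
(* Formal power series in n variables are given by their coefficients, and  *)
(* formal maps C^n -> C^k by their k components.  Germs at 0 of holomorphic *)
(* maps are identified with their convergent Taylor series.                 *)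
(* ------------------------------------------------------------------------ *)

Definition fps (C : numClosedFieldType) (n : nat) := 'X_{1..n} -> C.

Definition fmap (C : numClosedFieldType) (n k : nat) := 'I_k -> fps C n.

(* The family a_m x^m is (unconditionally) summable with sum l. *)
Definition has_sum (C : numClosedFieldType) (n : nat)
    (a : fps C n) (x : 'rV[C]_n) (l : C) : Prop :=
  forall eps : C, 0 < eps ->
  exists A0 : {fset 'X_{1..n}},
  forall A : {fset 'X_{1..n}}, fsubset A0 A ->
    `| \sum_(m <- enum_fset A) a m * \prod_(i < n) x 0 i ^+ m i - l | < eps.

Definition convergent (C : numClosedFieldType) (n k : nat)
    (F : fmap C n k) : Prop :=
  exists2 r : C, 0 < r &
  forall x : 'rV[C]_n, (forall i, `|x 0 i| < r) ->
  forall j, exists l : C, has_sum (F j) x l.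

Definition diverges (C : numClosedFieldType) (n k : nat)
    (F : fmap C n k) : Prop := ~ convergent F.

Definition vanishes0 (C : numClosedFieldType) (n k : nat)
    (F : fmap C n k) : Prop := forall j, F j 0%MM = 0.

(* The matrix of first derivatives at 0. *)
Definition linpart (C : numClosedFieldType) (n k : nat)
    (F : fmap C n k) : 'M[C]_(k, n) := \matrix_(i, j) F i U_(j)%MM.

Definition linmap (C : numClosedFieldType) (n k : nat)
    (A : 'M[C]_(k, n)) : fmap C n k :=
  fun i m => \sum_j A i j * (m == U_(j)%MM)%:R.

Definition fid (C : numClosedFieldType) (n : nat) : fmap C n n :=
  fun i m => (m == U_(i)%MM)%:R.

Definition trunc (C : numClosedFieldType) (n d : nat)
    (f : fps C n) : {mpoly C[n]} :=
  \sum_(m : 'X_{1..n < d.+1}) f m *: 'X_[m].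

(* Composition F o G, meaningful when G vanishes at 0: the coefficients of  *)
(* F o G up to degree d then only depend on those of F and G up to degree d.*)
Definition fcomp (C : numClosedFieldType) (n k l : nat)
    (F : fmap C k l) (G : fmap C n k) : fmap C n l :=
  fun i m => (trunc (mdeg m) (F i)
                \mPo [tuple trunc (mdeg m) (G j) | j < k])@_m.

Definition formal_biholomorphism (C : numClosedFieldType) (n : nat)
    (F : fmap C n n) : Prop :=
  vanishes0 F /\ linpart F \in unitmx.

Definition biholomorphic_germ (C : numClosedFieldType) (n : nat)
    (F : fmap C n n) : Prop :=
  formal_biholomorphism F /\ convergent F.

(* ------------------------------------------------------------------------ *)
(* Coordinates on C^p x C^p are indexed by 'I_(p + p): lshift p j is the    *)
(* j-th coordinate of the first factor, rshift p j of the second one.  The  *)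
(* submanifold is z_{p+j} = E_j(z', conj z'), where E_j(z', w') is a power  *)
(* series in the 2p variables (z', w').                                     *)
(* ------------------------------------------------------------------------ *)

Definition real_analytic_germ (C : numClosedFieldType) (p : nat)
    (M : set 'rV[C]_(p + p)) (E : fmap C (p + p) p) : Prop :=
  [/\ convergent E,
      forall j (m : 'X_{1..p + p}), (mdeg m <= 1)%N -> E j m = 0 &
      exists2 r : C, 0 < r &
      forall z : 'rV[C]_(p + p), (forall i, `|z 0 i| < r) ->
        (M z <-> forall j : 'I_p,
           has_sum (E j) (row_mx (lsubmx z) (map_mx Num.conj (lsubmx z)))
                   (z 0 (rshift p j)))].

(* q_j(w'), the part of the quadratic part of E_j depending only on w'. *)
Definition qform (C : numClosedFieldType) (p : nat)
    (E : fmap C (p + p) p) (j : 'I_p) (w : 'rV[C]_p) : C :=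
  \sum_(k < p) \sum_(l < p | (k <= l)%N)
     E j (U_(rshift p k) + U_(rshift p l))%MM * w 0 k * w 0 l.

(* In the coordinates (z', w') of the complexification                      *)
(*   z_{p+j} = E_j(z', w'),  w_{p+j} = bar E_j(w', z'),                     *)
(* the projection (z, w) |-> z reads (z', w') |-> (z', E(z', w')).          *)
Definition pi1 (C : numClosedFieldType) (p : nat)
    (E : fmap C (p + p) p) : fmap C (p + p) (p + p) :=
  fun i => match split i with
           | inl j => fid C (lshift p j)
           | inr j => E j
           end.

Definition deck_transformation (C : numClosedFieldType) (p : nat)
    (E : fmap C (p + p) p) (F : fmap C (p + p) (p + p)) : Prop :=
  biholomorphic_germ F /\ fcomp (pi1 E) F = pi1 E.

Definition max_deck_transformations (C : numClosedFieldType) (p : nat)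
    (E : fmap C (p + p) p) : Prop :=
  (forall w : 'rV[C]_p, (forall j, qform E j w = 0) -> w = 0) /\
  ([set F | deck_transformation E F] #= `I_(2 ^ p))%classic%card.

(* The hypersurface is the image of a germ of embedding phi of C^(n-1). *)
Definition fixes_hypersurface (C : numClosedFieldType) (n : nat)
    (F : fmap C n n) : Prop :=
  exists phi : fmap C n.-1 n,
    [/\ vanishes0 phi, convergent phi, \rank (linpart phi) = n.-1 &
        fcomp F phi = phi].

(* Inverses are omitted: this is used inside a finite group. *)
Inductive generated (C : numClosedFieldType) (n p : nat)
    (t : 'I_p -> fmap C n n) : fmap C n n -> Prop :=
| generated_id : generated t (@fid C n)
| generated_comp j F : generated t F -> generated t (fcomp (t j) F).

Definition deck_generators (C : numClosedFieldType) (p : nat)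
    (E : fmap C (p + p) p) (t : 'I_p -> fmap C (p + p) (p + p)) : Prop :=
  [/\ forall j, deck_transformation E (t j),
      forall j, fixes_hypersurface (t j) &
      forall F, deck_transformation E F -> generated t F].

Definition swap_ord (p : nat) (i : 'I_(p + p)) : 'I_(p + p) :=
  match split i with
  | inl j => rshift p j
  | inr j => lshift p j
  end.

(* rho0 o F o rho0, where rho0(z', w') = (conj w', conj z'): the two blocks *)
(* of components and of variables are exchanged, coefficients conjugated.   *)
Definition rho0_conj (C : numClosedFieldType) (p : nat)
    (F : fmap C (p + p) (p + p)) : fmap C (p + p) (p + p) :=
  fun i m => (F (swap_ord i) [multinom m (swap_ord k) | k < p + p])^*.

Definition tau1 (C : numClosedFieldType) (n p : nat)
    (t : 'I_p -> fmap C n n) : fmap C n n :=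
  \big[@fcomp C n n n / @fid C n]_(j < p) t j.

Definition sigma (C : numClosedFieldType) (p : nat)
    (t : 'I_p -> fmap C (p + p) (p + p)) : fmap C (p + p) (p + p) :=
  fcomp (tau1 t) (rho0_conj (tau1 t)).

(* S is the linear part of sigma at 0. *)
Definition nonresonant (C : numClosedFieldType) (p : nat)
    (S : 'M[C]_(p + p)) : Prop :=
  exists2 mu : 'I_p -> C,
    char_poly S = \prod_(j < p) (('X - (mu j)%:P) * ('X - ((mu j)^-1)%:P)) &
    forall Q : 'I_p -> int, (exists j, Q j != 0) ->
      \prod_(j < p) mu j ^ Q j != 1.

Definition pure_elliptic (C : numClosedFieldType) (n : nat)
    (S : 'M[C]_n) : Prop :=
  forall mu : C, eigenvalue S mu -> mu \is Num.real.

(* Main.v *)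
Require Import Defs.
Set Warnings "-notation-overridden,-notation-incompatible-prefix,-ambiguous-paths".
From HB Require Import structures.
From mathcomp Require Import all_fingroup.
From mathcomp Require Import all_boot all_order all_algebra finmap.
From mathcomp Require Import mpoly complex.
From mathcomp Require Import boolp classical_sets cardinality reals.
From mathcomp Require Import ring lra zify.

Set Implicit Arguments.
Unset Strict Implicit.
Unset Printing Implicit Defensive.

Import Order.TTheory GRing.Theory Num.Theory.
Local Open Scope ring_scope.

(* The example is built backwards from a model of sigma in which everything can
   be computed.  On C^6 with coordinates (X_j, Y_j), let z_j = K_j X_j + Y_j and
   w_j = X_j + K_j Y_j, where K_j = kap_j (1 + X_j Y_j) for j = 1, 2 and
   K_3 = kap_3 = 3.  The involution tau_1 preserves the z_j and changes the sign
   of V_j = K_j X_j - Y_j, the third one being perturbed to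
   V_3 = K_3 X_3 - Y_3 + g z_3 with g a series in X_1, Y_1, X_2, Y_2.  In the
   coordinates (z, w) the complexification of z_(p+j) = V_j^2 has the sign
   changes of the V_j as deck transformations, and
   sigma = (tau_1 o swap)^2.  On the first two pairs tau_1 o swap is the twist
   X_j -> X_j / K_j, Y_j -> K_j Y_j; on the third pair it is linear with
   coefficients depending on the first two pairs, so that a formal Floquet
   reduction diagonalizes it with a multiplier mu = 3 + l(X_1 Y_1, X_2 Y_2).

   Divergence of l: the second variation of l in the direction of a monomial Q
   of g contains at the resonant monomial Q swap(Q) the quotient om / (om - 9),
   om = kap^Q = x^b / 2^a.  For a Liouville choice of x = kap_2 and a suitable
   lacunary g with coefficients in {-1, 0, 1} these terms make l diverge.

   Any convergent sigma* commuting with the linear part has convergent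
   multipliers S_j / Y_j.  Up to a permutation of the coordinates they are the
   multipliers kap_j^2 (1 + J_j)^2 (j = 1, 2) and mu^2(J_1, J_2), expressed
   through the invariants J_j = x_j y_j of the conjugating map.  The first two
   give back convergent J_1, J_2, which are local coordinates in the resonant
   products, so that mu, hence l, would converge. *)

(** * Formal power series *)

(** The statement quantifies over every normalizing map and every normal form, so only data forced
    by the equations can be used: multipliers of eigenfunctions and products of paired coordinates.
    Moreover [sigma_star] commutes with the linear part of sigma, while its own linear part is
    merely conjugate to it and may list the eigenvalues in another order. The dependence of the
    first two multipliers on J_1 and J_2 excludes the orders that split a pair. Small divisors need
    two independent base pairs: with kap_1 = 2 and kap_2 = x the weights x^b / 2^a approach 9 =
    kap_3^2 without reaching it, and then Q X_3 and Y_3 have nearly equal weights. The second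
    variation is used because l(g + Q) + l(g - Q) - 2 l(g) cancels whatever depends linearly on the
    new term and leaves an explicit coefficient that does not involve the earlier choices. Real data
    let the linear swap replace the antiholomorphic reflection, so that sigma is a square and one
    half map carries the whole computation. *)

Section PowerSeriesRing.
Variables (C : numClosedFieldType) (n : nat).
Implicit Types (f g h : fps C n) (m : 'X_{1..n}).

Lemma fps_ext f g : (forall m, f m = g m) -> f = g.
Proof. exact: functional_extensionality_dep. Qed.

Definition ps_add f g : fps C n := fun m => f m + g m.
Definition ps_opp f : fps C n := fun m => - f m.
Definition ps_zero : fps C n := fun=> 0.
Definition ps_one : fps C n := fun m => (m == 0%MM)%:R.
Definition ps_mul f g : fps C n := fun m =>
  \sum_(k : 'X_{1..n < (mdeg m).+1, (mdeg m).+1} | m == (k.1 + k.2)%MM)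
     f k.1 * g k.2.

HB.instance Definition _ := gen_eqMixin (fps C n).
HB.instance Definition _ := gen_choiceMixin (fps C n).

Lemma ps_addA : associative ps_add.
Proof. by move=> f g h; apply: fps_ext => m; rewrite /ps_add addrA. Qed.
Lemma ps_addC : commutative ps_add.
Proof. by move=> f g; apply: fps_ext => m; rewrite /ps_add addrC. Qed.
Lemma ps_add0 : left_id ps_zero ps_add.
Proof. by move=> f; apply: fps_ext => m; rewrite /ps_add add0r. Qed.
Lemma ps_addN : left_inverse ps_zero ps_opp ps_add.
Proof. by move=> f; apply: fps_ext => m; rewrite /ps_add addNr. Qed.

HB.instance Definition _ :=
  GRing.isZmodule.Build (fps C n) ps_addA ps_addC ps_add0 ps_addN.

Lemma mdeg_split d m k1 k2 : m = (k1 + k2)%MM -> (mdeg m <= d)%N ->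
  (mdeg k1 <= d)%N /\ (mdeg k2 <= d)%N.
Proof.
move=> ->; rewrite mdegD => h.
by split; apply: leq_trans h; rewrite ?leq_addr ?leq_addl.
Qed.

Lemma mcoeff_trunc d f m : (trunc d f)@_m = if (mdeg m <= d)%N then f m else 0.
Proof.
case: ifP => hm; first by rewrite /trunc mcoeff_mpoly.
rewrite /trunc raddf_sum big1 //= => k _; rewrite mcoeffZ mcoeffX.
case: eqP => [e|]; last by rewrite mulr0.
by have := bmdeg k; rewrite e ltnS hm.
Qed.

(** In degree at most [d] a product only sees truncations. Every ring identity for series is
    therefore inherited from polynomials, one degree at a time. *)
Lemma ps_mulE d f g m : (mdeg m <= d)%N ->
  ps_mul f g m = (trunc d f * trunc d g)@_m.
Proof.
move=> hm; rewrite mcoeffM; apply: eq_bigr => -[k1 k2] /= /eqP e.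
have [h1 h2] := mdeg_split e hm.
by rewrite !mcoeff_trunc h1 h2.
Qed.

Definition agree (d : nat) (p q : {mpoly C[n]}) :=
  forall m, (mdeg m <= d)%N -> p@_m = q@_m.

Lemma agreeM d p p' q q' : agree d p p' -> agree d q q' ->
  agree d (p * q) (p' * q').
Proof.
move=> hp hq m hm; rewrite !mcoeffM; apply: eq_bigr => -[k1 k2] /= /eqP e.
have [h1 h2] := mdeg_split e hm.
by rewrite hp // hq.
Qed.

Lemma agree_trunc_mul d f g : agree d (trunc d (ps_mul f g)) (trunc d f * trunc d g).
Proof. by move=> m hm; rewrite mcoeff_trunc hm (@ps_mulE d). Qed.

Lemma ps_mulA : associative ps_mul.
Proof.
move=> f g h; apply: fps_ext => m; rewrite !(@ps_mulE (mdeg m)) //.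
have := agree_trunc_mul (d := mdeg m); move=> H.
transitivity ((trunc (mdeg m) f * (trunc (mdeg m) g * trunc (mdeg m) h))@_m).
  exact: (agreeM (d := mdeg m)).
by rewrite mulrA; symmetry; apply: (agreeM (d := mdeg m)).
Qed.

Lemma ps_mulC : commutative ps_mul.
Proof. by move=> f g; apply: fps_ext => m; rewrite !(@ps_mulE (mdeg m)) // mulrC. Qed.

Lemma trunc_one d : trunc d ps_one = 1.
Proof.
apply/mpolyP => m; rewrite mcoeff_trunc mcoeff1 /ps_one; case: eqP => [->|].
  by rewrite mdeg0.
by rewrite if_same.
Qed.

Lemma ps_mul1 : left_id ps_one ps_mul.
Proof.
by move=> f; apply: fps_ext => m; rewrite (@ps_mulE (mdeg m)) // trunc_one mul1r mcoeff_trunc leqnn.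
Qed.

Lemma ftruncD d f g : trunc d (f + g) = trunc d f + trunc d g.
Proof.
by apply/mpolyP => m; rewrite mcoeffD !mcoeff_trunc; case: ifP => // _; rewrite addr0.
Qed.

Lemma ps_mulDl : left_distributive ps_mul ps_add.
Proof.
move=> f g h; apply: fps_ext => m; rewrite !(@ps_mulE (mdeg m)) //.
rewrite -[ps_add f g]/(f + g) ftruncD mulrDl mcoeffD.
by rewrite /ps_add !(@ps_mulE (mdeg m)).
Qed.

Lemma ps_one_neq0 : ps_one != ps_zero.
Proof.
apply/eqP => e; have /eqP : ps_one 0%MM = ps_zero 0%MM by rewrite e.
by rewrite /ps_one eqxx oner_eq0.
Qed.

HB.instance Definition _ := GRing.Zmodule_isComNzRing.Build (fps C n)
  ps_mulA ps_mulC ps_mul1 ps_mulDl ps_one_neq0.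

Lemma fcoefD f g m : (f + g) m = f m + g m. Proof. by []. Qed.
Lemma fcoefN f m : (- f) m = - f m. Proof. by []. Qed.
Lemma fcoefB f g m : (f - g) m = f m - g m. Proof. by []. Qed.
Lemma fcoef1 m : (1 : fps C n) m = (m == 0%MM)%:R. Proof. by []. Qed.
Lemma fcoefM d f g m : (mdeg m <= d)%N ->
  (f * g) m = (trunc d f * trunc d g)@_m.
Proof. exact: ps_mulE. Qed.
Lemma fcoefME f g m : (f * g) m =
  \sum_(k : 'X_{1..n < (mdeg m).+1, (mdeg m).+1} | m == (k.1 + k.2)%MM)
     f k.1 * g k.2.
Proof. by []. Qed.

Lemma fcoef_sum (I : Type) (r : seq I) (P : pred I) (F : I -> fps C n) m :
  (\sum_(i <- r | P i) F i) m = \sum_(i <- r | P i) F i m.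
Proof. by elim/big_rec2: _ => // i y1 y2 _ <-. Qed.

Definition ofmp (p : {mpoly C[n]}) : fps C n := fun m => p@_m.

Lemma ofmp_is_zmod_morphism : zmod_morphism ofmp.
Proof. by move=> p q; apply: fps_ext => m; rewrite /ofmp mcoeffB. Qed.

Lemma ofmp_is_monoid_morphism : monoid_morphism ofmp.
Proof.
split; first by apply: fps_ext => m; rewrite /ofmp mcoeff1.
by move=> p q; apply: fps_ext => m; rewrite /ofmp mcoeffM.
Qed.

HB.instance Definition _ :=
  GRing.isZmodMorphism.Build {mpoly C[n]} (fps C n) ofmp ofmp_is_zmod_morphism.
HB.instance Definition _ :=
  GRing.isMonoidMorphism.Build {mpoly C[n]} (fps C n) ofmp ofmp_is_monoid_morphism.

Definition cst (c : C) : fps C n := ofmp c%:MP.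

Lemma cst_is_zmod_morphism : zmod_morphism cst.
Proof. by move=> a b; rewrite /cst mpolyCB raddfB. Qed.
Lemma cst_is_monoid_morphism : monoid_morphism cst.
Proof. by split=> [|a b]; rewrite /cst ?rmorph1 // mpolyCM rmorphM. Qed.
HB.instance Definition _ :=
  GRing.isZmodMorphism.Build C (fps C n) cst cst_is_zmod_morphism.
HB.instance Definition _ :=
  GRing.isMonoidMorphism.Build C (fps C n) cst cst_is_monoid_morphism.

Lemma coef_cst c m : cst c m = c * (m == 0%MM)%:R.
Proof. by rewrite /cst /ofmp mcoeffC. Qed.

Lemma fcoefCM c f m : (cst c * f) m = c * f m.
Proof.
rewrite (@fcoefM (mdeg m)) //.
have -> : trunc (mdeg m) (cst c) = c%:MP.
  apply/mpolyP => k; rewrite mcoeff_trunc coef_cst mcoeffC.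
  by case: eqP => [->|]; rewrite ?mdeg0 // mulr0 if_same.
by rewrite mcoeffCM mcoeff_trunc leqnn.
Qed.

Definition mon m : fps C n := ofmp 'X_[m].

Lemma coef_mon m k : mon m k = (m == k)%:R.
Proof. by rewrite /mon /ofmp mcoeffX. Qed.

Lemma monD m k : mon (m + k)%MM = mon m * mon k.
Proof. by rewrite /mon mpolyXD rmorphM. Qed.

Lemma mon0 : mon 0%MM = 1.
Proof. by rewrite /mon mpolyX0 rmorph1. Qed.

Lemma fidE i : fid C i = mon U_(i)%MM.
Proof. by apply: fps_ext => m; rewrite coef_mon /fid eq_sym. Qed.

Lemma fcoefMX f m k : (f * mon m) (m + k)%MM = f k.
Proof.
rewrite (@fcoefM (mdeg (m + k)%MM)) //.
have -> : trunc (mdeg (m + k)%MM) (mon m) = 'X_[m].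
  apply/mpolyP => l; rewrite mcoeff_trunc coef_mon mcoeffX.
  by case: eqP => [<-|]; rewrite ?if_same // mdegD leq_addr.
by rewrite mcoeffMX mcoeff_trunc mdegD leq_addl.
Qed.

(** The monomial order is well founded. The lowest monomial plays the role of a leading term in the
    proof that series form an integral domain. *)
Lemma fps_min f : f != 0 ->
  exists2 m, f m != 0 & forall k, (k < m)%O -> f k = 0.
Proof.
move=> nz; apply: contrapT => H; case/eqP: nz; apply: fps_ext.
apply: ltmwf => m IH; apply/eqP; apply: contraT => nz.
by case: H; exists m.
Qed.

(** The order is compatible with addition, so the two lowest monomials form the only pair
    contributing to their sum. The absence of zero divisors is what allows division by the K_j, by
    the unit parts and by the V_j later on. *)
Lemma fps_mul_eq0 f g : f * g = 0 -> f = 0 \/ g = 0.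
Proof.
move=> fg0; case: (eqVneq f 0) => [|/fps_min[m fm mf]]; first by left.
case: (eqVneq g 0) => [|/fps_min[k gk kg]]; first by right.
have /eqP : (f * g) (m + k)%MM = 0 by rewrite fg0.
rewrite fcoefME.
have hm : (mdeg m < (mdeg (m + k)%MM).+1)%N by rewrite ltnS mdegD leq_addr.
have hk : (mdeg k < (mdeg (m + k)%MM).+1)%N by rewrite ltnS mdegD leq_addl.
rewrite (bigD1 (BMultinom hm, BMultinom hk)) //= big1; last first.
  move=> [[k1 h1] [k2 h2]] /= /andP[/eqP e ne].
  case: (ltP k1 m) => [/mf->|le1]; first by rewrite mul0r.
  case: (ltP k2 k) => [/kg->|le2]; first by rewrite mulr0.
  case/negP: ne; rewrite xpair_eqE !eqE /=.
  have e1 : k1 = m.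
    apply/eqP; rewrite eq_le le1 andbT leNgt; apply/negP => lt1.
    by have := ltmc_le_add lt1 le2; rewrite -e ltxx.
  rewrite e1 eqxx /=; apply/eqP.
  by move: e; rewrite e1 => /addmI.
by rewrite addr0 mulf_eq0 (negbTE fm) (negbTE gk).
Qed.

Lemma fps_mulfI f g h : f != 0 -> f * g = f * h -> g = h.
Proof.
move=> nz /eqP; rewrite -subr_eq0 -mulrBr => /eqP /fps_mul_eq0 [/eqP|/eqP].
  by rewrite (negbTE nz).
by rewrite subr_eq0 => /eqP.
Qed.

End PowerSeriesRing.

Arguments cst {C} n c.
Arguments ofmp {C n} p.


(** * Composition *)

Section OrderFiltration.
Variables (C : numClosedFieldType) (n : nat).
Implicit Types (f g h : fps C n) (m : 'X_{1..n}).

(** The powers of the maximal ideal. [ordge_eq] says that this filtration is separated and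
    [fps_fixpoint] uses that it is complete. *)
Definition ordge (d : nat) f := forall m, (mdeg m < d)%N -> f m = 0.

Lemma ordge0 f : ordge 0 f. Proof. by []. Qed.

Lemma ordge_le d e f : (d <= e)%N -> ordge e f -> ordge d f.
Proof. by move=> de H m hm; apply: H; apply: leq_trans de. Qed.

Lemma ordgeD d f g : ordge d f -> ordge d g -> ordge d (f + g).
Proof. by move=> hf hg m hm; rewrite fcoefD hf // hg // addr0. Qed.

Lemma ordgeN d f : ordge d f -> ordge d (- f).
Proof. by move=> hf m hm; rewrite fcoefN hf // oppr0. Qed.

Lemma ordgeB d f g : ordge d f -> ordge d g -> ordge d (f - g).
Proof. by move=> hf hg; apply: ordgeD => //; apply: ordgeN. Qed.

Lemma ordge_sum d (I : Type) (r : seq I) (P : pred I) (F : I -> fps C n) :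
  (forall i, P i -> ordge d (F i)) -> ordge d (\sum_(i <- r | P i) F i).
Proof.
by move=> H; elim/big_ind: _ => // [x y]; apply: ordgeD.
Qed.

Lemma ordgeM d e f g : ordge d f -> ordge e g -> ordge (d + e) (f * g).
Proof.
move=> hf hg m hm; rewrite fcoefME big1 // => -[k1 k2] /= /eqP em.
case: (ltnP (mdeg k1) d) => [/hf->|h1]; first by rewrite mul0r.
case: (ltnP (mdeg k2) e) => [/hg->|h2]; first by rewrite mulr0.
have := leq_add h1 h2; rewrite -mdegD -em leqNgt hm //.
Qed.

Lemma ordgeMl d f g : ordge d g -> ordge d (f * g).
Proof. by move=> hg; rewrite -[d]add0n; apply: ordgeM. Qed.

Lemma ordgeMr d f g : ordge d f -> ordge d (f * g).
Proof. by move=> hf; rewrite mulrC; apply: ordgeMl. Qed.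

Lemma ordgeX d f k : ordge d f -> ordge (d * k) (f ^+ k).
Proof.
move=> hf; elim: k => [|k IH]; first by rewrite muln0.
by rewrite mulnS exprS; apply: ordgeM.
Qed.

Lemma ordge1P f : ordge 1 f <-> f 0%MM = 0.
Proof.
split=> [H|H m]; first by apply: H; rewrite mdeg0.
by rewrite ltnS leqn0 mdeg_eq0 => /eqP->.
Qed.

Lemma ordge_ofmp_trunc d f : ordge d.+1 (f - ofmp (trunc d f)).
Proof.
by move=> m hm; rewrite fcoefB /ofmp mcoeff_trunc -ltnS hm subrr.
Qed.

Lemma ordge_eq f g : (forall d, ordge d (f - g)) -> f = g.
Proof.
move=> H; apply: fps_ext => m; apply/eqP; rewrite -subr_eq0 -fcoefB.
by rewrite (H (mdeg m).+1).
Qed.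

Lemma ordge_mon d m : (d <= mdeg m)%N -> ordge d (mon C m).
Proof.
move=> hm k hk; rewrite coef_mon; case: eqP => // e.
by move: hk; rewrite -e ltnNge hm.
Qed.

End OrderFiltration.

(* Locked so that [ring] and [rewrite] never try to compare two compositions
   by unfolding them. *)
HB.lock Definition comp1 (C : numClosedFieldType) n k (f : fps C k) (G : fmap C n k) : fps C n :=
  fun m => (trunc (mdeg m) f \mPo [tuple trunc (mdeg m) (G j) | j < k])@_m.

Section Composition.
Variables (C : numClosedFieldType).

Lemma fcompE n k l (F : fmap C k l) (G : fmap C n k) i :
  fcomp F G i = comp1 (F i) G.
Proof. by rewrite comp1.unlock. Qed.

(** Unlike [comp1], substitution into a polynomial is a ring morphism for every [G]. Identities for
    [comp1] are read off here and carried over modulo each order by [comp1_eval]. *)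
Definition evalp n k (G : fmap C n k) (p : {mpoly C[k]}) : fps C n :=
  mmap (@cst C n) G p.

HB.instance Definition _ n k (G : fmap C n k) :=
  GRing.RMorphism.copy (evalp G) (mmap (@cst C n) G).

Lemma evalpE n k (G : fmap C n k) p :
  evalp G p = \sum_(m <- msupp p) cst n p@_m * \prod_i G i ^+ m i.
Proof. by []. Qed.

Lemma evalpX n k (G : fmap C n k) m : evalp G 'X_[m] = \prod_i G i ^+ m i.
Proof. by rewrite /evalp mmapX. Qed.

Lemma evalpC n k (G : fmap C n k) c : evalp G c%:MP = cst n c.
Proof. by rewrite /evalp mmapC. Qed.

Lemma ordge_monomial n k (G : fmap C n k) (m : 'X_{1..k}) :
  vanishes0 G -> ordge (mdeg m) (\prod_i G i ^+ m i).
Proof.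
move=> G0; rewrite mdegE.
elim/big_rec2: _ => [|i d x _ IH]; first exact: ordge0.
by apply: ordgeM => //; rewrite -[X in ordge X]mul1n; apply: ordgeX; apply/ordge1P.
Qed.

Lemma ordge_evalp n k (G : fmap C n k) p d : vanishes0 G ->
  ordge d (ofmp p) -> ordge d (evalp G p).
Proof.
move=> G0 hp; rewrite evalpE; apply: ordge_sum => m _.
case: (ltnP (mdeg m) d) => [h|h]; last first.
  by apply: ordgeMl; apply: ordge_le h _; apply: ordge_monomial.
by move: (hp m h); rewrite /ofmp => ->; rewrite rmorph0 mul0r.
Qed.

(** Exchanging the factors one by one, each difference contributes order e + 1 and the remaining |m|
    - 1 factors contribute one each. *)
Lemma ordge_monomialB n k (G G' : fmap C n k) (m : 'X_{1..k}) e :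
  vanishes0 G -> vanishes0 G' -> (forall i, ordge e.+1 (G i - G' i)) ->
  ordge (mdeg m + e) (\prod_i G i ^+ m i - \prod_i G' i ^+ m i).
Proof.
move=> G0 G0' H.
have HX i d : ordge (d + e) (G i ^+ d - G' i ^+ d).
  elim: d => [|d IH]; first by rewrite !expr0 subrr.
  have -> : G i ^+ d.+1 - G' i ^+ d.+1 =
    (G i - G' i) * G i ^+ d + G' i * (G i ^+ d - G' i ^+ d).
    by rewrite !exprS; ring.
  apply: ordgeD.
    rewrite [X in ordge X](_ : _ = e.+1 + 1 * d)%N; last by lia.
    by apply: ordgeM => //; apply: ordgeX; apply/ordge1P.
  by rewrite addSn -add1n; apply: ordgeM => //; apply/ordge1P.
rewrite mdegE.
suff [] : [/\ ordge (\sum_i m i) (\prod_i G i ^+ m i),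
   ordge (\sum_i m i) (\prod_i G' i ^+ m i) &
   ordge (\sum_i m i + e) (\prod_i G i ^+ m i - \prod_i G' i ^+ m i)] by [].
elim/big_rec3: _ => [|i x y d _ [h1 h2 h3]].
  by split=> //; rewrite subrr.
have hX (F : fmap C n k) (F0 : vanishes0 F) : ordge (m i) (F i ^+ m i).
  by rewrite -[X in ordge X]mul1n; apply: ordgeX; apply/ordge1P.
split; try by apply: ordgeM => //; apply: hX.
have -> : G i ^+ m i * y - G' i ^+ m i * x =
   (G i ^+ m i - G' i ^+ m i) * y + G' i ^+ m i * (y - x) by ring.
apply: ordgeD; last by rewrite -addnA; apply: ordgeM => //; apply: hX.
by rewrite -addnA [X in ordge (_ + X)]addnC addnA; apply: ordgeM.
Qed.

Lemma ordge_evalpB n k (G G' : fmap C n k) p d e :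
  vanishes0 G -> vanishes0 G' -> (forall i, ordge e.+1 (G i - G' i)) ->
  ordge d (ofmp p) -> ordge (d + e) (evalp G p - evalp G' p).
Proof.
move=> G0 G0' H hp; rewrite !evalpE -sumrB; apply: ordge_sum => m _.
rewrite -mulrBr; case: (ltnP (mdeg m) d) => [h|h].
  by move: (hp m h); rewrite /ofmp => ->; rewrite rmorph0 mul0r.
apply: ordgeMl; apply: ordge_le (_ : (d + e <= mdeg m + e)%N) _.
  by rewrite leq_add2r.
exact: ordge_monomialB.
Qed.

Lemma evalp_congr n k (G G' : fmap C n k) p e :
  (forall i, ordge e (G i - G' i)) -> ordge e (evalp G p - evalp G' p).
Proof.
move=> H; rewrite !evalpE -sumrB; apply: ordge_sum => m _.
rewrite -mulrBr; apply: ordgeMl.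
have HX i d : ordge e (G i ^+ d - G' i ^+ d).
  by rewrite subrXX; apply: ordgeMr.
elim/big_rec2: _ => [|i x y _ IH]; first by rewrite subrr.
have -> : G i ^+ m i * y - G' i ^+ m i * x =
   (G i ^+ m i - G' i ^+ m i) * y + G' i ^+ m i * (y - x) by ring.
by apply: ordgeD; [apply: ordgeMr | apply: ordgeMl].
Qed.

Lemma ofmp_comp n k (p : {mpoly C[k]}) (lq : k.-tuple {mpoly C[n]}) :
  ofmp (p \mPo lq) = evalp (fun i => ofmp (tnth lq i)) p.
Proof.
rewrite evalpE comp_mpolyE raddf_sum /=; apply: eq_bigr => m _.
rewrite -mul_mpolyC rmorphM /= rmorph_prod /=; congr (_ * _).
by apply: eq_bigr => i _; rewrite rmorphXn.
Qed.

Lemma ordge_ofmp_truncB n (f : fps C n) d e : (d <= e)%N ->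
  ordge d.+1 (ofmp (trunc d f) - ofmp (trunc e f)).
Proof.
move=> de m hm; rewrite fcoefB /ofmp !mcoeff_trunc -ltnS hm.
by rewrite (leq_trans _ de) ?subrr.
Qed.

(** The truncation in [comp1] varies with the coefficient under consideration. Since [G] vanishes at
    0, one polynomial computes all coefficients up to degree [d]. *)
Lemma comp1_eval n k (f : fps C k) (G : fmap C n k) d :
  vanishes0 G -> ordge d.+1 (comp1 f G - evalp G (trunc d f)).
Proof.
move=> G0 m hm; rewrite fcoefB; apply/eqP; rewrite subr_eq0; apply/eqP.
set D := mdeg m in hm *.
have -> : comp1 f G m = ofmp (trunc D f \mPo [tuple trunc D (G j) | j < k]) m by rewrite comp1.unlock.
rewrite ofmp_comp; set G' : fmap C n k := fun i => _.
have e1 : ordge D.+1 (evalp G' (trunc D f) - evalp G (trunc D f)).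
  apply: evalp_congr => i; rewrite /G' tnth_mktuple -opprB.
  by apply/ordgeN/ordge_ofmp_trunc.
have e2 : ordge D.+1 (evalp G (trunc D f) - evalp G (trunc d f)).
  rewrite -rmorphB; apply: ordge_evalp => //.
  by rewrite rmorphB; apply: ordge_ofmp_truncB; rewrite -ltnS.
have := ordgeD e1 e2 (ltnSn _).
by rewrite addrA subrK fcoefB => /eqP; rewrite subr_eq0 => /eqP.
Qed.

Lemma comp1D n k (f g : fps C k) (G : fmap C n k) : vanishes0 G ->
  comp1 (f + g) G = comp1 f G + comp1 g G.
Proof.
move=> G0; apply: ordge_eq => -[|d] //.
have h1 := comp1_eval f (d := d) G0; have h2 := comp1_eval g (d := d) G0.
have h3 := comp1_eval (f + g) (d := d) G0.
rewrite ftruncD rmorphD /= in h3.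
have := ordgeB h3 (ordgeD h1 h2); congr ordge; ring.
Qed.

Lemma comp1M n k (f g : fps C k) (G : fmap C n k) : vanishes0 G ->
  comp1 (f * g) G = comp1 f G * comp1 g G.
Proof.
move=> G0; apply: ordge_eq => -[|d] //.
have h1 := comp1_eval f (d := d) G0; have h2 := comp1_eval g (d := d) G0.
have h3 := comp1_eval (f * g) (d := d) G0.
have h4 : ordge d.+1 (evalp G (trunc d (f * g)) - evalp G (trunc d f * trunc d g)).
  rewrite -rmorphB; apply: ordge_evalp => // m hm.
  by rewrite /ofmp mcoeffB mcoeff_trunc -ltnS hm (fcoefM _ _ (d := d)) ?subrr.
rewrite [in X in _ - X]rmorphM /= in h4.
have h5 := ordgeMr (comp1 g G) h1.
have h6 := ordgeMl (evalp G (trunc d f)) h2.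
have := ordgeB (ordgeD h3 h4) (ordgeD h5 h6); congr ordge; ring.
Qed.

Lemma comp1_ofmp n k p (G : fmap C n k) : vanishes0 G -> comp1 (ofmp p) G = evalp G p.
Proof.
move=> G0; apply: ordge_eq => -[|d] //.
have h1 := comp1_eval (ofmp p) (d := d) G0.
have h2 : ordge d.+1 (evalp G (trunc d (ofmp p)) - evalp G p).
  rewrite -rmorphB; apply: ordge_evalp => // m hm.
  by rewrite /ofmp mcoeffB mcoeff_trunc -ltnS hm subrr.
have := ordgeD h1 h2; congr ordge; ring.
Qed.

Lemma comp1_cst n k c (G : fmap C n k) : vanishes0 G -> comp1 (cst k c) G = cst n c.
Proof. by move=> G0; rewrite comp1_ofmp // evalpC. Qed.

Lemma comp1_0 n k (G : fmap C n k) : vanishes0 G -> comp1 0 G = 0.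
Proof. by move=> G0; rewrite -(rmorph0 (@cst C k)) comp1_cst // rmorph0. Qed.

Lemma comp1_1 n k (G : fmap C n k) : vanishes0 G -> comp1 1 G = 1.
Proof. by move=> G0; rewrite -(rmorph1 (@cst C k)) comp1_cst // rmorph1. Qed.

Lemma comp1N n k (f : fps C k) (G : fmap C n k) : vanishes0 G ->
  comp1 (- f) G = - comp1 f G.
Proof.
move=> G0; apply/eqP; rewrite -subr_eq0 opprK -comp1D // addNr comp1_0 //.
Qed.

Lemma comp1B n k (f g : fps C k) (G : fmap C n k) : vanishes0 G ->
  comp1 (f - g) G = comp1 f G - comp1 g G.
Proof. by move=> G0; rewrite comp1D // comp1N. Qed.

Lemma comp1X n k (f : fps C k) (G : fmap C n k) d : vanishes0 G ->
  comp1 (f ^+ d) G = comp1 f G ^+ d.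
Proof.
by move=> G0; elim: d => [|d IH]; rewrite ?expr0 ?comp1_1 // !exprS comp1M // IH.
Qed.

Lemma comp1_sum n k (I : Type) (r : seq I) (P : pred I) (F : I -> fps C k)
    (G : fmap C n k) : vanishes0 G ->
  comp1 (\sum_(i <- r | P i) F i) G = \sum_(i <- r | P i) comp1 (F i) G.
Proof.
move=> G0; elim/big_rec2: _ => [|i x y _ <-]; first by rewrite comp1_0.
by rewrite comp1D.
Qed.

Lemma comp1_mon n k m (G : fmap C n k) : vanishes0 G ->
  comp1 (mon C m) G = \prod_i G i ^+ m i.
Proof. by move=> G0; rewrite comp1_ofmp // evalpX. Qed.

Lemma comp1_fid n k i (G : fmap C n k) : vanishes0 G -> comp1 (fid C i) G = G i.
Proof.
move=> G0; rewrite fidE comp1_mon // (bigD1 i) //= mnm1E eqxx expr1.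
by rewrite big1 ?mulr1 // => j ne; rewrite mnm1E eq_sym (negbTE ne).
Qed.

Lemma ordge_comp1 n k (f : fps C k) (G : fmap C n k) d : vanishes0 G ->
  ordge d f -> ordge d (comp1 f G).
Proof.
move=> G0 hf; case: d hf => [|d] hf //.
have h1 := comp1_eval f (d := d) G0.
have h2 : ordge d.+1 (evalp G (trunc d f)).
  apply: ordge_evalp => // m hm; rewrite /ofmp mcoeff_trunc -ltnS hm; exact: hf.
have := ordgeD h1 h2; congr ordge; ring.
Qed.

(** Changing the argument in order e + 1 gains e orders in the composition. The case e = 1, where a
    map is compared with its linear part, drives the recursions of the Floquet reduction. *)
Lemma ordge_comp1B n k (f : fps C k) (G G' : fmap C n k) d e :
  vanishes0 G -> vanishes0 G' -> (forall i, ordge e.+1 (G i - G' i)) ->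
  ordge d f -> ordge (d + e) (comp1 f G - comp1 f G').
Proof.
move=> G0 G0' H hf; case E: (d + e)%N => [|D] //; rewrite -E.
have h1 := comp1_eval f (d := D) G0; have h2 := comp1_eval f (d := D) G0'.
have h3 : ordge (d + e) (evalp G (trunc D f) - evalp G' (trunc D f)).
  apply: ordge_evalpB => // m hm; rewrite /ofmp mcoeff_trunc.
  by case: ifP => // _; apply: hf.
rewrite -E in h1 h2.
have := ordgeD (ordgeB h1 h2) h3; congr ordge; ring.
Qed.

Lemma comp1_0E n k (f : fps C k) (G : fmap C n k) : vanishes0 G ->
  comp1 f G 0%MM = f 0%MM.
Proof.
move=> G0.
have h1 : ordge 1 (f - cst k (f 0%MM)).
  by apply/ordge1P; rewrite fcoefB coef_cst eqxx mulr1 subrr.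
have := ordge_comp1 G0 h1; rewrite ordge1P comp1B // comp1_cst //.
by rewrite fcoefB coef_cst eqxx mulr1 => /eqP; rewrite subr_eq0 => /eqP.
Qed.

Lemma vanishes0_comp n k l (F : fmap C k l) (G : fmap C n k) :
  vanishes0 F -> vanishes0 G -> vanishes0 (fcomp F G).
Proof. by move=> F0 G0 i; rewrite fcompE comp1_0E. Qed.

Lemma vanishes0_fid n : vanishes0 (@fid C n).
Proof. by move=> i; rewrite fidE coef_mon; case: eqP => // /(congr1 (@mdeg n)); rewrite mdeg1 mdeg0. Qed.

Lemma comp1A n k l (f : fps C l) (F : fmap C k l) (G : fmap C n k) :
  vanishes0 F -> vanishes0 G -> comp1 (comp1 f F) G = comp1 f (fcomp F G).
Proof.
move=> F0 G0; have FG0 := vanishes0_comp F0 G0.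
apply: ordge_eq => -[|d] //.
have h1 := comp1_eval f (d := d) F0.
have := ordge_comp1 G0 h1; rewrite comp1B // => h2.
have h3 := comp1_eval f (d := d) FG0.
have e : comp1 (evalp F (trunc d f)) G = evalp (fcomp F G) (trunc d f).
  rewrite !evalpE comp1_sum //.
  apply: eq_bigr => m _; rewrite comp1M // comp1_cst //; congr (_ * _).
  elim/big_rec2: _ => [|i x y _ <-]; first by rewrite comp1_1.
  by rewrite comp1M // comp1X // fcompE.
rewrite e in h2; have := ordgeB h2 h3; congr ordge; ring.
Qed.

Lemma fcompA n k l q (H : fmap C l q) (F : fmap C k l) (G : fmap C n k) :
  vanishes0 F -> vanishes0 G -> fcomp (fcomp H F) G = fcomp H (fcomp F G).
Proof.
by move=> F0 G0; apply: functional_extensionality_dep => i; rewrite !fcompE comp1A.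
Qed.

Lemma fcomp_idl n k (G : fmap C n k) : vanishes0 G -> fcomp (@fid C k) G = G.
Proof.
by move=> G0; apply: functional_extensionality_dep => i; rewrite fcompE comp1_fid.
Qed.

Lemma prodr_fid n (m : 'X_{1..n}) : \prod_i fid C i ^+ m i = mon C m.
Proof.
rewrite {2}[m]multinomUE_id.
rewrite (big_morph (@mon C n) (@monD C n) (@mon0 C n)).
by apply: eq_bigr => i _; rewrite fidE /mon -rmorphXn mpolyXn.
Qed.

Lemma comp1_id n (f : fps C n) : comp1 f (@fid C n) = f.
Proof.
have v0 := @vanishes0_fid n; apply: ordge_eq => -[|d] //.
have h1 := comp1_eval f (d := d) v0.
have e : evalp (@fid C n) (trunc d f) = ofmp (trunc d f).
  rewrite evalpE [in RHS](mpolyE (trunc d f)) raddf_sum; apply: eq_bigr => m _ /=.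
  by rewrite prodr_fid -mul_mpolyC rmorphM.
rewrite e in h1; have h2 := ordge_ofmp_trunc (d := d) f.
have := ordgeB h1 h2; congr ordge; ring.
Qed.

Lemma fcomp_idr n k (F : fmap C n k) : fcomp F (@fid C n) = F.
Proof.
by apply: functional_extensionality_dep => i; rewrite fcompE comp1_id.
Qed.

End Composition.

#[local] Opaque fcomp.

(** * Linear parts, diagonal maps and formal inverses *)

Section LinearPart.
Variable (C : numClosedFieldType).

Lemma fmap_ext n k (F G : fmap C n k) : (forall i, F i = G i) -> F = G.
Proof. exact: functional_extensionality_dep. Qed.

Lemma linmapE n k (A : 'M[C]_(k, n)) i :
  linmap A i = \sum_j cst n (A i j) * mon C U_(j)%MM.
Proof.
apply: fps_ext => m; rewrite fcoef_sum; apply: eq_bigr => j _.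
by rewrite fcoefCM coef_mon eq_sym.
Qed.

Lemma mnmU_inj n (i j : 'I_n) : (U_(i)%MM == U_(j)%MM :> 'X_{1..n}) = (i == j).
Proof.
apply/eqP/eqP => [/mnmP /(_ i)|->//]; rewrite !mnm1E eqxx.
by case: eqP => // ->.
Qed.

Lemma linpart_linmap n k (A : 'M[C]_(k, n)) : linpart (linmap A) = A.
Proof.
apply/matrixP => i j; rewrite mxE /linmap (bigD1 j) //= eqxx mulr1.
by rewrite big1 ?addr0 // => l ne; rewrite mnmU_inj eq_sym (negbTE ne) mulr0.
Qed.

Lemma vanishes0_linmap n k (A : 'M[C]_(k, n)) : vanishes0 (linmap A).
Proof.
move=> i; rewrite /linmap big1 // => j _; case: eqP => [/(congr1 (@mdeg n))|].
  by rewrite mdeg1 mdeg0.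
by rewrite mulr0.
Qed.

Lemma linmap1 n : linmap 1%:M = @fid C n.
Proof.
apply: fmap_ext => i; rewrite linmapE fidE (bigD1 i) //= mxE eqxx rmorph1 mul1r.
by rewrite big1 ?addr0 // => j ne; rewrite mxE eq_sym (negbTE ne) rmorph0 mul0r.
Qed.

Lemma comp1_linmap n k l (A : 'M[C]_(l, k)) (G : fmap C n k) i : vanishes0 G ->
  comp1 (linmap A i) G = \sum_j cst n (A i j) * G j.
Proof.
move=> G0; rewrite linmapE comp1_sum //; apply: eq_bigr => j _.
by rewrite comp1M // comp1_cst // -fidE comp1_fid.
Qed.

Lemma fcomp_linmap n k l (A : 'M[C]_(l, k)) (B : 'M[C]_(k, n)) :
  fcomp (linmap A) (linmap B) = linmap (A *m B).
Proof.
apply: fmap_ext => i; rewrite fcompE comp1_linmap; last exact: vanishes0_linmap.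
rewrite linmapE.
under eq_bigr do rewrite linmapE mulr_sumr.
rewrite exchange_big /=; apply: eq_bigr => j _.
rewrite mxE raddf_sum mulr_suml; apply: eq_bigr => h _.
by rewrite /= rmorphM mulrA.
Qed.

Lemma ordge2P n (f : fps C n) :
  f 0%MM = 0 -> (forall j, f U_(j)%MM = 0) -> ordge 2 f.
Proof.
move=> f0 f1 m; rewrite ltnS leq_eqVlt ltnS leqn0 => /orP[/mdeg1P[j /eqP->]|] //.
by rewrite mdeg_eq0 => /eqP->.
Qed.

Lemma ordge2_linpart n k (F : fmap C n k) i : vanishes0 F ->
  ordge 2 (F i - linmap (linpart F) i).
Proof.
move=> F0; apply: ordge2P => [|j]; rewrite fcoefB ?F0 ?vanishes0_linmap ?subrr //.
have := congr1 (fun M : 'M_(k, n) => M i j) (linpart_linmap (linpart F)).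
by rewrite !mxE => ->; rewrite subrr.
Qed.

Lemma linpart_comp n k l (F : fmap C k l) (G : fmap C n k) :
  vanishes0 F -> vanishes0 G -> linpart (fcomp F G) = linpart F *m linpart G.
Proof.
move=> F0 G0; apply/matrixP => i j; rewrite !mxE fcompE.
have := ordge_comp1 G0 (ordge2_linpart i F0) (_ : (mdeg U_(j) < 2)%N).
rewrite mdeg1 comp1B // fcoefB => /(_ isT)/eqP; rewrite subr_eq0 => /eqP ->.
rewrite comp1_linmap // fcoef_sum; apply: eq_bigr => h _.
by rewrite fcoefCM !mxE.
Qed.

Lemma linpart_fid n : linpart (@fid C n) = 1%:M.
Proof. by rewrite -linmap1 linpart_linmap. Qed.

Definition wt n (d : 'I_n -> C) (m : 'X_{1..n}) : C := \prod_i d i ^+ m i.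

Lemma wtD n (d : 'I_n -> C) m k : wt d (m + k)%MM = wt d m * wt d k.
Proof. by rewrite /wt -big_split; apply: eq_bigr => i _; rewrite mnmDE exprD. Qed.

Lemma wt0 n (d : 'I_n -> C) : wt d 0%MM = 1.
Proof. by rewrite /wt big1 // => i _; rewrite mnm0E. Qed.

Lemma wtU n (d : 'I_n -> C) i : wt d U_(i)%MM = d i.
Proof.
rewrite /wt (bigD1 i) //= mnm1E eqxx expr1 big1 ?mulr1 // => j ne.
by rewrite mnm1E eq_sym (negbTE ne).
Qed.

Definition dmap n (d : 'I_n -> C) : fmap C n n :=
  fun i => cst n (d i) * fid C i.

Lemma dmapE n (d : 'I_n -> C) : dmap d = linmap (diag_mx (\row_i d i)).
Proof.
apply: fmap_ext => i; rewrite linmapE (bigD1 i) //= !mxE eqxx mulr1n /dmap fidE.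
rewrite big1 ?addr0 // => j ne.
by rewrite !mxE eq_sym (negbTE ne) mulr0n rmorph0 mul0r.
Qed.

Lemma vanishes0_dmap n (d : 'I_n -> C) : vanishes0 (dmap d).
Proof. rewrite dmapE; exact: vanishes0_linmap. Qed.

Lemma comp1_dmap n (f : fps C n) (d : 'I_n -> C) m :
  comp1 f (dmap d) m = wt d m * f m.
Proof.
set g : fps C n := fun m => wt d m * f m.
suff -> : comp1 f (dmap d) = g by [].
have v0 := vanishes0_dmap d.
apply: ordge_eq => -[|e] //.
have h1 := comp1_eval f (d := e) v0.
suff h2 : evalp (dmap d) (trunc e f) = ofmp (trunc e g).
  rewrite h2 in h1.
  have h3 := ordge_ofmp_trunc (d := e) g.
  have := ordgeB h1 h3; congr ordge; ring.
apply: fps_ext => k; rewrite /ofmp mcoeff_trunc evalpE fcoef_sum.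
transitivity (\sum_(i <- msupp (trunc e f)) (trunc e f)@_i * wt d i * (i == k)%:R).
  apply: eq_bigr => i _; rewrite fcoefCM -mulrA; congr (_ * _).
  have -> : \prod_i0 dmap d i0 ^+ i i0 = cst n (wt d i) * mon C i.
    rewrite -prodr_fid /wt rmorph_prod /= -big_split; apply: eq_bigr => j _.
    by rewrite /dmap exprMn rmorphXn.
  by rewrite fcoefCM coef_mon.
case: (boolP (k \in msupp (trunc e f))) => hk.
  rewrite (bigD1_seq k) ?msupp_uniq //= eqxx mulr1 big1 => [|i ne].
    by rewrite addr0 mcoeff_trunc /g; case: ifP; rewrite ?mul0r // mulrC.
  by rewrite (negbTE ne) mulr0.
rewrite big1_seq => [|i /andP[_ hi]].
  move: hk; rewrite mcoeff_msupp negbK mcoeff_trunc /g; case: ifP => // _ /eqP->.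
  by rewrite mulr0.
case: eqP => [e1|]; last by rewrite mulr0.
by rewrite e1 (negbTE hk) in hi.
Qed.

Lemma comp1_lead n (f : fps C n) (G : fmap C n n) (d : 'I_n -> C) m :
  vanishes0 G -> (forall i, ordge 2 (G i - dmap d i)) -> ordge (mdeg m) f ->
  comp1 f G m = wt d m * f m.
Proof.
move=> G0 H hf; have v0 := vanishes0_dmap d.
have := ordge_comp1B G0 v0 (e := 1) H hf (_ : (mdeg m < _)%N).
rewrite addn1 ltnSn fcoefB comp1_dmap => /(_ isT) /eqP.
by rewrite subr_eq0 => /eqP.
Qed.

(** Contraction principle for the order filtration: the iterates stabilize degree by degree, so the
    coefficient of m in the limit is that of iterate |m| + 1. *)
Lemma fps_fixpoint (I : Type) n (Gam : (I -> fps C n) -> I -> fps C n) :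
  (forall d F F', (forall i, ordge d (F i - F' i)) ->
     forall i, ordge d.+1 (Gam F i - Gam F' i)) ->
  exists F, Gam F = F.
Proof.
move=> H; pose It d := iter d Gam (fun=> 0).
have st d e i : (d <= e)%N -> ordge d (It e i - It d i).
  elim: d e i => [|d IH] [|e] i // de.
  by rewrite /It /=; apply: H => j; apply: IH.
pose F : I -> fps C n := fun i m => It (mdeg m).+1 i m.
have hF d i : ordge d (F i - It d i).
  move=> m hm; rewrite fcoefB /F.
  have := st _ _ i hm m (ltnSn _).
  by rewrite fcoefB => /eqP; rewrite subr_eq0 => /eqP->; rewrite subrr.
exists F; apply: functional_extensionality_dep => i; apply: ordge_eq => -[|d] //.
have h1 := H d F (It d) (hF d) i.
have h2 := hF d.+1 i; rewrite /It /= -/(It d) in h2.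
have := ordgeB h1 h2; congr ordge; ring.
Qed.

Lemma near_id_inverse n (h : fmap C n n) : (forall i, ordge 2 (h i)) ->
  exists2 K : fmap C n n, vanishes0 K & forall i, K i = fid C i - comp1 (h i) K.
Proof.
move=> h2.
(* The fixed point is sought among all families of series, whereas composition requires vanishing at
   0. [nz] removes the constant terms, and the fixed point turns out to have none. *)
pose nz (F : fmap C n n) : fmap C n n := fun i => F i - cst n (F i 0%MM).
have nz0 F : vanishes0 (nz F).
  by move=> i; rewrite /nz fcoefB coef_cst eqxx mulr1 subrr.
pose Gam (F : fmap C n n) : fmap C n n := fun i => fid C i - comp1 (h i) (nz F).
have [F F' d HF i|K eK] := @fps_fixpoint 'I_n n Gam.
  have -> : Gam F' i - Gam d i = comp1 (h i) (nz d) - comp1 (h i) (nz F').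
    by rewrite /Gam; ring.
  have HN j : ordge F (nz d j - nz F' j).
    case: F HF => [|e] HF //; rewrite /nz.
    have -> : d j - cst n (d j 0%MM) - (F' j - cst n (F' j 0%MM)) =
      - (F' j - d j) + cst n ((F' j - d j) 0%MM) by rewrite fcoefB rmorphB /=; ring.
    rewrite HF ?mdeg0 // rmorph0 addr0; exact: ordgeN.
  case: F HF HN => [|e] HF HN.
    apply: ordgeB; apply: ordge_comp1 => //; exact: ordge_le (h2 i).
  by rewrite -add2n; apply: ordge_comp1B.
have eK' i : K i = fid C i - comp1 (h i) (nz K) by rewrite -{1}eK.
have K0 : vanishes0 K.
  move=> i; rewrite eK' fcoefB comp1_0E // vanishes0_fid (h2 i) ?subrr ?mdeg0 //.
exists K => // i; rewrite eK'; congr (_ - comp1 _ _).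
by apply: fmap_ext => j; rewrite /nz K0 rmorph0 subr0.
Qed.

Lemma near_id_right n (F K : fmap C n n) : vanishes0 F -> vanishes0 K ->
  (forall i, K i = fid C i - comp1 (F i - fid C i) K) -> fcomp F K = @fid C n.
Proof.
move=> F0 K0 H; apply: fmap_ext => i; rewrite fcompE.
have := H i; rewrite comp1B // comp1_fid // => /eqP.
rewrite -subr_eq0 => /eqP e; apply/eqP; rewrite -subr_eq0 -e; apply/eqP; ring.
Qed.

Lemma ordge2_near_id n (F : fmap C n n) : vanishes0 F -> linpart F = 1%:M ->
  forall i, ordge 2 (F i - fid C i).
Proof. by move=> F0 F1 i; have := ordge2_linpart i F0; rewrite F1 linmap1. Qed.

Lemma near_id_right_linpart n (F K : fmap C n n) : vanishes0 F -> vanishes0 K ->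
  linpart F = 1%:M -> fcomp F K = @fid C n -> linpart K = 1%:M.
Proof.
move=> F0 K0 F1 /(congr1 (@linpart _ _ _)).
by rewrite linpart_comp // F1 mul1mx linpart_fid.
Qed.

Lemma near_id_right_exists n (F : fmap C n n) : vanishes0 F -> linpart F = 1%:M ->
  exists2 K : fmap C n n, vanishes0 K & fcomp F K = @fid C n.
Proof.
move=> F0 F1; have [K K0 HK] := near_id_inverse (ordge2_near_id F0 F1).
by exists K => //; apply: near_id_right.
Qed.

(** A right inverse [K] is again tangent to the identity, hence has a right inverse F'. Then F = F o
    (K o F') = F'. *)
Lemma near_id_right_left n (F K : fmap C n n) : vanishes0 F -> vanishes0 K ->
  linpart F = 1%:M -> fcomp F K = @fid C n -> fcomp K F = @fid C n.
Proof.
move=> F0 K0 F1 FK; have K1 := near_id_right_linpart F0 K0 F1 FK.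
have [F' F'0 KF'] := near_id_right_exists K0 K1.
suff -> : F = F' by [].
by rewrite -[LHS]fcomp_idr -KF' -fcompA // FK fcomp_idl.
Qed.

End LinearPart.

(** * Majorant norms and convergence *)

Section MajorantNorm.
Variable (C : numClosedFieldType).

(** A weighted l^1 norm at radius [rho], cut at degree [d]. All sums stay finite, and convergence
    becomes a bound that is uniform in [d]. *)
Definition nrm n (rho : C) d (f : fps C n) : C :=
  \sum_(m : 'X_{1..n < d.+1}) `|f m| * rho ^+ mdeg m.

Lemma nrm_ge0 n rho d (f : fps C n) : 0 <= rho -> 0 <= nrm rho d f.
Proof. by move=> r0; apply: sumr_ge0 => m _; rewrite mulr_ge0 // exprn_ge0. Qed.

Lemma nrm_congr n rho d (f g : fps C n) : ordge d.+1 (f - g) -> nrm rho d f = nrm rho d g.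
Proof.
move=> H; apply: eq_bigr => m _; have := H m (bmdeg m).
by rewrite fcoefB => /eqP; rewrite subr_eq0 => /eqP->.
Qed.

Lemma nrm_trunc n rho d (f : fps C n) : nrm rho d.+1 (ofmp (trunc d f)) = nrm rho d f.
Proof.
have hw (m : 'X_{1..n < d.+1}) : (mdeg m < d.+2)%N by rewrite ltnS ltnW // bmdeg.
pose h (m : 'X_{1..n < d.+1}) : 'X_{1..n < d.+2} := BMultinom (hw m).
rewrite /nrm (bigID (fun m : 'X_{1..n < d.+2} => (mdeg m < d.+1)%N)) /=.
rewrite [X in _ + X]big1 ?addr0 => [|m hm]; last first.
  by rewrite /ofmp mcoeff_trunc -ltnS (negbTE hm) normr0 mul0r.
rewrite (reindex_onto h (fun m => insubd bm0 (m : 'X_{1..n}))) /=; last first.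
  by move=> m hm; apply: val_inj; rewrite /= insubdK.
apply: eq_big => [m|m hm].
  by rewrite bmdeg /=; apply/eqP; apply: (valKd bm0 m).
by rewrite /ofmp mcoeff_trunc -ltnS bmdeg.
Qed.

Lemma nrmD n rho d (f g : fps C n) : 0 <= rho ->
  nrm rho d (f + g) <= nrm rho d f + nrm rho d g.
Proof.
move=> r0; rewrite -big_split; apply: ler_sum => m _.
by rewrite /= -mulrDl; apply: ler_wpM2r; rewrite ?exprn_ge0 // fcoefD ler_normD.
Qed.

Lemma nrmN n rho d (f : fps C n) : nrm rho d (- f) = nrm rho d f.
Proof. by apply: eq_bigr => m _; rewrite fcoefN normrN. Qed.

Lemma nrmM n rho d (f g : fps C n) : 0 <= rho ->
  nrm rho d (f * g) <= nrm rho d f * nrm rho d g.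
Proof.
move=> r0.
pose a (k : 'X_{1..n < d.+1, d.+1}) : C :=
  `|f k.1| * rho ^+ mdeg k.1 * (`|g k.2| * rho ^+ mdeg k.2).
have a0 k : 0 <= a k by rewrite /a !mulr_ge0 // exprn_ge0.
have -> : nrm rho d f * nrm rho d g = \sum_k a k.
  by rewrite /nrm mulr_suml; under eq_bigr do rewrite mulr_sumr; rewrite pair_bigA.
have H (m : 'X_{1..n < d.+1}) : `|(f * g) m| * rho ^+ mdeg m <=
    \sum_(k : 'X_{1..n < d.+1, d.+1} | (m : 'X_{1..n}) == (k.1 + k.2)%MM) a k.
  rewrite (fcoefM _ _ (d := d)); last by rewrite -ltnS bmdeg.
  have -> := mcoeff_poly_mul (trunc d f) (trunc d g) (bmdeg m).
  apply: le_trans (ler_wpM2r (exprn_ge0 _ r0) (ler_norm_sum _ _ _)) _.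
  rewrite mulr_suml; apply: ler_sum => -[k1 k2] /= /eqP ->.
  have := bmdeg k1; have := bmdeg k2; rewrite !ltnS => hk2 hk1.
  rewrite !mcoeff_trunc hk1 hk2 normrM mdegD exprD /a /=.
  by rewrite mulrACA.
apply: le_trans; first by apply: ler_sum => m _; apply: H.
rewrite (exchange_big_dep xpredT) //=; apply: ler_sum => k _.
case: (ltnP (mdeg (k.1 + k.2)%MM) d.+1) => hk.
  by rewrite (big_pred1 (BMultinom hk)).
rewrite big_pred0 // => m; apply/eqP => e.
by move: (bmdeg m); rewrite e ltnNge hk.
Qed.

Lemma nrm_cst n rho d c : nrm rho d (cst n c) = `|c|.
Proof.
rewrite /nrm (bigD1 bm0) //= mdeg0 expr0 mulr1 coef_cst eqxx mulr1 big1 ?addr0 //.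
move=> m ne; rewrite coef_cst; case: eqP => [e|]; last by rewrite mulr0 normr0 mul0r.
by case/eqP: ne; apply: val_inj.
Qed.

Lemma nrm_fid n rho d (i : 'I_n) : 0 <= rho -> nrm rho d (fid C i) <= rho.
Proof.
move=> r0; case: d => [|d].
  rewrite /nrm big1 // => m _; rewrite fidE coef_mon; case: eqP => [e|].
    by have := bmdeg m; rewrite -e mdeg1.
  by rewrite normr0 mul0r.
have h : (mdeg U_(i)%MM < d.+2)%N by rewrite mdeg1.
rewrite /nrm (bigD1 (BMultinom h)) //= fidE coef_mon eqxx normr1 mul1r mdeg1 expr1.
rewrite big1 ?addr0 // => m ne; rewrite coef_mon; case: eqP => [e|]; last by rewrite normr0 mul0r.
by case/eqP: ne; apply: val_inj; rewrite /= e.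
Qed.

(** Shrinking the radius by [t] makes terms of order [e] smaller by t^e; this is how high order
    becomes a small norm. *)
Lemma nrm_scale n rho t d e (f : fps C n) : 0 <= rho -> 0 <= t <= 1 -> ordge e f ->
  nrm (t * rho) d f <= t ^+ e * nrm rho d f.
Proof.
move=> r0 /andP[t0 t1] hf; rewrite mulr_sumr; apply: ler_sum => m _.
case: (ltnP (mdeg m) e) => h; first by rewrite (hf _ h) normr0 !mul0r mulr0.
rewrite exprMn mulrCA; apply: ler_wpM2r.
  by rewrite mulr_ge0 // exprn_ge0.
by apply: ler_wiXn2l.
Qed.

Lemma nrm_monomial n k rho rho' d (G : fmap C n k) (m : 'X_{1..k}) : 0 <= rho -> 0 <= rho' ->
  (forall i, nrm rho d (G i) <= rho') ->
  nrm rho d (\prod_i G i ^+ m i) <= rho' ^+ mdeg m.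
Proof.
move=> r0 r0' H.
have HX i e : nrm rho d (G i ^+ e) <= rho' ^+ e.
  elim: e => [|e IH]; first by rewrite !expr0 -(rmorph1 (cst n)) nrm_cst normr1.
  rewrite !exprS; apply: le_trans (nrmM _ _ _ r0) _.
  by apply: ler_pM => //; apply: nrm_ge0.
rewrite mdegE -prodrXr.
elim/big_rec2: _ => [|i x y _ IH]; first by rewrite -(rmorph1 (cst n)) nrm_cst normr1.
apply: le_trans (nrmM _ _ _ r0) _.
by apply: ler_pM => //; apply: nrm_ge0.
Qed.

Lemma nrm_sum n rho d (I : Type) (r : seq I) (P : pred I) (F : I -> fps C n) : 0 <= rho ->
  nrm rho d (\sum_(i <- r | P i) F i) <= \sum_(i <- r | P i) nrm rho d (F i).
Proof.
move=> r0; elim/big_rec2: _ => [|i x y _ IH].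
  by rewrite -(rmorph0 (cst n)) nrm_cst normr0.
by apply: le_trans (nrmD _ _ _ r0) _; apply: lerD.
Qed.

Lemma nrm_comp1 n k rho rho' d (f : fps C k) (G : fmap C n k) :
  vanishes0 G -> 0 <= rho -> 0 <= rho' ->
  (forall i, nrm rho d (G i) <= rho') -> nrm rho d (comp1 f G) <= nrm rho' d f.
Proof.
move=> G0 r0 r0' H; rewrite (nrm_congr _ (comp1_eval f (d := d) G0)).
have -> : evalp G (trunc d f) =
    \sum_(m : 'X_{1..k < d.+1}) cst n (f m) * \prod_i G i ^+ (m : 'X_{1..k}) i.
  rewrite /trunc raddf_sum; apply: eq_bigr => m _.
  by rewrite -mul_mpolyC /= rmorphM /= evalpC evalpX.
apply: le_trans (nrm_sum _ _ _ _ r0) _; apply: ler_sum => m _.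
apply: le_trans (nrmM _ _ _ r0) _; rewrite nrm_cst.
by apply: ler_wpM2l => //; apply: nrm_monomial.
Qed.

(** Two forms of convergence: [cvm], with a common radius, behaves well under composition, while
    [geo] is tested one component at a time on coefficients. They agree by [cvmP]. *)
Definition cvm n k (F : fmap C n k) :=
  exists rho B : C, [/\ 0 < rho, 0 <= B & forall i d, nrm rho d (F i) <= B].

Definition geo n (f : fps C n) :=
  exists R B : C, [/\ 0 <= R, 0 <= B & forall m, `|f m| <= B * R ^+ mdeg m].

Lemma sum_geometric (d : nat) : \sum_(k < d.+1) (2^-1 : C) ^+ k <= 2.
Proof.

have -> : \sum_(k < d.+1) (2^-1 : C) ^+ k = 2 - 2^-1 ^+ d.
  elim: d => [|d IH].
    by rewrite big_ord1 !expr0 -[2]/(1 + 1) addrK.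
  rewrite big_ord_recr /= IH !exprS; set x := _ ^+ d.
  by field.
by rewrite lerBlDr lerDl exprn_ge0 // invr_ge0 ler0n.
Qed.

(** The monomials of degree at most [d] embed into a box of exponents, over which the sum factors
    into [n] geometric sums, each at most 2. *)
Lemma sum_monomials_le n (d : nat) :
  \sum_(m : 'X_{1..n < d.+1}) (2^-1 : C) ^+ mdeg m <= 2 ^+ n.
Proof.
have t0 : 0 <= (2^-1 : C) by rewrite invr_ge0 ler0n.
have hlt (m : 'X_{1..n < d.+1}) i : ((m : 'X_{1..n}) i < d.+1)%N.
  apply: leq_ltn_trans (bmdeg m); rewrite mdegE (bigD1 i) //=; exact: leq_addr.
pose h (m : 'X_{1..n < d.+1}) : {ffun 'I_n -> 'I_d.+1} :=
  [ffun i => Ordinal (hlt m i)].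
have hinj : injective h.
  move=> m m' /ffunP e; apply: val_inj; apply/mnmP => i.
  by have := congr1 val (e i); rewrite !ffunE.
pose F (g : {ffun 'I_n -> 'I_d.+1}) : C := \prod_i 2^-1 ^+ g i.
have -> : \sum_(m : 'X_{1..n < d.+1}) (2^-1 : C) ^+ mdeg m = \sum_m F (h m).
  apply: eq_bigr => m _; rewrite mdegE -prodrXr; apply: eq_bigr => i _.
  by rewrite ffunE.
have F0 g : 0 <= F g by apply: prodr_ge0 => i _; rewrite exprn_ge0.
apply: le_trans (_ : \sum_g F g <= _).
  rewrite [leRHS](bigID (mem (h @: setT))) /= big_imset /=; last by move=> x y _ _; apply: hinj.
  rewrite [X in _ <= X + _](eq_bigl xpredT) => [|m]; last by rewrite in_setT.
  by rewrite lerDl; apply: sumr_ge0.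
rewrite /F -(bigA_distr_bigA (fun (_ : 'I_n) (k : 'I_d.+1) => (2^-1 : C) ^+ k)).
rewrite prodr_const card_ord; apply: lerXn2r; last exact: sum_geometric.
  by rewrite nnegrE; apply: sumr_ge0 => k _; rewrite exprn_ge0.
by rewrite nnegrE ler0n.
Qed.

Lemma nrm_coef n rho d (f : fps C n) m : 0 <= rho -> (mdeg m <= d)%N ->
  `|f m| * rho ^+ mdeg m <= nrm rho d f.
Proof.
move=> r0 hm; have h : (mdeg m < d.+1)%N by [].
rewrite /nrm (bigD1 (BMultinom h)) //= lerDl; apply: sumr_ge0 => k _.
by rewrite mulr_ge0 // exprn_ge0.
Qed.

Lemma cvmP n k (F : fmap C n k) : cvm F <-> forall i, geo (F i).
Proof.
split=> [[rho [B [r0 B0 H]]] i|H].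
  exists rho^-1, B; split=> //; first by rewrite invr_ge0 ltW.
  move=> m; rewrite exprVn -ler_pdivrMr ?invr_gt0 ?exprn_gt0 // invrK.
  by apply: le_trans (H i (mdeg m)); apply: nrm_coef => //; apply: ltW.
have /choice [R hR] := H; have /choice [B hB] := hR.
pose R' := \sum_i R i; pose B' := \sum_i B i.
have Ri0 i : 0 <= R i by case: (hB i).
have Bi0 i : 0 <= B i by case: (hB i).
have R0 : 0 <= R' by apply: sumr_ge0.
have B0 : 0 <= B' by apply: sumr_ge0.
have RR i : R i <= R' by rewrite /R' (bigD1 i) //= lerDl sumr_ge0.
have BB i : B i <= B' by rewrite /B' (bigD1 i) //= lerDl sumr_ge0.
have P0 : 0 < R' + 1 by rewrite ltr_wpDl.
(* Half of a common radius 1 / (R' + 1): the general term is then dominated by B' times a power of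
   1/2. *)
exists (2^-1 * (R' + 1)^-1), (B' * 2 ^+ n).
split; first by rewrite mulr_gt0 // invr_gt0 // ltr0n.
  by rewrite mulr_ge0 // exprn_ge0.
move=> i d; apply: le_trans (ler_wpM2l B0 (sum_monomials_le n d)).
rewrite mulr_sumr; apply: ler_sum => m _.
have [_ _ /(_ m) h] := hB i.
rewrite exprMn mulrCA mulrC; apply: ler_wpM2r.
  by rewrite exprn_ge0 // invr_ge0 ler0n.
rewrite exprVn ler_pdivrMr ?exprn_gt0 //; apply: le_trans h _.
apply: ler_pM => //; first by rewrite exprn_ge0.
by apply: lerXn2r; rewrite ?nnegrE //; [apply: ltW | rewrite (le_trans (RR i)) // lerDl].
Qed.

Lemma geoP n (f : fps C n) : geo f <-> exists rho B : C,
  [/\ 0 < rho, 0 <= B & forall d, nrm rho d f <= B].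
Proof.
split=> [H|[rho [B [r0 B0 H]]]].
  have /cvmP [rho [B [r0 B0 HB]]] : forall i : 'I_1, geo ((fun=> f) i : fps C n) by [].
  by exists rho, B; split=> // d; apply: (HB ord0).
suff /cvmP /(_ ord0) : cvm (fun _ : 'I_1 => f) by [].
by exists rho, B; split.
Qed.

Lemma geo2P n (f g : fps C n) : geo f -> geo g -> exists rho B : C,
  [/\ 0 < rho, 0 <= B, forall d, nrm rho d f <= B & forall d, nrm rho d g <= B].
Proof.
move=> hf hg; pose F : fmap C n 2 := fun i => if i == ord0 then f else g.
have /cvmP [rho [B [r0 B0 HB]]] : forall i, geo (F i) by move=> i; rewrite /F; case: ifP.
exists rho, B; split=> // d; [exact: (HB ord0) | exact: (HB (lift ord0 ord0))].
Qed.

Lemma geoD n (f g : fps C n) : geo f -> geo g -> geo (f + g).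
Proof.
move=> hf hg; have [rho [B [r0 B0 Hf Hg]]] := geo2P hf hg.
apply/geoP; exists rho, (B + B); split; rewrite ?addr_ge0 // => d.
by apply: le_trans (nrmD _ _ _ (ltW r0)) _; apply: lerD.
Qed.

Lemma geoN n (f : fps C n) : geo f -> geo (- f).
Proof. by case=> R [B [R0 B0 H]]; exists R, B; split=> // m; rewrite fcoefN normrN. Qed.

Lemma geoB n (f g : fps C n) : geo f -> geo g -> geo (f - g).
Proof. by move=> hf hg; apply: geoD => //; apply: geoN. Qed.

Lemma geoM n (f g : fps C n) : geo f -> geo g -> geo (f * g).
Proof.
move=> hf hg; have [rho [B [r0 B0 Hf Hg]]] := geo2P hf hg.
apply/geoP; exists rho, (B * B); split; rewrite ?mulr_ge0 // => d.
by apply: le_trans (nrmM _ _ _ (ltW r0)) _; apply: ler_pM => //; apply: nrm_ge0; apply: ltW.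
Qed.

Lemma geo_cst n c : geo (cst n c).
Proof.
by apply/geoP; exists 1, `|c|; split=> // d; rewrite nrm_cst.
Qed.

Lemma geo_fid n (i : 'I_n) : geo (fid C i).
Proof. by apply/geoP; exists 1, 1; split=> [||d]; rewrite ?ltr01 ?ler01 ?nrm_fid ?ler01. Qed.

Lemma geo_sum n (I : Type) (r : seq I) (P : pred I) (F : I -> fps C n) :
  (forall i, P i -> geo (F i)) -> geo (\sum_(i <- r | P i) F i).
Proof.
move=> H; elim/big_ind: _ => // [|x y]; last exact: geoD.
by rewrite -(rmorph0 (cst n)); apply: geo_cst.
Qed.

Lemma geoX n (f : fps C n) d : geo f -> geo (f ^+ d).
Proof.
move=> hf; elim: d => [|d IH]; last by rewrite exprS; apply: geoM.
by rewrite expr0 -(rmorph1 (cst n)); apply: geo_cst.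
Qed.

Lemma geo_divX n (f : fps C n) m : geo (f * mon C m) -> geo f.
Proof.
case=> R [B [R0 B0 H]]; exists R, (B * R ^+ mdeg m).
split=> //; first by rewrite mulr_ge0 // exprn_ge0.
by move=> k; rewrite -(fcoefMX f m k) -mulrA -exprD -mdegD; apply: H.
Qed.

Lemma scale_exists (r a : C) : 0 < r -> 0 <= a ->
  exists t : C, [/\ 0 < t, t <= 1 & t * a <= r].
Proof.
move=> r0 a0; have h : 0 < r + a by rewrite ltr_wpDr.
exists (r / (r + a)); split; first by rewrite divr_gt0.
  by rewrite ler_pdivrMr // mul1r lerDl.
by rewrite mulrAC ler_pdivrMr //; apply: ler_wpM2l; rewrite ?lerDr ltW.
Qed.

Lemma cvm_comp1 n k (f : fps C k) (G : fmap C n k) :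
  vanishes0 G -> geo f -> cvm G -> geo (comp1 f G).
Proof.
move=> G0 /geoP[rf [Bf [rf0 Bf0 Hf]]] [rG [BG [rG0 BG0 HG]]].
have [t [t0 t1 tB]] := scale_exists rf0 BG0.
apply/geoP; exists (t * rG), Bf; split=> //; first by rewrite mulr_gt0.
move=> d; apply: le_trans (Hf d); apply: nrm_comp1 => //.
- by rewrite mulr_ge0 // ltW.
- exact: ltW.
move=> i; apply: le_trans tB.
apply: le_trans (_ : t ^+ 1 * nrm rG d (G i) <= _); last by rewrite expr1 ler_wpM2l // ltW.
apply: nrm_scale; first exact: ltW.
  by rewrite (ltW t0).
by apply/ordge1P; apply: G0.
Qed.

Lemma cvm_comp n k l (F : fmap C k l) (G : fmap C n k) :
  vanishes0 G -> cvm F -> cvm G -> cvm (fcomp F G).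
Proof. by move=> G0 /cvmP HF HG; apply/cvmP => i; rewrite fcompE; apply: cvm_comp1. Qed.

Lemma cvm_linmap n k (A : 'M[C]_(k, n)) : cvm (linmap A).
Proof.
apply/cvmP => i; rewrite linmapE; apply: geo_sum => j _; apply: geoM.
  exact: geo_cst.
by rewrite -fidE; apply: geo_fid.
Qed.

(** As [h] has order 2, the recursion K = id - h o K computes degree d + 1 from the truncation of
    [K] at degree d. The bound 2 rho therefore propagates from each degree to the next. *)
Lemma cvm_near_id_inverse n (h K : fmap C n n) : vanishes0 K ->
  (forall i, ordge 2 (h i)) -> cvm h ->
  (forall i, K i = fid C i - comp1 (h i) K) -> cvm K.
Proof.
move=> K0 h2 [r [B [r0 B0 HB]]] HK.
(* with t = 2 rho / r this rho satisfies t <= 1 and t^2 B <= rho *)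
pose rho := r ^+ 2 / (4 * B + 2 * r).
have den0 : 0 < 4 * B + 2 * r.
  by rewrite ltr_wpDl ?mulr_ge0 ?mulr_gt0 ?ltr0n ?ler0n.
have rho0 : 0 < rho by apply: divr_gt0 => //; apply: exprn_gt0.
pose t := 2 * r / (4 * B + 2 * r).
have tr : t * r = 2 * rho by rewrite /t /rho expr2; ring.
have t0 : 0 <= t.
  by apply: divr_ge0; apply: ltW => //; apply: mulr_gt0; rewrite ?ltr0n.
have t1 : t <= 1 by rewrite ler_pdivrMr // mul1r lerDr mulr_ge0 // ler0n.
have tB : t ^+ 2 * B <= rho.
  have -> : t ^+ 2 * B = rho * (4 * B / (4 * B + 2 * r)).
    by rewrite /t /rho; field; rewrite gt_eqF.
  rewrite -[leRHS]mulr1; apply: ler_wpM2l; first exact: ltW.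
  by rewrite ler_pdivrMr // mul1r lerDl mulr_ge0 ?ler0n // ltW.
clearbody t rho.
have rho20 : 0 <= 2 * rho by rewrite mulr_ge0 ?ler0n // ltW.
have main d i : nrm rho d (K i) <= 2 * rho.
  elim: d i => [|d IH] i.
    rewrite /nrm big1 // => m _.
    have : mdeg m == 0%N by have := bmdeg m; rewrite ltnS leqn0.
    by rewrite mdeg_eq0 => /eqP ->; rewrite K0 normr0 mul0r.
  rewrite HK; apply: le_trans (nrmD _ _ _ (ltW rho0)) _; rewrite nrmN.
  rewrite -[2]/(1 + 1) mulrDl !mul1r; apply: lerD.
    by apply: nrm_fid; apply: ltW.
  pose Kd : fmap C n n := fun j => ofmp (trunc d (K j)).
  have Kd0 : vanishes0 Kd by move=> j; rewrite /Kd /ofmp mcoeff_trunc mdeg0 /= K0.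
  have hKd j : ordge d.+1 (K j - Kd j) by apply: ordge_ofmp_trunc.
  rewrite (nrm_congr _ (ordge_comp1B K0 Kd0 hKd (h2 i))).
  apply: le_trans tB.
  apply: le_trans (_ : nrm (t * r) d.+1 (h i) <= _); last first.
    apply: le_trans (_ : t ^+ 2 * nrm r d.+1 (h i) <= _).
      by apply: nrm_scale => //; rewrite ?t0 ?t1 // ltW.
    by rewrite ler_wpM2l // exprn_ge0.
  rewrite tr; apply: nrm_comp1 => // [|j]; first exact: ltW.
  by rewrite nrm_trunc.
by exists rho, (2 * rho); split.
Qed.


(** With S = (1 + l)^2 - 1 one has l = (S - l^2) / 2. At a radius where S has norm at most 1/2, the
    bound 1/2 for l reproduces itself degree by degree. *)
Lemma geo_sqrt n (l : fps C n) : l 0%MM = 0 -> geo ((1 + l) ^+ 2) -> geo l.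
Proof.
move=> l0 hS; pose S := (1 + l) ^+ 2 - 1.
have /geoP [r [B [r0 B0 HB]]] : geo S.
  by apply: geoB => //; rewrite -(rmorph1 (cst n)); apply: geo_cst.
have S0 : ordge 1 S.
  have -> : S = l * (2 + l) by rewrite /S; ring.
  by apply: ordgeMr; apply/ordge1P.
have h2 : 0 < (2^-1 : C) by rewrite invr_gt0 ltr0n.
have [t [t0 t1 tB]] := scale_exists h2 B0.
have tr0 : 0 <= t * r by rewrite mulr_ge0 // ltW.
have HS d : nrm (t * r) d S <= 2^-1.
  apply: le_trans tB; apply: le_trans (_ : t ^+ 1 * nrm r d S <= _).
    by apply: nrm_scale; rewrite ?(ltW t0) ?(ltW r0) ?t1.
  by rewrite expr1 ler_wpM2l // ltW.
have el : l = cst n 2^-1 * (S - l * l).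
  have -> : S - l * l = cst n 2 * l.
    by rewrite /S -[2]/(1 + 1) rmorphD rmorph1; ring.
  by rewrite mulrA -rmorphM mulVf ?pnatr_eq0 // rmorph1 mul1r.
apply/geoP; exists (t * r), 2^-1; split; rewrite ?mulr_gt0 ?ltW //.
elim=> [|d IH].
  rewrite /nrm big1 ?ltW // => m _.
  have : mdeg m == 0%N by have := bmdeg m; rewrite ltnS leqn0.
  by rewrite mdeg_eq0 => /eqP ->; rewrite l0 normr0 mul0r.
pose ld : fps C n := ofmp (trunc d l).
have hl : ordge d.+1 (l - ld) by apply: ordge_ofmp_trunc.
have e2 : ordge d.+2 (l * l - ld * ld).
  have -> : l * l - ld * ld = (l - ld) * (l + ld) by ring.
  rewrite -addn1; apply: ordgeM => //.
  by apply/ordge1P; rewrite fcoefD /ld /ofmp mcoeff_trunc mdeg0 /= l0 addr0.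
rewrite el; apply: le_trans (nrmM _ _ _ tr0) _.
rewrite nrm_cst ger0_norm ?(ltW h2) // -[leRHS]mulr1; apply: ler_wpM2l; first exact: ltW.
apply: le_trans (nrmD _ _ _ tr0) _; rewrite nrmN.
have -> : (1 : C) = 2^-1 + 2^-1 by field.
apply: lerD => //; rewrite (nrm_congr _ e2).
apply: le_trans (nrmM _ _ _ tr0) _; rewrite /ld !nrm_trunc.
apply: le_trans (_ : 2^-1 * 2^-1 <= _); first by apply: ler_pM => //; apply: nrm_ge0.
rewrite -[leRHS]mulr1; apply: ler_wpM2l; first exact: ltW.
by rewrite invf_le1 ?ltr0n // ler1n.
Qed.

(** The same [K] is the formal inverse and is convergent as soon as [F] is, so formal and convergent
    inverses never have to be compared. *)
Lemma inverse_exists n (F : fmap C n n) : vanishes0 F -> linpart F \in unitmx ->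
  exists K : fmap C n n, [/\ vanishes0 K, fcomp F K = @fid C n,
    fcomp K F = @fid C n & cvm F -> cvm K].
Proof.
move=> F0 uF; set A := linpart F.
have vA (M : 'M[C]_n) := vanishes0_linmap M.
pose F' := fcomp (linmap (invmx A)) F.
have F'0 : vanishes0 F' by apply: vanishes0_comp.
have F'1 : linpart F' = 1%:M by rewrite linpart_comp // linpart_linmap mulVmx.
have h2 := ordge2_near_id F'0 F'1.
have [K K0 HK] := near_id_inverse h2.
have FK := near_id_right F'0 K0 HK; have KF := near_id_right_left F'0 K0 F'1 FK.
have FE : fcomp (linmap A) F' = F.
  rewrite /F' -(fcompA (linmap A) (vA _) F0) fcomp_linmap mulmxV // linmap1.
  exact: fcomp_idl.
have KA0 : vanishes0 (fcomp K (linmap (invmx A))) by apply: vanishes0_comp.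
exists (fcomp K (linmap (invmx A))); split; first exact: KA0.
- rewrite -{1}FE (fcompA _ F'0 KA0) -(fcompA F' K0 (vA _)) FK (fcomp_idl (vA _)).
  by rewrite fcomp_linmap mulmxV // linmap1.
- by rewrite (fcompA K (vA _) F0).
move=> cF; apply: (cvm_comp (vA _)) (cvm_linmap _).
have /cvmP cF' : cvm F' by apply: (cvm_comp F0) cF; apply: cvm_linmap.
apply: (cvm_near_id_inverse K0 h2) HK.
by apply/cvmP => i; apply: geoB => //; apply: geo_fid.
Qed.

End MajorantNorm.

(** * Majorant bounds and unconditional summability *)

Section ConvergentBounded.
Variables (C : numClosedFieldType).

(** Summability at a single point with equal positive coordinates suffices: adding one monomial to
    the finite set [A0] moves the partial sum by less than 2, which bounds every term outside
    [A0]. *)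
Lemma convergent_cvm n k (F : fmap C n k) : convergent F -> cvm F.
Proof.
case=> r r0 H; apply/cvmP => j.
pose s := r / 2.
have s0 : 0 < s by rewrite divr_gt0 // ltr0n.
have [|l Hl] := H (const_mx s) _ j.
  move=> i; rewrite mxE gtr0_norm // ltr_pdivrMr ?ltr0n //.
  by rewrite mulr_natr mulr2n ltrDl.
have xE (m : 'X_{1..n}) : \prod_(i < n) (const_mx s : 'rV[C]_n) 0 i ^+ m i = s ^+ mdeg m.
  by rewrite mdegE -prodrXr; apply: eq_bigr => i _; rewrite mxE.
have [A0 HA] := Hl 1 ltr01.
pose B := 2 + \sum_(m <- enum_fset A0) `|F j m| * s ^+ mdeg m.
have B0 : 0 <= \sum_(m <- enum_fset A0) `|F j m| * s ^+ mdeg m.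
  by apply: sumr_ge0 => m _; rewrite mulr_ge0 // exprn_ge0 // ltW.
exists s^-1, B; split; first by rewrite invr_ge0 ltW.
  by rewrite addr_ge0 ?ler0n.
move=> m; rewrite exprVn ler_pdivlMr ?exprn_gt0 //.
case: (boolP (m \in A0)) => mA.
  rewrite /B (big_fsetD1 m) //= addrCA lerDl addr_ge0 ?ler0n //.
  by apply: sumr_ge0 => k' _; rewrite mulr_ge0 // exprn_ge0 // ltW.
apply: le_trans (_ : 2 <= _); last by rewrite lerDl.
have h1 := HA _ (fsubset_refl A0).
have h2 := HA _ (fsubsetU1 m A0).
rewrite big_fsetU1 //= in h2.
rewrite -(ger0_norm (exprn_ge0 (mdeg m) (ltW s0))) -normrM -xE.
set a := F j m * _ in h2 *; set S := \sum_(_ <- _) _ in h1 h2.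
have -> : a = (a + S - l) - (S - l) by ring.
apply: le_trans (ler_normB _ _) _; rewrite -[2]/(1 + 1).
by apply: lerD; apply: ltW.
Qed.

End ConvergentBounded.

Section Summability.
Variables (R : realType) (T : choiceType).
Local Notation C := R[i].
Implicit Types (u : T -> C).

Definition hs u (l : C) := forall eps : C, 0 < eps ->
  exists A0 : {fset T}, forall A : {fset T}, fsubset A0 A ->
    `| \sum_(m <- enum_fset A) u m - l | < eps.

Lemma hsD u v l l' : hs u l -> hs v l' -> hs (fun m => u m + v m) (l + l').
Proof.
move=> hu hv eps e0; have e2 : 0 < eps / 2 by rewrite divr_gt0 // ltr0n.
have [A HA] := hu _ e2; have [B HB] := hv _ e2.
exists (A `|` B)%fset => D; rewrite fsubUset => /andP[/HA h1 /HB h2].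
rewrite big_split /= [eps]splitr; set x := \sum_(_ <- _) _; set y := \sum_(_ <- _) _.
have -> : x + y - (l + l') = (x - l) + (y - l') by ring.
by apply: le_lt_trans (ler_normD _ _) _; apply: ltrD.
Qed.

Lemma hsZ c u l : hs u l -> hs (fun m => c * u m) (c * l).
Proof.
move=> hu eps e0; have c1 : 0 < `|c| + 1 by rewrite ltr_wpDl.
have [A HA] := hu (eps / (`|c| + 1)) (divr_gt0 e0 c1).
exists A => D /HA; rewrite ltr_pdivlMr // => h.
rewrite -mulr_sumr -mulrBr normrM; apply: le_lt_trans h.
by rewrite mulrC ler_wpM2l // lerDl.
Qed.

Lemma hs_pos (v : T -> R) (B : R) : (forall m, 0 <= v m) ->
  (forall A : {fset T}, \sum_(m <- enum_fset A) v m <= B) ->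
  exists l : R, hs (fun m => (v m)%:C%C) l%:C%C.
Proof.
move=> v0 HB.
pose E : set R := fun y => exists A : {fset T}, y = \sum_(m <- enum_fset A) v m.
have supE : has_sup E.
  split; first by exists (\sum_(m <- enum_fset fset0) v m); exists fset0.
  by exists B => y [A ->]; apply: HB.
exists (sup E) => eps; rewrite ltcE /= => /andP[/eqP ime e0].
have [_ [A0 ->] hA0] := sup_adherent e0 supE.
exists A0 => A sA.
have le1 : \sum_(m <- enum_fset A0) v m <= \sum_(m <- enum_fset A) v m.
  rewrite (big_fsetID _ (mem A0) A) /= ?lerDl.
  have -> : [fset x in A | x \in A0]%fset = A0.
    apply/fsetP => x; rewrite !inE /=; case: (boolP (x \in A0)) => h; rewrite ?andbF ?andbT //.
    by apply: (fsubsetP sA).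
  by rewrite lerDl; apply: sumr_ge0.
have le2 : \sum_(m <- enum_fset A) v m <= sup E.
  by apply: sup_upper_bound => //; exists A.
rewrite -raddf_sum -rmorphB /= normc_def /= expr0n addr0 sqrtr_sqr.
rewrite ltcE /= ime eqxx /= ler0_norm ?subr_le0 // opprB.
by rewrite ltrBlDr -ltrBlDl (lt_le_trans hA0).
Qed.

Lemma hs_abs u (B : C) :
  (forall A : {fset T}, \sum_(m <- enum_fset A) `|u m| <= B) -> exists l, hs u l.
Proof.
move=> HB.
have HR (A : {fset T}) : \sum_(m <- enum_fset A) complex.Re `|u m| <= complex.Re B.
  have := HB A; rewrite lecE => /andP[_]; congr (_ <= _).
  by rewrite -[LHS]/(complex.Re _) (raddf_sum (@complex.Re R : {additive _ -> _})).
have nRe m : `|complex.Re (u m)| <= complex.Re `|u m|.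
  rewrite normc_def /= -sqrtr_sqr ler_wsqrtr // lerDl sqr_ge0 //.
have nIm m : `|complex.Im (u m)| <= complex.Re `|u m|.
  rewrite normc_def /= -sqrtr_sqr ler_wsqrtr // lerDr sqr_ge0 //.
have key (w : T -> R) : (forall m, `|w m| <= complex.Re `|u m|) ->
    exists l : C, hs (fun m => (w m)%:C%C) l.
  (* The values 1 and -1 of [s] give the positive and the negative part of [w]. Both are nonnegative
     with bounded partial sums, and [w] is their difference. *)
  move=> hw; have pos s : s = 1 \/ s = -1 ->
      exists l : R, hs (fun m => ((`|w m| + s * w m) / 2)%:C%C) l%:C%C.
    move=> hs1.
    have ub m : (`|w m| + s * w m) / 2 <= complex.Re `|u m|.
      rewrite ler_pdivrMr ?ltr0n // mulr_natr mulr2n; apply: lerD => //.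
      apply: le_trans (hw m); case: hs1 => ->; rewrite ?mul1r ?mulN1r; first exact: ler_norm.
      by rewrite lerNl lerNnormlW.
    apply: (hs_pos (B := complex.Re B)) => [m|A].
      rewrite divr_ge0 ?ler0n // -lerBlDr sub0r.
      case: hs1 => ->; rewrite ?mul1r ?mulN1r ?opprK; last exact: ler_norm.
      by rewrite lerNl lerNnormlW.
    by apply: le_trans (HR A); apply: ler_sum.
  have [l1 h1] := pos 1 (or_introl erefl).
  have [l2 h2] := pos (-1) (or_intror erefl).
  exists (l1%:C%C + (-1) * l2%:C%C); have := hsD h1 (hsZ (-1) h2).
  congr hs; apply: functional_extensionality_dep => m.
  rewrite mul1r !mulN1r -[in LHS](rmorphB (real_complex R)) /=; congr (_%:C)%C; by field.
have [l1 h1] := key _ nRe; have [l2 h2] := key _ nIm.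
exists (l1 + 'i%C * l2); have := hsD h1 (hsZ 'i%C h2).
by congr hs; apply: functional_extensionality_dep => m; rewrite -complexE.
Qed.

End Summability.

Section BoundedConvergent.
Variable (R : realType).

Lemma cvm_convergent n k (F : fmap R[i] n k) : cvm F -> convergent F.
Proof.
case=> rho [B [r0 B0 HB]]; exists rho => // x hx j.
suff [l hl] : exists l, hs (fun m => F j m * \prod_(i < n) x 0 i ^+ m i) l by exists l.
apply: (hs_abs (B := B)) => A.
pose d := \max_(m <- enum_fset A) mdeg m.
have hd m : m \in A -> (mdeg m < d.+1)%N.
  by move=> mA; rewrite ltnS /d (big_fsetD1 m) //= leq_maxl.
apply: le_trans (HB j d).
apply: le_trans (_ : \sum_(m <- enum_fset A) `|F j m| * rho ^+ mdeg m <= _).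
  apply: ler_sum => m _; rewrite normrM; apply: ler_wpM2l => //.
  rewrite normr_prod mdegE -prodrXr; apply: ler_prod => i _; rewrite normr_ge0 normrX /=.
  by apply: lerXn2r; rewrite ?nnegrE // ?ltW.
pose h (m : 'X_{1..n}) : 'X_{1..n < d.+1} := insubd bm0 m.
pose G (m : 'X_{1..n < d.+1}) := `|F j m| * rho ^+ mdeg m.
have -> : \sum_(m <- enum_fset A) `|F j m| * rho ^+ mdeg m = \sum_(m <- map h (enum_fset A)) G m.
  rewrite big_map big_seq [RHS]big_seq; apply: eq_bigr => m mA.
  by rewrite /G insubdK //; apply: hd.
have un : uniq (map h (enum_fset A)).
  rewrite map_inj_in_uniq ?fset_uniq // => m m' /hd mA /hd mA' e.
  by have := congr1 val e; rewrite !insubdK.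
rewrite (big_uniq _ un) /= /nrm.
rewrite [leRHS](bigID (mem (map h (enum_fset A)))) /= lerDl.
by apply: sumr_ge0 => m _; rewrite /G mulr_ge0 // exprn_ge0 // ltW.
Qed.

Lemma convergentP n k (F : fmap R[i] n k) : convergent F <-> cvm F.
Proof. by split; [apply: convergent_cvm | apply: cvm_convergent]. Qed.

End BoundedConvergent.

(** * Resonant series *)

Section Resonance.
Variables (C : numClosedFieldType).

Lemma coef_mul_lead n (g h : fps C n) m : ordge (mdeg m) h -> (g * h) m = g 0%MM * h m.
Proof.
move=> hh; have := ordgeM (d := 1) (e := mdeg m) (f := g - cst n (g 0%MM)) _ hh.
move=> H; have : ((g - cst n (g 0%MM)) * h) m = 0.
  apply: H => //; apply/ordge1P.
  by rewrite fcoefB coef_cst eqxx mulr1 subrr.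
by rewrite mulrBl fcoefB fcoefCM => /eqP; rewrite subr_eq0 => /eqP.
Qed.

Lemma evalp_trunc n k (f : fps C k) (G : fmap C n k) d :
  evalp G (trunc d f) =
    \sum_(m : 'X_{1..k < d.+1}) cst n (f m) * \prod_i G i ^+ (m : 'X_{1..k}) i.
Proof.
rewrite /trunc raddf_sum; apply: eq_bigr => m _.
by rewrite -mul_mpolyC /= rmorphM /= evalpC evalpX.
Qed.

(** Such monomials are exactly those in the products of paired coordinates. For a nonresonant paired
    diagonal map they are the monomials of weight 1. *)
Definition resonant p (m : 'X_{1..p + p}) := [forall j : 'I_p, m (lshift p j) == m (rshift p j)].

Definition resonant_series p (b : fps C (p + p)) := forall m, ~~ resonant m -> b m = 0.

Lemma resonant_prod n p (phi : fmap C n (p + p)) m : resonant m ->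
  \prod_i phi i ^+ m i = \prod_(j < p) (phi (lshift p j) * phi (rshift p j)) ^+ m (lshift p j).
Proof.
move=> /forallP rm; rewrite big_split_ord /= -big_split /=; apply: eq_bigr => j _.
by rewrite exprMn (eqP (rm j)).
Qed.

(* A resonant series is a series in the products of paired coordinates. *)
Lemma resonant_comp1 n p (b : fps C (p + p)) (phi psi : fmap C n (p + p)) :
  resonant_series b -> vanishes0 phi -> vanishes0 psi ->
  (forall j, phi (lshift p j) * phi (rshift p j) = psi (lshift p j) * psi (rshift p j)) ->
  comp1 b phi = comp1 b psi.
Proof.
move=> hb h0 h0' H; apply: ordge_eq => -[|d] //.
have h1 := comp1_eval b (d := d) h0; have h2 := comp1_eval b (d := d) h0'.
have e : evalp phi (trunc d b) = evalp psi (trunc d b).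
  rewrite !evalp_trunc; apply: eq_bigr => m _.
  case: (boolP (resonant m)) => rm; last by rewrite hb // rmorph0 !mul0r.
  by rewrite !resonant_prod //; congr (_ * _); apply: eq_bigr => j _; rewrite H.
rewrite e in h1; have := ordgeB h1 h2; congr ordge; ring.
Qed.

(* F = c1 f o D - c2 f satisfies the same equation as f, and its lowest-order
   part is killed by the factor already present in F. *)
Lemma multiplier_weight n (S : fmap C n n) (d : 'I_n -> C) (f g1 g2 : fps C n) :
  vanishes0 S -> (forall i, ordge 2 (S i - dmap d i)) ->
  fcomp S (dmap d) = fcomp (dmap d) S ->
  comp1 g1 (dmap d) = g1 -> comp1 g2 (dmap d) = g2 ->
  g1 * comp1 f S = g2 * f ->
  forall m, f m != 0 -> g1 0%MM * wt d m = g2 0%MM.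
Proof.
move=> S0 S1 SD h1 h2 H.
set c1 := g1 0%MM; set c2 := g2 0%MM; have v0 := vanishes0_dmap d.
pose F := cst n c1 * comp1 f (dmap d) - cst n c2 * f.
have FE m : F m = (c1 * wt d m - c2) * f m.
  by rewrite /F fcoefB !fcoefCM comp1_dmap; ring.
have HF : g1 * comp1 F S = g2 * F.
  rewrite /F comp1B // !comp1M // !comp1_cst // comp1A // -SD -comp1A //.
  rewrite mulrBr mulrCA -[X in cst n c1 * (X * _)]h1 -comp1M // H comp1M // h2.
  by rewrite mulrCA [X in _ - X]mulrCA H; ring.
have F_0 d' : ordge d' F.
  elim: d' => [|e IH] // m; rewrite ltnS leq_eqVlt => /orP[/eqP em|]; last exact: IH.
  have om : ordge (mdeg m) F by rewrite em.
  have := congr1 (fun f => f m) HF.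
  rewrite /= !coef_mul_lead //; last exact: ordge_comp1.
  rewrite (comp1_lead S0 S1) // -/c1 -/c2 mulrA => /eqP.
  rewrite -subr_eq0 -mulrBl FE mulf_eq0 => /orP[/eqP->|/eqP//].
  by rewrite mul0r.
move=> m fm; have := F_0 (mdeg m).+1 m (ltnSn _).
by rewrite FE => /eqP; rewrite mulf_eq0 (negbTE fm) orbF subr_eq0 => /eqP.
Qed.

Definition divX n i (f : fps C n) : fps C n := fun m => f (m + U_(i))%MM.

Lemma divXK n i (f : fps C n) : (forall m, f m != 0 -> (0 < m i)%N) ->
  f = divX i f * fid C i.
Proof.
move=> H; apply: fps_ext => m; rewrite fidE.
case: (posnP (m i)) => mi.
  have -> : f m = 0 by apply/eqP; apply: contraTT isT => /H; rewrite mi.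
  rewrite fcoefME big1 // => -[k1 k2] /= /eqP e; rewrite coef_mon.
  case: eqP => [e2|]; last by rewrite mulr0.
  have := congr1 (fun u : 'X_{1..n} => u i) e.
  by rewrite mi mnmDE -e2 mnm1E eqxx addn1.
have {2}-> : m = (U_(i) + (m - U_(i)))%MM.
  by rewrite addmC submK //; apply/mnm_lepP => j; rewrite mnm1E; case: eqP => // <-.
rewrite fcoefMX /divX submK //.
by apply/mnm_lepP => j; rewrite mnm1E; case: eqP => // <-.
Qed.

Lemma geo_divX_fid n i (f : fps C n) : geo (f * fid C i) -> geo f.
Proof. by rewrite fidE; apply: geo_divX. Qed.

Definition pairwt p (kap : 'I_p -> C) : 'I_(p + p) -> C :=
  fun i => match split i with inl j => (kap j)^-1 | inr j => kap j end.

Lemma pairwt_l p (kap : 'I_p -> C) j : pairwt kap (lshift p j) = (kap j)^-1.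
Proof. by rewrite /pairwt (unsplitK (inl _ j)). Qed.

Lemma pairwt_r p (kap : 'I_p -> C) j : pairwt kap (rshift p j) = kap j.
Proof. by rewrite /pairwt (unsplitK (inr _ j)). Qed.

(** Multiplicative independence in the form in which it is used: monomials of equal weight have, in
    each pair, the same difference of exponents. The equation is arranged to avoid subtraction. *)
Definition nonres p (d : 'I_(p + p) -> C) := forall m m' : 'X_{1..p + p}, wt d m = wt d m' ->
  forall j, (m (lshift p j) + m' (rshift p j) = m (rshift p j) + m' (lshift p j))%N.

Lemma wt_pairwt p (kap : 'I_p -> C) m : (forall j, kap j != 0) ->
  wt (pairwt kap) m * \prod_j kap j ^+ m (lshift p j) = \prod_j kap j ^+ m (rshift p j).
Proof.
move=> k0; rewrite /wt big_split_ord /= mulrAC -big_split /= big1 ?mul1r.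
  by apply: eq_bigr => j _; rewrite pairwt_r.
by move=> j _; rewrite pairwt_l exprVn mulVf // expf_neq0.
Qed.

Lemma wt_pairwt_eq p (kap : 'I_p -> C) (m m' : 'X_{1..p + p}) : (forall j, kap j != 0) ->
  (forall j, m (lshift p j) + m' (rshift p j) = m (rshift p j) + m' (lshift p j))%N ->
  wt (pairwt kap) m = wt (pairwt kap) m'.
Proof.
move=> k0 H.
have nz (u : 'X_{1..p + p}) : \prod_j kap j ^+ u (lshift p j) != 0.
  by apply/prodf_neq0 => j _; apply: expf_neq0.
apply: (mulIf (nz m)); apply: (mulIf (nz m')).
rewrite wt_pairwt // mulrAC wt_pairwt // -!big_split; apply: eq_bigr => j _ /=.
by rewrite -!exprD; congr (_ ^+ _); rewrite -H addnC.
Qed.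

(** In each pair the difference of the exponents has the parity of their sum. As a consequence a map
    commuting with the diagonal map has only terms of odd degree. *)
Lemma nonres_odd p (d : 'I_(p + p) -> C) (m m' : 'X_{1..p + p}) : nonres d -> wt d m = wt d m' ->
  odd (mdeg m) = odd (mdeg m').
Proof.
move=> nr /nr H; rewrite !mdegE !big_split_ord /= -!big_split /=.
elim/big_rec2: _ => // j a b _; rewrite !oddD => ->; congr (_ (+) _).
by have := congr1 odd (H j); rewrite !oddD; do 4!case: odd.
Qed.

Lemma nonres_resonant p (d : 'I_(p + p) -> C) m : nonres d -> wt d m = 1 -> resonant m.
Proof.
by move=> nr; rewrite -(wt0 d) => /nr H; apply/forallP => j; have := H j; rewrite !mnm0E !addn0 => ->.
Qed.

Lemma nonres_inj p (d : 'I_(p + p) -> C) : nonres d -> injective d.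
Proof.
move=> nr i k; rewrite -!(wtU d) => /nr H.
have lr (a b : 'I_p) : (lshift p a == rshift p b) = false by rewrite eq_lrshift.
have rl (a b : 'I_p) : (rshift p a == lshift p b) = false by rewrite eq_rlshift.
case: (split_ordP i) H => j -> /(_ j); rewrite !mnm1E !eqxx ?lr ?rl.
  by case: (k =P lshift p j) => [->|_] //; case: eqP.
by case: (k =P rshift p j) => [->|_] //; case: eqP.
Qed.

End Resonance.

(** * Normal forms with paired multipliers *)

Section PairedNormalForm.
Variables (C : numClosedFieldType) (q : nat).
Local Notation p := q.+1.
Local Notation base := (widen_ord (leqnSn q)).
Local Notation lX j := (lshift p j).
Local Notation rX j := (rshift p j).

(** All multipliers are series in the coordinates of the first q pairs; the last pair has a
    multiplier but contributes no variable. Hence this embedding of the smaller index set. *)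
Definition bidx (i : 'I_(q + q)) : 'I_(p + p) :=
  match split i with inl j => lX (base j) | inr j => rX (base j) end.

Lemma bidx_l j : bidx (lshift q j) = lX (base j).
Proof. by rewrite /bidx (unsplitK (inl _ j)). Qed.

Lemma bidx_r j : bidx (rshift q j) = rX (base j).
Proof. by rewrite /bidx (unsplitK (inr _ j)). Qed.

Lemma bidx_inj : injective bidx.
Proof.
move=> i k; case: (split_ordP i) => a ->; case: (split_ordP k) => b ->;
  rewrite ?bidx_l ?bidx_r => /eqP.
- by rewrite eq_lshift => /eqP e; congr lshift; apply: val_inj; case: e.
- by rewrite eq_lrshift.
- by rewrite eq_rlshift.
- by rewrite eq_rshift => /eqP e; congr rshift; apply: val_inj; case: e.
Qed.

Variables (kap : 'I_p -> C) (x S : fmap C (p + p) (p + p)) (G : 'I_p -> fps C (q + q)).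
Local Notation D := (pairwt kap).
Hypothesis kap0 : forall j, kap j != 0.
Hypothesis nr : nonres D.
Hypothesis x0 : vanishes0 x.
Hypothesis S0 : vanishes0 S.
Hypothesis G_res : forall j, resonant_series (G j).
Hypothesis G0 : forall j, G j 0%MM = kap j.
Hypothesis G_base : forall j : 'I_q, G (base j) =
  cst _ (kap (base j)) * (1 + fid C (lshift q j) * fid C (rshift q j)) ^+ 2.

Local Notation xb := (fun i => x (bidx i)).
Local Notation g j := (comp1 (G j) xb).
Hypothesis HX : forall j, g j * comp1 (x (lX j)) S = x (lX j).
Hypothesis HY : forall j, comp1 (x (rX j)) S = g j * x (rX j).

Let xb0 : vanishes0 (xb : fmap C (p + p) (q + q)).
Proof. by move=> i; apply: x0. Qed.

Let g0 j : g j 0%MM = kap j.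
Proof. by rewrite comp1_0E ?G0. Qed.

(** To first order the eigenfunction equations only see the constant terms of the multipliers. *)
Lemma lin_conj : linpart x *m linpart S = diag_mx (\row_i D i) *m linpart x.
Proof.
rewrite -linpart_comp //; apply/matrixP => i k.
rewrite mul_diag_mx !mxE fcompE.
have o1 (f : fps C (p + p)) : f 0%MM = 0 -> ordge (mdeg U_(k)%MM) f.
  by rewrite mdeg1 => /ordge1P.
case: (split_ordP i) => j ->; rewrite ?pairwt_l ?pairwt_r.
  have := congr1 (fun f => f U_(k)%MM) (HX j); rewrite /= coef_mul_lead ?g0.
    by move=> <-; rewrite mulKf.
  by apply: o1; rewrite comp1_0E.
by rewrite HY coef_mul_lead ?g0 //; apply: o1.
Qed.

Definition J j := x (lX j) * x (rX j).

Lemma J_invariant j : comp1 (J j) S = J j.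
Proof.
rewrite /J comp1M // HY mulrCA; apply/esym; rewrite -{1}HX; ring.
Qed.

Hypothesis S1 : forall i, ordge 2 (S i - dmap D i).

Section Permuted.
Variable s : {perm 'I_(p + p)}.
Local Notation D' := (fun i => D (s i)).
Hypothesis SD' : fcomp S (dmap D') = fcomp (dmap D') S.
Hypothesis ux : linpart x \in unitmx.

Lemma S_lin i k : S i U_(k)%MM = D i * (i == k)%:R.
Proof.
have := @S1 i U_(k)%MM; rewrite mdeg1 fcoefB => /(_ isT) /eqP.
by rewrite subr_eq0 => /eqP->; rewrite /dmap fcoefCM fidE coef_mon mnmU_inj.
Qed.

Lemma x_lin_diag i k : i != k -> x i U_(k)%MM = 0.
Proof.
move=> ne; have := congr1 (fun M : 'M_(_) => M i k) lin_conj.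
rewrite mul_diag_mx !mxE (bigD1 k) //= big1 => [|l nl]; last first.
  by rewrite !mxE S_lin (negbTE nl) !mulr0.
rewrite !mxE S_lin eqxx addr0 mulr1 => e.
have : (D k - D i) * x i U_(k)%MM = 0 by rewrite mulrBl mulrC e subrr.
move=> /eqP; rewrite mulf_eq0 => /orP[|/eqP//]; rewrite subr_eq0 => /eqP /(nonres_inj nr) e2.
by rewrite e2 eqxx in ne.
Qed.

Lemma x_lin_neq0 i : x i U_(i)%MM != 0.
Proof.
apply: contraTN ux => /eqP e; rewrite unitmxE unitfE negbK.
rewrite (expand_det_row _ i) big1 // => k _; rewrite mxE.
by case: (eqVneq i k) => [<-|ne]; rewrite ?e ?x_lin_diag ?mul0r.
Qed.

Lemma S_support i m : S i m != 0 -> wt D' m = D' i.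
Proof.
move=> nz; have := congr1 (fun F : fmap C (p + p) (p + p) => F i m) SD'.
rewrite /= !fcompE comp1_dmap /dmap comp1M // comp1_cst // comp1_fid // fcoefCM.
exact: mulIf.
Qed.

(** Moves the exponents so that weights for the permuted diagonal map become weights for [D], to
    which [nonres] applies. *)
Definition unshuffle (m : 'X_{1..p + p}) : 'X_{1..p + p} :=
  [multinom m ((s^-1)%g i) | i < p + p].

Lemma wt_shuffle m : wt D' m = wt D (unshuffle m).
Proof.
rewrite /wt [RHS](reindex_inj (@perm_inj _ s)); apply: eq_bigr => i _.
by rewrite mnmE permK.
Qed.

Lemma mdeg_unshuffle m : mdeg (unshuffle m) = mdeg m.
Proof.
rewrite !mdegE [LHS](reindex_inj (@perm_inj _ s)); apply: eq_bigr => i _.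
by rewrite mnmE permK.
Qed.

Lemma S_odd i m : S i m != 0 -> odd (mdeg m).
Proof.
move=> /S_support; rewrite -(wtU D' i) !wt_shuffle => /(nonres_odd nr).
by rewrite !mdeg_unshuffle mdeg1.
Qed.

Lemma g_base (j : 'I_q) : g (base j) = cst _ (kap (base j)) * (1 + J (base j)) ^+ 2.
Proof.
rewrite G_base comp1M // comp1_cst // comp1X // comp1D // comp1_1 // comp1M //.
by rewrite !comp1_fid // bidx_l bidx_r.
Qed.

Lemma ordge_x i : ordge 1 (x i).
Proof. by apply/ordge1P; apply: x0. Qed.

Lemma ordge_x_lin i : ordge 2 (x i - cst _ (x i U_(i)%MM) * fid C i).
Proof.
apply: ordge2P => [|k]; first by rewrite fcoefB fcoefCM x0 vanishes0_fid mulr0 subrr.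
rewrite fcoefB fcoefCM fidE coef_mon mnmU_inj.
by case: (eqVneq i k) => [->|/x_lin_diag ->]; rewrite ?mulr1 ?mulr0 subrr.
Qed.

(* The coefficient of u_X u_Y^2 in the equation for x_Y forces S_Y to contain
   that monomial, since the multiplier of x_Y is kap (1 + x_X x_Y)^2. *)
Lemma base_pairing (j : 'I_q) : D' (lX (base j)) * D' (rX (base j)) = 1.
Proof.
set X := lX (base j); set Y := rX (base j); set k := kap (base j).
have DY : D Y = k by rewrite pairwt_r.
have DX : D X = k^-1 by rewrite pairwt_l.
set cX := x X U_(X)%MM; set cY := x Y U_(Y)%MM.
pose f := x Y; pose h := f - cst _ cY * fid C Y.
have fE : f = cst _ cY * fid C Y + h by rewrite /h; ring.
have h2 : ordge 2 h by apply: ordge_x_lin.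
have J2 : ordge 2 (J (base j)) by apply: (ordgeM (d := 1) (e := 1)); apply: ordge_x.
pose r := cst _ k * (J (base j) * f) * 2 + cst _ k * (J (base j) * (J (base j) * f)).
have gf : g (base j) * f = cst _ k * f + r by rewrite g_base /r /k; ring.
have Jf3 : ordge 3 (J (base j) * f) by apply: (ordgeM (d := 2) (e := 1)) J2 (ordge_x _).
have r3 : ordge 3 r.
  by apply: ordgeD; [apply/ordgeMr/ordgeMl|apply/ordgeMl/ordgeMl].
have eqn m : cY * S Y m + comp1 h S m = k * (cY * (fid C Y m) + h m) + r m.
  have := congr1 (fun f => f m) (HY (base j)); rewrite /= -/Y -/f gf {1}fE.
  rewrite comp1D // comp1M // comp1_cst // comp1_fid // !fcoefD !fcoefCM.
  by rewrite {1}fE fcoefD fcoefCM.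
have uYm m : (1 < mdeg m)%N -> fid C Y m = 0.
  by move=> hm; rewrite fidE coef_mon; case: eqP hm => // <-; rewrite mdeg1.
(* In degree 2 the contribution of S disappears by parity. A surviving monomial of [h] would have
   the weight of Y, and parity excludes this as well. *)
have h3 : ordge 3 h.
  move=> m; rewrite ltnS leq_eqVlt => /orP[/eqP m2|]; last exact: h2.
  have := eqn m; rewrite (comp1_lead S0 S1) ?m2 // uYm ?m2 // mulr0 add0r r3 ?m2 // addr0.
  have -> : S Y m = 0 by apply: contraTeq isT => /S_odd; rewrite m2.
  rewrite mulr0 add0r => e; apply/eqP; apply: contraTT isT => hm.
  have : wt D m = wt D U_(Y)%MM by rewrite wtU DY; apply: (mulIf hm).
  by move=> /(nonres_odd nr); rewrite m2 mdeg1.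
pose m3 := (U_(X) + U_(Y) + U_(Y))%MM : 'X_{1..p + p}.
have m3d : mdeg m3 = 3%N by rewrite !mdegD !mdeg1.
have lead : (J (base j) * f) m3 = cX * cY * cY.
  have : ordge 4 (J (base j) * f - cst _ (cX * cY * cY) * mon C m3).
    have -> : J (base j) * f - cst _ (cX * cY * cY) * mon C m3 =
      (x X - cst _ cX * fid C X) * (f * f) + (cst _ cX * fid C X) * (h * f)
      + (cst _ cX * fid C X) * ((cst _ cY * fid C Y) * h).
      by rewrite /m3 !monD -!fidE !rmorphM /h /f /J -/X -/Y; ring.
    have o1 i c : ordge 1 (cst _ c * fid C i : fps C (p + p)).
      by apply: ordgeMl; apply/ordge1P; apply: vanishes0_fid.
    have of1 : ordge 1 f by apply: ordge_x.
    apply: ordgeD; first apply: ordgeD.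
    - by apply: (ordgeM (d := 2) (e := 2)); [apply: ordge_x_lin | apply: (ordgeM (d := 1) (e := 1))].
    - by apply: (ordgeM (d := 1) (e := 3)) => //; apply: (ordgeM (d := 2) (e := 1)).
    - by apply: (ordgeM (d := 1) (e := 3)) => //; apply: (ordgeM (d := 1) (e := 2)).
  move=> /(_ m3); rewrite m3d => /(_ isT); rewrite fcoefB fcoefCM coef_mon eqxx mulr1.
  by move/eqP; rewrite subr_eq0 => /eqP.
have rm3 : r m3 = k * (cX * cY * cY) * 2.
  have o5 : (J (base j) * (J (base j) * f)) m3 = 0.
    by apply: (ordgeM (d := 2) (e := 3) J2 Jf3); rewrite m3d.
  rewrite /r fcoefD fcoefCM o5 mulr0 addr0 -[2 in LHS]/(1 + 1) mulrDr !mulr1 fcoefD.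
  by rewrite !fcoefCM lead -[2]/(1 + 1) mulrDr mulr1.
have k0 : k != 0 by apply: kap0.
(* The weight of [m3] is k, so the two contributions of [h] cancel. What remains is cY times the
   coefficient of S, equal to 2 k cX cY^2. *)
have SY : S Y m3 != 0.
  apply/eqP => e; have := eqn m3.
  rewrite e mulr0 add0r (comp1_lead S0 S1) ?m3d // uYm ?m3d // mulr0 add0r rm3.
  rewrite !wtD !wtU DX DY mulVf // mul1r -[X in X = _]addr0 => /addrI /esym/eqP.
  by rewrite !mulf_eq0 (negbTE k0) !(negbTE (x_lin_neq0 _)) pnatr_eq0.
have := S_support SY; rewrite /m3 !wtD !wtU -[X in _ = X]mul1r => /mulIf; apply.
case: (split_ordP (s Y)) => i ->; rewrite ?pairwt_l ?pairwt_r ?invr_eq0; exact: kap0.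
Qed.

Lemma all_pairing j : D' (lX j) * D' (rX j) = 1.
Proof.
have D_neq0 i : D i != 0.
  by case: (split_ordP i) => l ->; rewrite ?pairwt_l ?pairwt_r ?invr_eq0; apply: kap0.
have pD : \prod_i D i = 1.
  rewrite big_split_ord /= -big_split big1 //= => l _.
  by rewrite pairwt_l pairwt_r mulVf.
have pD' : \prod_l (D' (lX l) * D' (rX l)) = 1.
  transitivity (\prod_i D (s i)); first by rewrite big_split_ord /= big_split.
  by rewrite -[RHS]pD [RHS](reindex_inj (@perm_inj _ s)).
have wE (l : 'I_p) : l != ord_max -> exists l' : 'I_q, l = base l'.
  move=> ne; have h : (l < q)%N.
    rewrite ltn_neqAle -ltnS ltn_ord andbT; apply: contraNneq ne => e.
    by apply/eqP/val_inj.
  by exists (Ordinal h); apply: val_inj.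
case: (eqVneq j ord_max) => [->|/wE[l ->]]; last exact: base_pairing.
move: pD'; rewrite (bigD1 ord_max) //= big1 ?mulr1 // => l /wE[l' ->].
exact: base_pairing.
Qed.

(** A pair of permuted weights with product 1 consists, by nonresonance, of the two weights of one
    pair, possibly reversed. Thus [s] maps pairs to pairs and the monomials allowed by D' are
    allowed by [D]. *)
Lemma permuted_commute : fcomp S (dmap D) = fcomp (dmap D) S.
Proof.
have D0 := vanishes0_dmap D.
apply: fmap_ext => i; apply: fps_ext => m.
rewrite !fcompE comp1_dmap /dmap comp1M // comp1_cst // comp1_fid // fcoefCM.
case: (eqVneq (S i m) 0) => [->|/S_support]; first by rewrite !mulr0.
rewrite -(wtU D' i) !wt_shuffle => /nr H; congr (_ * _).
rewrite -(wtU D i); apply: wt_pairwt_eq => // j.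
have sw : forall a : 'I_p, exists b : 'I_p,
    (s (lX a) = lX b /\ s (rX a) = rX b) \/ (s (lX a) = rX b /\ s (rX a) = lX b).
  move=> a; have := all_pairing a; rewrite -!(wtU D) -wtD -(wt0 D) => /nr K.
  have lr (u v : 'I_p) : (lX u == rX v) = false by rewrite eq_lrshift.
  have rl (u v : 'I_p) : (rX u == lX v) = false by rewrite eq_rlshift.
  have {}K b : ((s (lX a) == lX b) + (s (rX a) == lX b) = (s (lX a) == rX b) + (s (rX a) == rX b))%N.
    by have := K b; rewrite !mnmDE !mnm1E !mnm0E !addn0.
  case: (split_ordP (s (lX a))) K => b -> /(_ b) K; exists b; [left | right]; move: K.
    by rewrite eqxx lr; case: (s (rX a) =P rX b) => // _; case: eqP.
  by rewrite eqxx rl; case: (s (rX a) =P lX b) => // _; case: eqP.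
have [b [[e1 e2]|[e1 e2]]] := sw j; have := H b; rewrite !mnmE -!e1 -!e2 !permK //.
Qed.

End Permuted.

Section Diagonal.
Hypothesis SD : fcomp S (dmap D) = fcomp (dmap D) S.
Hypothesis ux : linpart x \in unitmx.

Let D0 := vanishes0_dmap D.

Lemma J_weight j : comp1 (J j) (dmap D) = J j.
Proof.
have W := multiplier_weight S0 S1 SD (f := J j) (g1 := 1) (g2 := 1).
apply: fps_ext => m; rewrite comp1_dmap.
case: (eqVneq (J j m) 0) => [->|nz]; first by rewrite mulr0.
have w1 : comp1 1 (dmap D) = 1 by rewrite comp1_1.
have := W w1 w1 _ m nz; rewrite fcoef1 eqxx !mul1r => -> //; first by rewrite mul1r.
by rewrite J_invariant.
Qed.

Lemma g_weight j : comp1 (g j) (dmap D) = g j.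
Proof.
rewrite comp1A //; apply: resonant_comp1 => // [|i].
  by apply: vanishes0_comp.
by rewrite !fcompE bidx_l bidx_r -comp1M // J_weight.
Qed.

Lemma x_weight i m : x i m != 0 -> wt D m = D i.
Proof.
have W := multiplier_weight S0 S1 SD (f := x i).
have w1 : comp1 1 (dmap D) = 1 by rewrite comp1_1.
case: (split_ordP i) W => j -> W nz.
  have := W (g j) 1 (g_weight j) w1 _ m nz; rewrite fcoef1 eqxx g0 pairwt_l mul1r.
  by move=> H; apply: (mulfI (kap0 j)); rewrite H ?mulfV // HX.
have := W 1 (g j) w1 (g_weight j) _ m nz; rewrite fcoef1 eqxx g0 pairwt_r !mul1r.
by apply; apply: HY.
Qed.

Definition unitpart i := divX i (x i).

Lemma x_unitpart i : x i = unitpart i * fid C i.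
Proof.
apply: divXK => m /x_weight; rewrite -(wtU D i) => /nr H.
case: (split_ordP i) H => j -> /(_ j); rewrite !mnm1E !eqxx.
  by rewrite (eq_lrshift j j) addn0 => ->; rewrite addn1.
by rewrite (eq_rlshift j j) addn0 => <-; rewrite addn1.
Qed.

Lemma unitpart_weight i m : unitpart i m != 0 -> wt D m = 1.
Proof.
rewrite /unitpart /divX => /x_weight; rewrite wtD wtU -{2}[D i]mul1r => /mulIf; apply.
by case: (split_ordP i) => j ->; rewrite ?pairwt_l ?pairwt_r ?invr_eq0.
Qed.

Lemma linpart_x i k : linpart x i k = unitpart i 0%MM * (i == k)%:R.
Proof.
rewrite mxE; case: eqP => [->|ne]; first by rewrite mulr1 /unitpart /divX add0m.
rewrite mulr0; apply/eqP; apply: contraTT isT => /x_weight; rewrite wtU => e.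
by case: ne; apply: (nonres_inj nr).
Qed.

Lemma unitpart0 i : unitpart i 0%MM != 0.
Proof.
have -> : unitpart i 0%MM = linpart x i i by rewrite linpart_x eqxx mulr1.
apply: contraTN ux => /eqP e; rewrite unitmxE unitfE negbK.
rewrite (expand_det_row _ i) big1 // => k _.
case: (eqVneq i k) => [<-|ne]; first by rewrite e mul0r.
by rewrite linpart_x (negbTE ne) mulr0 mul0r.
Qed.

(** Written in the coordinates [x], the unit part has only monomials of weight 1. It is therefore a
    function of the products [J j], which are invariant under [S]. *)
Lemma unitpart_invariant i : comp1 (unitpart i) S = unitpart i.
Proof.
have [K [K0 xK Kx _]] := inverse_exists x0 ux.
have xD : fcomp x (dmap D) = fcomp (dmap D) x.
  apply: fmap_ext => k; apply: fps_ext => m; rewrite fcompE comp1_dmap.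
  rewrite fcompE /dmap comp1M // comp1_cst // comp1_fid // fcoefCM.
  by case: (eqVneq (x k m) 0) => [->|/x_weight ->]; rewrite ?mulr0.
have KD : fcomp K (dmap D) = fcomp (dmap D) K.
  rewrite -[LHS]fcomp_idr -xK -(fcompA _ x0 K0) (fcompA K D0 x0) -xD.
  by rewrite -(fcompA K x0 D0) Kx (fcomp_idl D0).
pose b := comp1 (unitpart i) K.
have aD : comp1 (unitpart i) (dmap D) = unitpart i.
  apply: fps_ext => m; rewrite comp1_dmap.
  by case: (eqVneq (unitpart i m) 0) => [->|/unitpart_weight ->]; rewrite ?mulr0 ?mul1r.
have bres : resonant_series b.
  move=> m; apply: contraNeq => nz.
  apply: (nonres_resonant nr); apply: (mulIf nz); rewrite mul1r -comp1_dmap.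
  by rewrite /b comp1A // KD -comp1A // aD.
have ab : unitpart i = comp1 b x by rewrite /b comp1A // Kx comp1_id.
rewrite {1}ab comp1A // ab; apply: resonant_comp1 => // [|j].
  exact: vanishes0_comp.
by rewrite !fcompE -comp1M //; apply: J_invariant.
Qed.

(** Cancelling the invariant unit part from the equation of x_Y shows that the multiplier is the
    quotient S_Y / Y. It thus inherits the convergence of [S], although [x] may diverge. *)
Lemma S_right j : S (rX j) = g j * fid C (rX j).
Proof.
have nz : unitpart (rX j) != 0.
  by apply/eqP => e; have := unitpart0 (rX j); rewrite e eqxx.
apply: (fps_mulfI nz); have := HY j.
rewrite x_unitpart comp1M // unitpart_invariant comp1_fid // => ->; ring.
Qed.

Hypothesis cS : cvm S.

Lemma geo_g j : geo (g j).
Proof. by move/cvmP: cS => /(_ (rX j)); rewrite S_right; apply: geo_divX_fid. Qed.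

Lemma geo_J (j : 'I_q) : geo (J (base j)).
Proof.
apply: geo_sqrt; first by rewrite /J coef_mul_lead ?x0 ?mul0r // mdeg0.
have -> : (1 + J (base j)) ^+ 2 = cst _ (kap (base j))^-1 * g (base j).
  rewrite G_base comp1M // comp1_cst // comp1X // comp1D // comp1_1 // comp1M //.
  by rewrite !comp1_fid // bidx_l bidx_r mulrA -rmorphM mulVf // rmorph1 mul1r.
by apply: geoM; [apply: geo_cst | apply: geo_g].
Qed.

(** On the slice where the last pair vanishes ([iota]), the products J_j become X_j Y_j times
    convergent units. The local coordinates [chi] have the same products, so G_j o chi = g_j o iota
    because G_j is resonant, and inverting [chi] recovers G_j. *)
Lemma diagonal_geo j : geo (G j).
Proof.
pose aa (j : 'I_q) := unitpart (lX (base j)) * unitpart (rX (base j)).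
have geo_aa i : geo (aa i).
  apply: (@geo_divX_fid _ _ (lX (base i))); apply: (@geo_divX_fid _ _ (rX (base i))).
  have -> : aa i * fid C (lX (base i)) * fid C (rX (base i)) = J (base i).
    by rewrite /J !x_unitpart /aa; ring.
  exact: geo_J.
pose iota : fmap C (q + q) (p + p) := linmap (\matrix_(k, i) (bidx i == k)%:R).
have i0 : vanishes0 iota by apply: vanishes0_linmap.
have iotaE i : iota (bidx i) = fid C i.
  rewrite /iota linmapE (bigD1 i) //= mxE eqxx rmorph1 mul1r fidE big1 ?addr0 //.
  by move=> k ne; rewrite mxE (inj_eq bidx_inj) (negbTE ne) rmorph0 mul0r.
(* The whole unit is placed on the first member of each pair, since a resonant series only sees the
   product. *)
pose chi : fmap C (q + q) (q + q) := fun i => match split i with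
  | inl j => fid C (lshift q j) * comp1 (aa j) iota
  | inr j => fid C (rshift q j) end.
have chil i : chi (lshift q i) = fid C (lshift q i) * comp1 (aa i) iota.
  by rewrite /chi (unsplitK (inl _ i)).
have chir i : chi (rshift q i) = fid C (rshift q i).
  by rewrite /chi (unsplitK (inr _ i)).
have chi0 : vanishes0 chi.
  move=> i; case: (split_ordP i) => k ->; rewrite ?chil ?chir ?vanishes0_fid //.
  by rewrite coef_mul_lead ?vanishes0_fid ?mul0r // mdeg0.
have e : comp1 (G j) chi = comp1 (g j) iota.
  rewrite comp1A //; apply: resonant_comp1 => // [|k]; first exact: vanishes0_comp.
  rewrite chil chir !fcompE bidx_l bidx_r -comp1M // -/(J _) /J !x_unitpart.
  rewrite !comp1M // !comp1_fid // -bidx_l -bidx_r !iotaE bidx_l bidx_r.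
  ring.
have cchi : cvm chi.
  apply/cvmP => i; case: (split_ordP i) => k ->; rewrite ?chil ?chir; last exact: geo_fid.
  by apply: geoM; [apply: geo_fid | apply: cvm_comp1 => //; apply: cvm_linmap].
have uchi : linpart chi \in unitmx.
  pose dd (i : 'I_(q + q)) : C := match split i with inl j => aa j 0%MM | inr j => 1 end.
  have -> : linpart chi = diag_mx (\row_(i < q + q) dd i).
    apply/matrixP => i k; rewrite !mxE /dd.
    case: (split_ordP i) => l ->; rewrite ?(unsplitK (inl _ l)) ?(unsplitK (inr _ l)).
      rewrite chil mulrC coef_mul_lead; last first.
        by rewrite mdeg1 => m; rewrite ltnS leqn0 mdeg_eq0 => /eqP->; apply: vanishes0_fid.
      by rewrite comp1_0E // fidE coef_mon mnmU_inj mulr_natr.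
    by rewrite chir fidE coef_mon mnmU_inj.
  rewrite unitmxE det_diag unitfE; apply/prodf_neq0 => i _; rewrite mxE /dd.
  case: split => k; rewrite ?oner_eq0 // /aa coef_mul_lead ?mdeg0 //.
  by rewrite mulf_neq0 ?unitpart0.
have [K [K0 chiK _ cK]] := inverse_exists chi0 uchi.
have -> : G j = comp1 (comp1 (g j) iota) K by rewrite -e comp1A // chiK comp1_id.
apply: cvm_comp1 => //; last exact: cK.
by apply: cvm_comp1 => //; [apply: geo_g | apply: cvm_linmap].
Qed.

End Diagonal.

End PairedNormalForm.

(** * Permutations of the coordinates and the general normal form *)

Section Relabelling.
Variables (C : numClosedFieldType) (n : nat).
Implicit Types s : {perm 'I_n}.

Definition pmap s : fmap C n n := fun k => fid C (s k).

Lemma vanishes0_pmap s : vanishes0 (pmap s).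
Proof. by move=> k; apply: vanishes0_fid. Qed.

Lemma cvm_pmap s : cvm (pmap s).
Proof. by apply/cvmP => k; apply: geo_fid. Qed.

Lemma linpart_pmap s k l : linpart (pmap s) k l = (s k == l)%:R.
Proof. by rewrite mxE /pmap fidE coef_mon mnmU_inj. Qed.

Lemma fcomp_pmap k s (F : fmap C k n) i : vanishes0 F -> fcomp (pmap s) F i = F (s i).
Proof. by move=> F0; rewrite fcompE comp1_fid. Qed.

Lemma pmapVr s : fcomp (pmap s^-1%g) (pmap s) = @fid C n.
Proof.
by apply: fmap_ext => k; rewrite fcomp_pmap /pmap ?permKV //; apply: vanishes0_pmap.
Qed.

Lemma fcomp_pmap_dmap s (d : 'I_n -> C) :
  fcomp (pmap s) (dmap d) = fcomp (dmap (fun i => d (s i))) (pmap s).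
Proof.
have v := vanishes0_pmap s; have w := vanishes0_dmap d.
apply: fmap_ext => k; rewrite fcomp_pmap // fcompE /dmap comp1M // comp1_cst //.
by rewrite comp1_fid.
Qed.

Lemma unit_perm (A : 'M[C]_n) : A \in unitmx -> exists s : {perm 'I_n}, forall i, A i (s i) != 0.
Proof.
rewrite unitmxE unitfE => dA.
suff [s hs] : exists s : {perm 'I_n}, \prod_i A i (s i) != 0.
  by exists s => i; move/prodf_neq0: hs; apply.
apply: contrapT => H; case/eqP: dA; rewrite /determinant big1 // => s _.
case: (eqVneq (\prod_i A i (s i)) 0) => [->|ne]; first by rewrite mulr0.
by case: H; exists s.
Qed.

End Relabelling.

(** Commutation with [D] makes the linear part of [S] diagonal, but its entries may come in another
    order. Conjugation by a permutation makes [S] tangent to [D], at the price that it now commutes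
    with a permuted diagonal map; [permuted_commute] removes this discrepancy. *)
Lemma paired_normal_form (C : numClosedFieldType) (q : nat) (kap : 'I_q.+1 -> C)
    (x S : fmap C (q.+1 + q.+1) (q.+1 + q.+1)) (G : 'I_q.+1 -> fps C (q + q)) :
  let D := pairwt kap in
  let g j := comp1 (G j) (fun i => x (bidx i)) in
  (forall j, kap j != 0) -> nonres D -> vanishes0 x -> linpart x \in unitmx ->
  vanishes0 S -> cvm S -> fcomp S (dmap D) = fcomp (dmap D) S ->
  (forall j, resonant_series (G j)) -> (forall j, G j 0%MM = kap j) ->
  (forall j : 'I_q, G (widen_ord (leqnSn q) j) = cst _ (kap (widen_ord (leqnSn q) j)) *
     (1 + fid C (lshift q j) * fid C (rshift q j)) ^+ 2) ->
  (forall j, g j * comp1 (x (lshift _ j)) S = x (lshift _ j)) ->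
  (forall j, comp1 (x (rshift _ j)) S = g j * x (rshift _ j)) ->
  forall j, geo (G j).
Proof.
move=> D g kap0 nr x0 ux S0 cS SD Gr G0 Gb HX HY.
have AM := lin_conj kap0 x0 S0 G0 HX HY; rewrite -/D in AM.
have Dv := vanishes0_dmap D.
have Moff i k : i != k -> S i U_(k)%MM = 0.
  move=> ne; have := congr1 (fun F : fmap C _ _ => F i U_(k)%MM) SD.
  rewrite /= !fcompE comp1_dmap wtU /dmap comp1M // comp1_cst // comp1_fid // fcoefCM.
  move=> /eqP; rewrite -subr_eq0 -mulrBl mulf_eq0 => /orP[|/eqP //].
  by rewrite subr_eq0 => /eqP /(nonres_inj nr) e; rewrite e eqxx in ne.
have [s hs] := unit_perm ux.
(* A nonzero entry of the linear part of [x] in row i and column s i identifies the two eigenvalues,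
   so [s] records where each entry of [D] occurs. *)
have Mdiag i : S (s i) U_(s i)%MM = D i.
  have := congr1 (fun M : 'M_(_) => M i (s i)) AM.
  rewrite mul_diag_mx !mxE (bigD1 (s i)) //= big1 => [|l nl]; last first.
    by rewrite !mxE Moff // mulr0.
  rewrite addr0 !mxE mulrC; apply: mulIf.
  by have := hs i; rewrite mxE.
pose P := pmap C s^-1%g; pose Q := pmap C s.
have P0 : vanishes0 P by apply: vanishes0_pmap.
have Q0 : vanishes0 Q by apply: vanishes0_pmap.
pose x' := fcomp x P.
pose S' := fcomp (fcomp Q S) P.
have QS0 : vanishes0 (fcomp Q S) by apply: vanishes0_comp.
have x'0 : vanishes0 x' by apply: vanishes0_comp.
have S'0 : vanishes0 S' by apply: vanishes0_comp.
have xS i : comp1 (x' i) S' = comp1 (comp1 (x i) S) P.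
  rewrite /x' fcompE comp1A // -(fcompA _ QS0 P0) -(fcompA P Q0 S0) pmapVr.
  by rewrite (fcomp_idl S0) comp1A.
have xb0 : vanishes0 (fun i : 'I_(q + q) => x (bidx i)) by move=> i; apply: x0.
have g' j : comp1 (G j) (fun i => x' (bidx i)) = comp1 (g j) P.
  by rewrite /g comp1A //; congr (comp1 _ _).
have S'1 i : ordge 2 (S' i - dmap D i).
  have -> : dmap D = linmap (linpart S').
    rewrite dmapE; congr linmap; apply/matrixP => k l.
    rewrite /S' !linpart_comp // !mxE (bigD1 (s l)) //= big1 => [|h nh]; last first.
      rewrite linpart_pmap; case: eqP => [e|]; last by rewrite mulr0.
      by rewrite -e permKV eqxx in nh.
    rewrite linpart_pmap permK eqxx mulr1 addr0 mxE (bigD1 (s k)) //= big1 => [|h nh]; last first.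
      by rewrite linpart_pmap eq_sym (negbTE nh) mul0r.
    rewrite linpart_pmap eqxx mul1r addr0 !mxE.
    case: (eqVneq k l) => [->|ne]; first by rewrite Mdiag.
    by rewrite Moff ?(inj_eq perm_inj).
  exact: ordge2_linpart.
have SD' : fcomp S' (dmap (fun i => D (s i))) = fcomp (dmap (fun i => D (s i))) S'.
  have D'0 := vanishes0_dmap (fun i => D (s i)).
  have PD : fcomp P (dmap (fun i => D (s i))) = fcomp (dmap D) P.
    rewrite /P fcomp_pmap_dmap; congr (fcomp (dmap _) _).
    by apply: functional_extensionality_dep => i; rewrite permKV.
  rewrite /S' (fcompA _ P0 D'0) PD -(fcompA _ Dv P0) (fcompA Q S0 Dv) SD.
  rewrite -(fcompA Q Dv S0) fcomp_pmap_dmap -(fcompA _ QS0 P0).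
  by rewrite -(fcompA (dmap _) Q0 S0).
have ux' : linpart x' \in unitmx.
  rewrite linpart_comp // unitmx_mul ux /=.
  have : linpart P *m linpart Q = 1%:M by rewrite -linpart_comp // pmapVr linpart_fid.
  by move=> /mulmx1_unit[].
have cS' : cvm S'.
  by apply: cvm_comp => //; [apply: cvm_comp => // |]; apply: cvm_pmap.
have HX' j : comp1 (G j) (fun i => x' (bidx i)) * comp1 (x' (lshift _ j)) S' = x' (lshift _ j).
  by rewrite g' xS -comp1M // HX /x' fcompE.
have HY' j : comp1 (x' (rshift _ j)) S' = comp1 (G j) (fun i => x' (bidx i)) * x' (rshift _ j).
  by rewrite g' xS HY comp1M // /x' fcompE.
have SD2 := permuted_commute kap0 nr x'0 S'0 G0 Gb HX' HY' S'1 SD' ux'.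
exact: (diagonal_geo kap0 nr x'0 S'0 Gr G0 Gb HX' HY' S'1 SD2 ux' cS').
Qed.

(** * Formal Floquet reduction *)

Section Floquet.
Variables (C : numClosedFieldType) (n : nat) (kap : C) (w : 'I_n -> C) (T : fmap C n n).
Hypothesis T0 : vanishes0 T.
Hypothesis T1 : forall i, ordge 2 (T i - dmap w i).
Hypothesis kap0 : kap != 0.
Hypothesis small_neq0 : forall m, kap^-1 * wt w m - kap != 0.
Local Notation D0 := (vanishes0_dmap w).
Local Notation cst := (cst n).
Implicit Types (th a b l : fps C n).

(** With [resY], the remainder of the eigenfunction equation, taken as coefficients of X and of Y,
    once the linear operator with constant coefficients is moved to the left. The differences
    between composing with [T] and with its linear part gain one order. *)
Definition resX th a b l := l * a - cst kap^-1 * (comp1 a T - comp1 a (dmap w))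
  + cst kap^-1 * (th * comp1 a T) - th * (1 + comp1 b T).

Definition resY th a b l := l * b - cst kap * (comp1 b T - comp1 b (dmap w))
  + th * comp1 a T - cst kap * (th * (1 + comp1 b T)).

(** The Y equation serves two unknowns: [b] takes the monomials of weight different from 1 and [l]
    those of weight 1. This normalization makes the solution unique and puts [l] on resonant
    monomials when the weights are nonresonant. *)
Definition lin_solution a b l (rX rY : fps C n) :=
  [/\ forall m, (kap^-1 * wt w m - kap) * a m = rX m,
      forall m, kap * (wt w m - 1) * b m - l m = rY m,
      forall m, wt w m = 1 -> b m = 0 &
      forall m, wt w m != 1 -> l m = 0].

(* With kap + l for the multiplier, a X + (1 + b) Y is an eigenfunction of
   X |-> (X - th (X + kap Y)) / kap,  Y |-> kap Y + th (X + kap Y)  over T. *)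
Definition floquet th a b l :=
  [/\ ordge 1 a, ordge 1 b, ordge 1 l & lin_solution a b l (resX th a b l) (resY th a b l)].

Lemma lin_solutionB a b l rX rY a' b' l' rX' rY' :
  lin_solution a b l rX rY -> lin_solution a' b' l' rX' rY' ->
  lin_solution (a - a') (b - b') (l - l') (rX - rX') (rY - rY').
Proof.
move=> [A B N L] [A' B' N' L']; split=> m.
- by rewrite !fcoefB mulrBr A A'.
- by rewrite !fcoefB -B -B'; ring.
- by move=> e; rewrite fcoefB N // N' // subr0.
- by move=> e; rewrite fcoefB L // L' // subr0.
Qed.

Lemma lin_solutionD a b l rX rY a' b' l' rX' rY' :
  lin_solution a b l rX rY -> lin_solution a' b' l' rX' rY' ->
  lin_solution (a + a') (b + b') (l + l') (rX + rX') (rY + rY').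
Proof.
move=> [A B N L] [A' B' N' L']; split=> m.
- by rewrite !fcoefD mulrDr A A'.
- by rewrite !fcoefD -B -B'; ring.
- by move=> e; rewrite fcoefD N // N' // addr0.
- by move=> e; rewrite fcoefD L // L' // addr0.
Qed.

Lemma lin_solution_ordge d a b l rX rY : lin_solution a b l rX rY ->
  ordge d rX -> ordge d rY -> [/\ ordge d a, ordge d b & ordge d l].
Proof.
move=> [A B N L] hX hY; split=> m hm.
- by have := A m; rewrite hX // => /eqP; rewrite mulf_eq0 (negbTE (small_neq0 m)) => /eqP.
- case: (eqVneq (wt w m) 1) => [/N //|ne]; have := B m; rewrite hY // L // subr0.
  by move=> /eqP; rewrite !mulf_eq0 (negbTE kap0) subr_eq0 (negbTE ne) => /eqP.
case: (eqVneq (wt w m) 1) => [e|/L //]; have := B m; rewrite hY // e subrr mulr0 mul0r sub0r.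
by move/eqP; rewrite oppr_eq0 => /eqP.
Qed.

Let cB f g : comp1 (f - g) T = comp1 f T - comp1 g T.
Proof. exact: comp1B. Qed.

Let cD f g : comp1 (f + g) T = comp1 f T + comp1 g T.
Proof. exact: comp1D. Qed.

Let cB0 f g : comp1 (f - g) (dmap w) = comp1 f (dmap w) - comp1 g (dmap w).
Proof. exact: comp1B D0. Qed.

Let cD0 f g : comp1 (f + g) (dmap w) = comp1 f (dmap w) + comp1 g (dmap w).
Proof. exact: comp1D D0. Qed.

Let comp_gain d a : ordge d a -> ordge d.+1 (comp1 a T - comp1 a (dmap w)).
Proof. by move=> ha; rewrite -addn1; apply: (ordge_comp1B T0 D0 (e := 1) T1). Qed.

Lemma floquet_exists th : ordge 1 th -> exists a b l, floquet th a b l.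
Proof.
move=> th1.
pose nz (f : fps C n) : fps C n := f - cst (f 0%MM).
have nz1 f : ordge 1 (nz f).
  by apply/ordge1P; rewrite /nz fcoefB coef_cst eqxx mulr1 subrr.
have nzB d f f' : ordge d (f - f') -> ordge d (nz f - nz f').
  case: d => [|d] H //; have -> : nz f - nz f' = (f - f') - cst ((f - f') 0%MM).
    by rewrite /nz fcoefB rmorphB /=; ring.
  by rewrite H ?mdeg0 // rmorph0 subr0.
have nz_id f : ordge 1 f -> nz f = f by rewrite /nz => /ordge1P->; rewrite rmorph0 subr0.
(* One index type holds the three unknowns: [Some true] is a, [Some false] is b, [None] is l. *)
pose rX (F : option bool -> fps C n) :=
  resX th (nz (F (Some true))) (nz (F (Some false))) (nz (F None)).
pose rY (F : option bool -> fps C n) :=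
  resY th (nz (F (Some true))) (nz (F (Some false))) (nz (F None)).
pose Gam (F : option bool -> fps C n) (i : option bool) : fps C n := match i with
  | Some true => fun m => rX F m / (kap^-1 * wt w m - kap)
  | Some false => fun m => if wt w m == 1 then 0 else rY F m / (kap * (wt w m - 1))
  | None => fun m => if wt w m == 1 then - rY F m else 0
  end.
have GamB d F F' : ordge d (rX F - rX F') -> ordge d (rY F - rY F') ->
    forall i, ordge d (Gam F i - Gam F' i).
  move=> HX HY [[]|] m hm; rewrite fcoefB /=.
  - by rewrite -mulrBl -fcoefB HX // mul0r.
  - case: ifP => _; first by rewrite subrr.
    by rewrite -mulrBl -fcoefB HY // mul0r.
  - case: ifP => _; last by rewrite subrr.
    by rewrite opprK addrC -fcoefB -opprB fcoefN HY // oppr0.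
have prodB d f f' g g' : ordge d (f - f') -> ordge d (g - g') -> ordge 1 g -> ordge 1 f' ->
    ordge d.+1 (f * g - f' * g').
  move=> Hf Hg g1 f1; have -> : f * g - f' * g' = (f - f') * g + f' * (g - g') by ring.
  by apply: ordgeD; [rewrite -addn1 | rewrite -add1n]; apply: ordgeM.
have contr d F F' : (forall i, ordge d (F i - F' i)) -> forall i, ordge d.+1 (Gam F i - Gam F' i).
  move=> H; have HN i := nzB _ _ _ (H i).
  set a := nz (F (Some true)); set b := nz (F (Some false)); set l := nz (F None).
  set a' := nz (F' (Some true)); set b' := nz (F' (Some false)); set l' := nz (F' None).
  have Ha : ordge d (a - a') by apply: HN.
  have Hb : ordge d (b - b') by apply: HN.
  have Hl : ordge d (l - l') by apply: HN.
  have Hca : ordge d (comp1 (a - a') T) by apply: ordge_comp1.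
  have Hcb : ordge d (comp1 (b - b') T) by apply: ordge_comp1.
  have th_gain f : ordge d f -> ordge d.+1 (th * f).
    by rewrite -add1n => hf; apply: ordgeM.
  apply: GamB.
    have -> : rX F - rX F' = (l * a - l' * a')
      - cst kap^-1 * (comp1 (a - a') T - comp1 (a - a') (dmap w))
      + cst kap^-1 * (th * comp1 (a - a') T) - th * comp1 (b - b') T.
      by rewrite /rX /resX -/a -/b -/l -/a' -/b' -/l' !(cB a a') !(cB b b') (cB0 a a'); ring.
    apply: ordgeB; last exact: th_gain.
    apply: ordgeD; last by apply/ordgeMl/th_gain.
    by apply: ordgeB; [apply: prodB; rewrite ?/a ?/l' | apply/ordgeMl/comp_gain].
  have -> : rY F - rY F' = (l * b - l' * b')
      - cst kap * (comp1 (b - b') T - comp1 (b - b') (dmap w))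
      + th * comp1 (a - a') T - cst kap * (th * comp1 (b - b') T).
    by rewrite /rY /resY -/a -/b -/l -/a' -/b' -/l' !(cB a a') !(cB b b') (cB0 b b'); ring.
  apply: ordgeB; last by apply/ordgeMl/th_gain.
  apply: ordgeD; last exact: th_gain.
  by apply: ordgeB; [apply: prodB; rewrite ?/b ?/l' | apply/ordgeMl/comp_gain].
have [F HF] := fps_fixpoint contr.
have res1 f : ordge 1 f -> ordge 1 (comp1 f T - comp1 f (dmap w)).
  by move=> /comp_gain; apply: ordge_le.
have rX1 : ordge 1 (rX F).
  rewrite /rX /resX; apply: ordgeB; last exact: ordgeMr.
  apply: ordgeD; last by apply/ordgeMl/ordgeMr.
  by apply: ordgeB; [apply: ordgeMr | apply/ordgeMl/res1].
have rY1 : ordge 1 (rY F).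
  rewrite /rY /resY; apply: ordgeB; last by apply/ordgeMl/ordgeMr.
  apply: ordgeD; last exact: ordgeMr.
  by apply: ordgeB; [apply: ordgeMr | apply/ordgeMl/res1].
have F1 i : ordge 1 (F i).
  rewrite -HF; case: i => [[]|] m hm /=.
  - by rewrite rX1 // mul0r.
  - by rewrite rY1 // mul0r if_same.
  - by rewrite rY1 // oppr0 if_same.
have FE i m : F i m = Gam F i m by rewrite HF.
exists (F (Some true)), (F (Some false)), (F None).
split; try exact: F1.
have eX : resX th (F (Some true)) (F (Some false)) (F None) = rX F by rewrite /rX !nz_id.
have eY : resY th (F (Some true)) (F (Some false)) (F None) = rY F by rewrite /rY !nz_id.
rewrite eX eY; split=> m.
- by rewrite FE /= mulrC divfK.
- rewrite !FE /=; case: eqP => [->|/eqP ne]; first by rewrite subrr mulr0 sub0r opprK.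
  rewrite subr0 mulrC divfK; first by [].
  by rewrite mulf_neq0 ?subr_eq0.
- by move=> e; rewrite FE /= e eqxx.
- by move=> ne; rewrite FE /= (negbTE ne).
Qed.

Section Comparison.
Variables (th ph a b l a' b' l' : fps C n) (d : nat).
Hypothesis th1 : ordge 1 th.
Hypothesis ph_d : ordge d ph.
Hypothesis H : floquet th a b l.
Hypothesis H' : floquet (th + ph) a' b' l'.

Let rXE : resX (th + ph) a' b' l' - resX th a b l =
  (l' * (a' - a) + (l' - l) * a) - cst kap^-1 * (comp1 (a' - a) T - comp1 (a' - a) (dmap w))
  + cst kap^-1 * (th * comp1 (a' - a) T + ph * comp1 a' T)
  - th * comp1 (b' - b) T - ph * comp1 b' T - ph.
Proof. by rewrite /resX !(cB a' a) !(cB b' b) (cB0 a' a); ring. Qed.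

Let rYE : resY (th + ph) a' b' l' - resY th a b l =
  (l' * (b' - b) + (l' - l) * b) - cst kap * (comp1 (b' - b) T - comp1 (b' - b) (dmap w))
  + th * comp1 (a' - a) T + ph * comp1 a' T
  - cst kap * (th * comp1 (b' - b) T + ph * comp1 b' T) - cst kap * ph.
Proof. by rewrite /resY !(cB a' a) !(cB b' b) (cB0 b' b); ring. Qed.

Let gain e : ordge e (a' - a) -> ordge e (b' - b) -> ordge e (l' - l) -> (e <= d)%N ->
  ordge e.+1 (resX (th + ph) a' b' l' - resX th a b l + ph) /\
  ordge e.+1 (resY (th + ph) a' b' l' - resY th a b l + cst kap * ph).
Proof.
move=> Ha Hb Hl ed; have [a1 b1 l1 _] := H; have [a1' b1' l1' _] := H'.
have th_gain f : ordge e f -> ordge e.+1 (th * f).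
  by rewrite -add1n => hf; apply: ordgeM.
have ph_gain f : ordge 1 f -> ordge e.+1 (ph * f).
  by move=> hf; rewrite -addn1; apply: ordgeM hf; apply: ordge_le ed _.
have mul_gain f g : ordge 1 f -> ordge e g -> ordge e.+1 (f * g).
  by move=> hf hg; rewrite -add1n; apply: ordgeM.
have cT f e' : ordge e' f -> ordge e' (comp1 f T) by apply: ordge_comp1.
rewrite rXE rYE !subrK; split.
  apply: ordgeB; last by apply/ph_gain/cT.
  apply: ordgeB; last by apply/th_gain/cT.
  apply: ordgeD; last by apply/ordgeMl/ordgeD; [apply/th_gain/cT | apply/ph_gain/cT].
  apply: ordgeB; last by apply/ordgeMl/comp_gain.
  by apply: ordgeD; [apply: mul_gain | rewrite mulrC; apply: mul_gain].
apply: ordgeB; last by apply/ordgeMl/ordgeD; [apply/th_gain/cT | apply/ph_gain/cT].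
apply: ordgeD; last by apply/ph_gain/cT.
apply: ordgeD; last by apply/th_gain/cT.
apply: ordgeB; last by apply/ordgeMl/comp_gain.
by apply: ordgeD; [apply: mul_gain | rewrite mulrC; apply: mul_gain].
Qed.

(** Apart from the terms linear in [ph] alone, every term of the difference of the equations gains
    an order, so two solutions agree up to the order of [ph]. With [ph] = 0 this is uniqueness. *)
Lemma floquet_close : [/\ ordge d (a' - a), ordge d (b' - b) & ordge d (l' - l)].
Proof.
have [_ _ _ E] := H; have [_ _ _ E'] := H'; have EB := lin_solutionB E' E.
suff G e : (e <= d)%N -> [/\ ordge e (a' - a), ordge e (b' - b) & ordge e (l' - l)] by apply: G.
elim: e => [|e IH] ed //.
have [Ha Hb Hl] := IH (ltnW ed); have [gX gY] := gain Ha Hb Hl (ltnW ed).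
have phe : ordge e.+1 ph by apply: ordge_le ed _.
apply: (lin_solution_ordge EB).
  by have := ordgeB gX phe; rewrite addrK.
by have := ordgeB gY (ordgeMl (cst kap) phe); rewrite addrK.
Qed.

(** In degree exactly d only the inhomogeneous terms - [ph] and - kap [ph] survive; the first
    variation is a plain division by the divisors. *)
Lemma floquet_leading m : mdeg m = d ->
  (kap^-1 * wt w m - kap) * (a' - a) m = - ph m /\
  (wt w m != 1 -> (wt w m - 1) * (b' - b) m = - ph m).
Proof.
move=> md; have [Ha Hb Hl] := floquet_close; have [gX gY] := gain Ha Hb Hl (leqnn d).
have [_ _ _ E] := H; have [_ _ _ E'] := H'; have [A B N L] := lin_solutionB E' E.
have hm : (mdeg m < d.+1)%N by rewrite md.
split.
  rewrite A; apply/eqP; rewrite -subr_eq0 opprK -fcoefD.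
  by apply/eqP; apply: gX.
move=> ne; apply: (mulfI kap0); have := B m; rewrite L // subr0 mulrA => ->.
apply/eqP; rewrite mulrN -subr_eq0 opprK -fcoefCM -fcoefD; apply/eqP; exact: gY.
Qed.

End Comparison.

(** The factor with which the first-order response of a and b at weight [om] feeds back into l. For
    kap = 3 the first denominator is (om - 9) / 3, the small divisor. *)
Definition second_order om := om / (kap^-1 * om - kap) - kap * om / (om - 1).

(** The second differences [va], [vb], [vl] solve the same linear system with the quadratic sources
    [qX], [qY] of order 2d. At the resonant monomial of degree 2d all other terms have higher order,
    so [vl] equals minus the coefficient of [qY], which the leading responses determine. *)
Lemma floquet_second_difference th ph d a b l a1 b1 l1 a2 b2 l2 (p p' : C) m m' :
  ordge 1 th -> (0 < d)%N -> ordge d ph ->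
  mdeg m = d -> mdeg m' = d -> m != m' -> wt w m * wt w m' = 1 -> wt w m != 1 ->
  ordge d.+1 (ph - cst p * mon C m - cst p' * mon C m') ->
  floquet th a b l -> floquet (th + ph) a1 b1 l1 -> floquet (th - ph) a2 b2 l2 ->
  (l1 + l2 - (l + l)) (m + m')%MM =
    2 * (p * p') * (second_order (wt w m) + second_order (wt w m')).
Proof.
move=> th1 d0 phd md md' mne ww wm ph_lead H H1 H2.
have phNd : ordge d (- ph) by apply: ordgeN.
have [Ha1 Hb1 Hl1] := floquet_close th1 phd H H1.
have [Ha2 Hb2 Hl2] := floquet_close th1 phNd H H2.
have [oa ob ol E] := H; have [_ _ _ E1] := H1; have [_ _ _ E2] := H2.
have EV := lin_solutionB (lin_solutionD E1 E2) (lin_solutionD E E).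
set va := a1 + a2 - (a + a) in EV; set vb := b1 + b2 - (b + b) in EV.
set vl := l1 + l2 - (l + l) in EV *.
have dda : ordge d (a1 - a2).
  by have := ordgeB Ha1 Ha2; congr ordge; ring.
have ddb : ordge d (b1 - b2).
  by have := ordgeB Hb1 Hb2; congr ordge; ring.
pose qX := (l1 - l) * (a1 - a) + (l2 - l) * (a2 - a)
  + cst kap^-1 * (ph * comp1 (a1 - a2) T) - ph * comp1 (b1 - b2) T.
pose qY := (l1 - l) * (b1 - b) + (l2 - l) * (b2 - b)
  + ph * comp1 (a1 - a2) T - cst kap * (ph * comp1 (b1 - b2) T).
have rX : resX (th + ph) a1 b1 l1 + resX (th - ph) a2 b2 l2 - (resX th a b l + resX th a b l)
   = (l * va + vl * a) - cst kap^-1 * (comp1 va T - comp1 va (dmap w))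
     + cst kap^-1 * (th * comp1 va T) - th * comp1 vb T + qX.
  by rewrite /resX /qX /va /vb /vl (cB a1) (cB b1) !(cB (a1 + a2)) !(cB (b1 + b2)) (cB0 (a1 + a2))
      !(cD a1) !(cD a) !(cD b1) !(cD b) (cD0 a1) (cD0 a); ring.
have rY : resY (th + ph) a1 b1 l1 + resY (th - ph) a2 b2 l2 - (resY th a b l + resY th a b l)
   = (l * vb + vl * b) - cst kap * (comp1 vb T - comp1 vb (dmap w))
     + th * comp1 va T - cst kap * (th * comp1 vb T) + qY.
  by rewrite /resY /qY /va /vb /vl (cB a1) (cB b1) !(cB (a1 + a2)) !(cB (b1 + b2)) (cB0 (b1 + b2))
      !(cD a1) !(cD a) !(cD b1) !(cD b) (cD0 b1) (cD0 b); ring.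
rewrite rX rY in EV.
have qX2 : ordge (d + d) qX.
  rewrite /qX; apply: ordgeB; last by apply: ordgeM => //; apply: ordge_comp1.
  apply: ordgeD; last by apply/ordgeMl/ordgeM => //; apply: ordge_comp1.
  by apply: ordgeD; apply: ordgeM.
have qY2 : ordge (d + d) qY.
  rewrite /qY; apply: ordgeB; last by apply/ordgeMl/ordgeM => //; apply: ordge_comp1.
  apply: ordgeD; last by apply: ordgeM => //; apply: ordge_comp1.
  by apply: ordgeD; apply: ordgeM.
have gain e : ordge e va -> ordge e vb -> ordge e vl ->
   ordge e.+1 ((l * va + vl * a) - cst kap^-1 * (comp1 va T - comp1 va (dmap w))
     + cst kap^-1 * (th * comp1 va T) - th * comp1 vb T) /\
   ordge e.+1 ((l * vb + vl * b) - cst kap * (comp1 vb T - comp1 vb (dmap w))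
     + th * comp1 va T - cst kap * (th * comp1 vb T)).
  move=> Va Vb Vl.
  have mul_gain f g : ordge 1 f -> ordge e g -> ordge e.+1 (f * g).
    by move=> hf hg; rewrite -add1n; apply: ordgeM.
  have cT f e' : ordge e' f -> ordge e' (comp1 f T) by apply: ordge_comp1.
  split.
    apply: ordgeB; last by apply/mul_gain/cT.
    apply: ordgeD; last by apply/ordgeMl/mul_gain/cT.
    apply: ordgeB; last by apply/ordgeMl/comp_gain.
    by apply: ordgeD; [apply: mul_gain | rewrite mulrC; apply: mul_gain].
  apply: ordgeB; last by apply/ordgeMl/mul_gain/cT.
  apply: ordgeD; last by apply/mul_gain/cT.
  apply: ordgeB; last by apply/ordgeMl/comp_gain.
  by apply: ordgeD; [apply: mul_gain | rewrite mulrC; apply: mul_gain].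
have V e : (e <= d + d)%N -> [/\ ordge e va, ordge e vb & ordge e vl].
  elim: e => [|e IH] ed //; have [Va Vb Vl] := IH (ltnW ed).
  have [gX gY] := gain e Va Vb Vl.
  apply: (lin_solution_ordge EV); apply: ordgeD => //; exact: ordge_le ed _.
have [Va Vb Vl] := V _ (leqnn _); have [_ gY] := gain _ Va Vb Vl.
have [_ B _ _] := EV.
have mm : mdeg (m + m')%MM = (d + d)%N by rewrite mdegD md md'.
have wmm : wt w (m + m')%MM = 1 by rewrite wtD.
have := B (m + m')%MM; rewrite wmm subrr mulr0 mul0r sub0r fcoefD gY ?mm // add0r => vlE.
have wm' : wt w m' != 1.
  by apply: contraNneq wm => e; rewrite e mulr1 in ww; rewrite ww.
(* A resonant monomial factored with one part of weight 1 has its other part of weight 1. Products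
   of a variation of l with a variation of b therefore do not contribute. *)
have disj (f g : fps C n) : (forall k, wt w k != 1 -> f k = 0) -> (forall k, wt w k = 1 -> g k = 0) ->
    (f * g) (m + m')%MM = 0.
  move=> hf hg; rewrite fcoefME big1 // => -[k1 k2] /= /eqP e.
  case: (eqVneq (wt w k1) 1) => [e1|/hf->]; last by rewrite mul0r.
  rewrite hg ?mulr0 //; have := congr1 (wt w) e.
  by rewrite wmm wtD e1 mul1r => <-.
have [_ _ N1 L1] := lin_solutionB E1 E; have [_ _ N2 L2] := lin_solutionB E2 E.
pose Hf := comp1 (a1 - a2) T - cst kap * comp1 (b1 - b2) T.
have Hfd : ordge d Hf by apply: ordgeB; [| apply: ordgeMl]; apply: ordge_comp1.
have qE : qY (m + m')%MM = (ph * Hf) (m + m')%MM.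
  have -> : qY = (l1 - l) * (b1 - b) + (l2 - l) * (b2 - b) + ph * Hf by rewrite /qY /Hf; ring.
  by rewrite !fcoefD (disj (l1 - l)) // (disj (l2 - l)) // !add0r.
have phH : (ph * Hf) (m + m')%MM = p * Hf m' + p' * Hf m.
  have := ordgeM ph_lead Hfd (_ : (mdeg (m + m')%MM < _)%N); rewrite mm addSn ltnSn => /(_ isT).
  have -> : (ph - cst p * mon C m - cst p' * mon C m') * Hf =
     ph * Hf - cst p * (Hf * mon C m) - cst p' * (Hf * mon C m') by ring.
  have e1 : (Hf * mon C m) (m + m')%MM = Hf m' by rewrite fcoefMX.
  have e2 : (Hf * mon C m') (m + m')%MM = Hf m by rewrite addmC fcoefMX.
  by rewrite !fcoefB !fcoefCM e1 e2 -addrA -opprD => /eqP; rewrite subr_eq0 => /eqP.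
have HfE k : mdeg k = d -> wt w k != 1 -> Hf k = - (2 * ph k * second_order (wt w k)).
  move=> kd wk; rewrite /Hf fcoefB fcoefCM !(comp1_lead T0 T1) ?kd //.
  have [A1 B1] := floquet_leading th1 phd H H1 kd; have [A2 B2] := floquet_leading th1 phNd H H2 kd.
  have {}A1 : (a1 - a) k = - ph k / (kap^-1 * wt w k - kap) by rewrite -A1 mulrC mulKf.
  have {}A2 : (a2 - a) k = ph k / (kap^-1 * wt w k - kap).
    by move: A2; rewrite fcoefN opprK => <-; rewrite mulrC mulKf.
  have wk1 : wt w k - 1 != 0 by rewrite subr_eq0.
  have {}B1 : (b1 - b) k = - ph k / (wt w k - 1) by rewrite -(B1 wk) mulrC mulKf.
  have {}B2 : (b2 - b) k = ph k / (wt w k - 1).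
    by move: (B2 wk); rewrite fcoefN opprK => <-; rewrite mulrC mulKf.
  have -> : (a1 - a2) k = (a1 - a) k - (a2 - a) k by rewrite !fcoefB; ring.
  have -> : (b1 - b2) k = (b1 - b) k - (b2 - b) k by rewrite !fcoefB; ring.
  by rewrite A1 A2 B1 B2 /second_order; ring.
have phm : ph m = p /\ ph m' = p'.
  split; apply/eqP; rewrite -subr_eq0.
    have := ph_lead m; rewrite md => /(_ (ltnSn _)).
    by rewrite !fcoefB !fcoefCM !coef_mon eqxx [m' == m]eq_sym (negbTE mne) mulr1 mulr0 subr0 => ->.
  have := ph_lead m'; rewrite md' => /(_ (ltnSn _)).
  by rewrite !fcoefB !fcoefCM !coef_mon eqxx (negbTE mne) mulr1 mulr0 subr0 => ->.
have [pm pm'] := phm.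
apply: oppr_inj; rewrite vlE qE phH !HfE // pm pm'; ring.
Qed.

End Floquet.

(** * Lacunary perturbations *)

Section Swap.
Variable C : numClosedFieldType.

Lemma swap_l p j : swap_ord (lshift p j) = rshift p j.
Proof. by rewrite /swap_ord (unsplitK (inl _ j)). Qed.

Lemma swap_r p j : swap_ord (rshift p j) = lshift p j.
Proof. by rewrite /swap_ord (unsplitK (inr _ j)). Qed.

Lemma swap_ordK p : involutive (@swap_ord p).
Proof. by move=> i; case: (split_ordP i) => j ->; rewrite !(swap_l, swap_r). Qed.

Definition swmap p : fmap C (p + p) (p + p) := fun i => fid C (swap_ord i).

Lemma vanishes0_swmap p : vanishes0 (@swmap p).
Proof. by move=> i; apply: vanishes0_fid. Qed.

Definition mswap p (m : 'X_{1..p + p}) : 'X_{1..p + p} :=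
  [multinom m (swap_ord i) | i < p + p].

Lemma mdeg_mswap p (m : 'X_{1..p + p}) : mdeg (mswap m) = mdeg m.
Proof.
rewrite !mdegE (reindex_inj (can_inj (@swap_ordK p))); apply: eq_bigr => i _.
by rewrite mnmE swap_ordK.
Qed.

Lemma comp1_mon_swap p (m : 'X_{1..p + p}) : comp1 (mon C m) (@swmap p) = mon C (mswap m).
Proof.
rewrite comp1_mon; last exact: vanishes0_swmap.
rewrite -prodr_fid [RHS](reindex_inj (can_inj (@swap_ordK p))); apply: eq_bigr => i _.
by rewrite mnmE swap_ordK.
Qed.

Lemma swmapK p : fcomp (@swmap p) (@swmap p) = @fid C (p + p).
Proof.
apply: fmap_ext => i; rewrite fcompE comp1_fid; last exact: vanishes0_swmap.
by rewrite /swmap swap_ordK.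
Qed.

End Swap.
Arguments swmap {C} p.

Section Lacunary.
Variables (C : numClosedFieldType) (q : nat) (kap : C) (w : 'I_(q + q) -> C).
Variables (T : fmap C (q + q) (q + q)) (mQ : nat -> 'X_{1..q + q}).
Hypothesis T0 : vanishes0 T.
Hypothesis T1 : forall i, ordge 2 (T i - dmap w i).
Hypothesis kap0 : kap != 0.
Hypothesis small_neq0 : forall m, kap^-1 * wt w m - kap != 0.
Hypothesis w_swap : forall m, wt w m * wt w (mswap m) = 1.
Hypothesis mQ_gt0 : (0 < mdeg (mQ 0%N))%N.
Hypothesis mQ_lac : forall k, (2 * mdeg (mQ k) < mdeg (mQ k.+1))%N.
Hypothesis mQ_swap : forall k, mQ k != mswap (mQ k).
Hypothesis mQ_wt : forall k, wt w (mQ k) != 1.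
Local Notation om k := (wt w (mQ k)).
Hypothesis mQ_large : forall k, 4 * (k.+1%:R : C) ^+ (2 * mdeg (mQ k)).+1 <=
  `| om k / 2 * (second_order kap (om k) + second_order kap (om k)^-1) |.
Hypothesis arch : forall r : C, 0 <= r -> exists N : nat, r <= N%:R.

Lemma mdeg_mQ_mono j k : (j <= k)%N -> (mdeg (mQ j) <= mdeg (mQ k))%N.
Proof.
elim: k => [|k IH]; first by rewrite leqn0 => /eqP->.
rewrite leq_eqVlt => /orP[/eqP-> //|/IH h]; apply: leq_trans h _.
by apply: leq_trans (ltnW (mQ_lac k)); rewrite mul2n -addnn leq_addr.
Qed.

Lemma mdeg_mQ_lt j k : (j < k)%N -> (2 * mdeg (mQ j) < mdeg (mQ k))%N.
Proof. by move=> h; apply: leq_trans (mQ_lac j) (mdeg_mQ_mono h). Qed.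

Lemma mdeg_mQ_pos k : (0 < mdeg (mQ k))%N.
Proof. by apply: leq_trans mQ_gt0 (mdeg_mQ_mono _). Qed.

Lemma mdeg_mQ_gt k : (k < mdeg (mQ k))%N.
Proof.
elim: k => [|k IH] //; apply: leq_ltn_trans IH _; apply: leq_ltn_trans (mQ_lac k).
by rewrite mul2n -addnn leq_addr.
Qed.

(** The formal sum of h_k times the monomial Q_k. Stopping at k = |m| loses nothing, since |Q_k| >
    k. *)
Definition lacunary (h : nat -> C) : fps C (q + q) := fun m =>
  \sum_(k < (mdeg m).+1) h k * (mQ k == m)%:R.

Lemma mQ_inj : injective mQ.
Proof.
move=> j k e; case: (ltngtP j k) => // /mdeg_mQ_lt; rewrite e => h;
  by move: h; rewrite mul2n -addnn ltnNge leq_addr.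
Qed.

Lemma lacunaryB h h' : lacunary h - lacunary h' = lacunary (fun k => h k - h' k).
Proof.
apply: fps_ext => m; rewrite fcoefB /lacunary -sumrB; apply: eq_bigr => k _.
by rewrite mulrBl.
Qed.

Lemma lacunary_ordge k h : (forall j, (j < k)%N -> h j = 0) -> ordge (mdeg (mQ k)) (lacunary h).
Proof.
move=> H m hm; rewrite /lacunary big1 // => j _; case: eqP => [e|]; last by rewrite mulr0.
case: (ltnP j k) => [/H->|kj]; first by rewrite mul0r.
by have := mdeg_mQ_mono kj; rewrite e leqNgt hm.
Qed.

Lemma lacunary_delta k c : lacunary (fun j => if j == k then c else 0) = cst _ c * mon C (mQ k).
Proof.
apply: fps_ext => m; rewrite fcoefCM coef_mon /lacunary.
case: (eqVneq (mQ k) m) => [e|ne].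
  have hk : (k < (mdeg m).+1)%N by rewrite -e ltnW // ltnS mdeg_mQ_gt.
  rewrite (bigD1 (Ordinal hk)) //= eqxx e eqxx big1 ?addr0 // => j nj.
  rewrite ifN ?mul0r //; apply: contraNneq nj => ej; apply/eqP; exact: val_inj.
rewrite mulr0 big1 // => j _; case: eqP => [->|_]; last by rewrite mul0r.
by rewrite (negbTE ne) mulr0.
Qed.

Lemma geo_lacunary h : (forall k, `|h k| <= 1) -> geo (lacunary h).
Proof.
move=> H; exists 1, 1; split=> // m; rewrite expr1n mulr1.
case: (pselect (exists k, mQ k = m)) => [[k e]|ne]; last first.
  rewrite /lacunary big1 ?normr0 // => j _; case: eqP => [e|]; last by rewrite mulr0.
  by case: ne; exists j.
have hk : (k < (mdeg m).+1)%N by rewrite -e ltnW // ltnS mdeg_mQ_gt.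
rewrite /lacunary (bigD1 (Ordinal hk)) //= e eqxx mulr1 big1 ?addr0 // => j nj.
case: eqP => [e2|]; last by rewrite mulr0.
by case/eqP: nj; apply: val_inj; apply: mQ_inj; rewrite e e2.
Qed.

(** The form in which g acts on the third pair: comparing the sign change of V_3 before and after
    the half map gives the average of g o swap and g o T. *)
Definition coupling (g : fps C (q + q)) : fps C (q + q) :=
  cst _ 2^-1 * (comp1 g (swmap q) + comp1 g T).

Let sw0 := @vanishes0_swmap C q.

Lemma couplingB g g' : coupling (g - g') = coupling g - coupling g'.
Proof. by rewrite /coupling !comp1B //; ring. Qed.

Lemma coupling_ordge d g : ordge d g -> ordge d (coupling g).
Proof. by move=> hg; apply/ordgeMl/ordgeD; apply: ordge_comp1. Qed.

(** One monomial of g produces two leading monomials, of weights om and 1/om. Their product is the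
    resonant monomial at which the second variation is read. *)
Lemma coupling_mon m c :
  ordge (mdeg m).+1 (coupling (cst _ c * mon C m)
     - cst _ (c * wt w m / 2) * mon C m - cst _ (c / 2) * mon C (mswap m)).
Proof.
have D0 := vanishes0_dmap w.
rewrite /coupling !comp1M // !comp1_cst // comp1_mon_swap.
have e : comp1 (mon C m) (dmap w) = cst _ (wt w m) * mon C m.
  apply: fps_ext => k; rewrite comp1_dmap fcoefCM coef_mon.
  by case: eqP => [->|]; rewrite ?mulr0.
have h : ordge (mdeg m).+1 (comp1 (mon C m) T - comp1 (mon C m) (dmap w)).
  by rewrite -addn1; apply: (ordge_comp1B T0 D0 (e := 1) T1); apply: ordge_mon.
rewrite e in h; have := ordgeMl (cst _ (c / 2)) h; congr ordge.
by rewrite !rmorphM; ring.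
Qed.

Lemma floquet_choice (g : fps C (q + q)) : ordge 1 g ->
  {abl : fps C (q + q) * fps C (q + q) * fps C (q + q) |
    floquet kap w T (coupling g) abl.1.1 abl.1.2 abl.2}.
Proof.
move=> g1; apply: cid.
have [a [b [l H]]] := floquet_exists T0 T1 kap0 small_neq0 (coupling_ordge g1).
by exists (a, b, l).
Qed.

Lemma ordge1_lacunary h : ordge 1 (lacunary h).
Proof.
apply: (@ordge_le _ _ _ (mdeg (mQ 0%N))); first exact: mQ_gt0.
exact: lacunary_ordge.
Qed.

Definition multiplier h := (sval (floquet_choice (ordge1_lacunary h))).2.

Lemma multiplierP h : exists a b, floquet kap w T (coupling (lacunary h)) a b (multiplier h).
Proof.
rewrite /multiplier; case: floquet_choice => -[[a b] l] /= H; by exists a, b.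
Qed.

(** The monomial has degree 2 |Q_k| < |Q_(k+1)|, out of reach of all later terms of g. *)
Lemma multiplier_stable k h h' : (forall j, (j <= k)%N -> h j = h' j) ->
  multiplier h (mQ k + mswap (mQ k))%MM = multiplier h' (mQ k + mswap (mQ k))%MM.
Proof.
move=> H; have [a [b F]] := multiplierP h; have [a' [b' F']] := multiplierP h'.
pose ph := coupling (lacunary h') - coupling (lacunary h).
have E : coupling (lacunary h') = coupling (lacunary h) + ph by rewrite /ph; ring.
have phd : ordge (mdeg (mQ k.+1)) ph.
  rewrite /ph -couplingB lacunaryB; apply/coupling_ordge/lacunary_ordge => j.
  by rewrite ltnS => /H ->; rewrite subrr.
rewrite E in F'.
have [_ _ L] := floquet_close T0 T1 kap0 small_neq0 (coupling_ordge (ordge1_lacunary h)) phd F F'.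
have := L (mQ k + mswap (mQ k))%MM; rewrite mdegD mdeg_mswap addnn -mul2n => /(_ (mQ_lac k)).
by rewrite fcoefB => /eqP; rewrite subr_eq0 => /eqP.
Qed.

(** If the values for c = 0, 1 and -1 were all smaller than V, the second difference would be
    smaller than 4 V. Which c works may depend on the earlier coefficients. *)
Lemma multiplier_large (h : nat -> C) k : exists2 c : C, `|c| <= 1 /\ c \is Num.real &
  k.+1%:R ^+ (2 * mdeg (mQ k)).+1 <=
  `|multiplier (fun j => if (j < k)%N then h j else if j == k then c else 0)
      (mQ k + mswap (mQ k))%MM|.
Proof.
pose hh c := fun j => if (j < k)%N then h j else if j == k then c else 0.
set V := k.+1%:R ^+ _; set M := (mQ k + _)%MM.
have [a [b F]] := multiplierP (hh 0); have [a1 [b1 F1]] := multiplierP (hh 1).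
have [a2 [b2 F2]] := multiplierP (hh (-1)).
pose ph := coupling (mon C (mQ k)).
have lac c : lacunary (hh c) - lacunary (hh 0) = cst _ c * mon C (mQ k).
  rewrite lacunaryB -lacunary_delta; congr lacunary.
  apply: functional_extensionality_dep => j; rewrite /hh.
  by case: ltngtP => _; rewrite ?subrr ?subr0.
have E1 : coupling (lacunary (hh 1)) = coupling (lacunary (hh 0)) + ph.
  by rewrite /ph -[mon C _]mul1r -(rmorph1 (cst (q + q))) -lac couplingB; ring.
have E2 : coupling (lacunary (hh (-1))) = coupling (lacunary (hh 0)) - ph.
  have -> : ph = - coupling (cst _ (-1) * mon C (mQ k)).
    have -> : cst (q + q) (-1 : C) * mon C (mQ k) = 0 - mon C (mQ k).
      by rewrite rmorphN rmorph1; ring.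
    by rewrite couplingB /ph /coupling !comp1_0 //; ring.
  by rewrite -lac couplingB; ring.
rewrite E1 in F1; rewrite E2 in F2.
have dQ := mdeg_mQ_pos k.
have phd : ordge (mdeg (mQ k)) ph by apply/coupling_ordge/ordge_mon.
have lead := @coupling_mon (mQ k) 1; rewrite rmorph1 !mul1r in lead.
have wV : wt w (mswap (mQ k)) = (om k)^-1.
  have w0 : om k != 0.
    apply: contraTneq isT => e; have := w_swap (mQ k).
    by rewrite e mul0r => /esym/eqP; rewrite oner_eq0.
  by apply: (mulfI w0); rewrite w_swap mulfV.
have := floquet_second_difference T0 T1 kap0 small_neq0 (coupling_ordge (ordge1_lacunary (hh 0)))
  dQ phd erefl (mdeg_mswap _) (mQ_swap k) (w_swap _) (mQ_wt k) lead F F1 F2.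
rewrite wV -/M => E.
have V0 : 0 <= V by apply: exprn_ge0; apply: ler0n.
have Vr : V \is Num.real by apply: ger0_real.
have big : 4 * V <= `|multiplier (hh 1) M| + `|multiplier (hh (-1)) M|
    + (`|multiplier (hh 0) M| + `|multiplier (hh 0) M|).
  apply: le_trans (mQ_large k) _.
  have -> : om k / 2 * (second_order kap (om k) + second_order kap (om k)^-1) =
     2 * (om k / 2 * 2^-1) * (second_order kap (om k) + second_order kap (om k)^-1).
    by field.
  rewrite -E; apply: le_trans (ler_normB _ _) _.
  by apply: lerD; apply: ler_normD.
have n01 : `|0 : C| <= 1 by rewrite normr0 ler01.
have n11 : `|1 : C| <= 1 by rewrite normr1.
have nN1 : `|-1 : C| <= 1 by rewrite normrN normr1.
case: (real_leP Vr (normr_real (multiplier (hh 1) M))) => h1; first by exists 1; rewrite ?rpred1.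
case: (real_leP Vr (normr_real (multiplier (hh (-1)) M))) => h2; first by exists (-1); rewrite ?rpredN1.
case: (real_leP Vr (normr_real (multiplier (hh 0) M))) => h3; first by exists 0; rewrite ?rpred0.
have := ltrD (ltrD h1 h2) (ltrD h3 h3) => lt.
have := le_lt_trans big lt; have -> : V + V + (V + V) = 4 * V by ring.
by rewrite ltxx.
Qed.

Lemma floquet_multiplier h a b l :
  floquet kap w T (coupling (lacunary h)) a b l -> l = multiplier h.
Proof.
move=> F; have [a' [b' F']] := multiplierP h; apply: ordge_eq => d.
have z : ordge d (0 : fps C (q + q)) by [].
rewrite -[coupling _]addr0 in F.
by have [_ _] := floquet_close T0 T1 kap0 small_neq0 (coupling_ordge (ordge1_lacunary h)) z F' F.
Qed.

Lemma exists_divergent : exists h : nat -> C, (forall k, `|h k| <= 1 /\ h k \is Num.real) /\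
  forall a b l, floquet kap w T (coupling (lacunary h)) a b l -> ~ geo l.
Proof.
pose M k := (mQ k + mswap (mQ k))%MM.
pose large (kh : nat * (nat -> C)) c := (`|c| <= 1 /\ c \is Num.real) /\
   kh.1.+1%:R ^+ (2 * mdeg (mQ kh.1)).+1 <= `|multiplier (fun j =>
     if (j < kh.1)%N then kh.2 j else if j == kh.1 then c else 0) (M kh.1)|.
have /choice [pick hp] : forall kh, exists c, large kh c.
  by move=> [k h]; have [c c1 c2] := multiplier_large h k; exists c.
(* Each coefficient depends on all earlier ones, so the recursion carries their list; [nth 0] reads
   it as a sequence, of which only the entries below k are consulted. *)
pose pre := fix pre k := if k is k'.+1 then rcons (pre k') (pick (k', nth 0 (pre k'))) else [::].
have spre k : size (pre k) = k by elim: k => //= k IH; rewrite size_rcons IH.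
pose h k := nth 0 (pre k.+1) k.
have hE j k : (j < k)%N -> nth 0 (pre k) j = h j.
  elim: k => // k IH; rewrite ltnS leq_eqVlt => /orP[/eqP-> //|jk].
  by rewrite /= nth_rcons spre jk IH.
have hk k : h k = pick (k, nth 0 (pre k)) by rewrite /h /= nth_rcons spre ltnn eqxx.
exists h; split=> [k|a b l /floquet_multiplier->].
  by rewrite hk; case: (hp (k, nth 0 (pre k))).
case=> R [B [R0 B0 H]].
have [N hN] := arch R0; have [N' hN'] := arch B0.
(* This k exceeds both constants of a presumed geometric bound, which would give (k + 1)^(d + 1) <=
   k (k + 1)^d. *)
pose k := (N + N')%N; set d := (2 * mdeg (mQ k))%N.
have dM : mdeg (M k) = d by rewrite mdegD mdeg_mswap addnn -mul2n.
have [_ /=] := hp (k, nth 0 (pre k)).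
have -> : multiplier (fun j => if (j < k)%N then nth 0 (pre k) j
    else if j == k then pick (k, nth 0 (pre k)) else 0) (M k) = multiplier h (M k).
  apply: multiplier_stable => j; rewrite leq_eqVlt => /orP[/eqP->|jk].
    by rewrite ltnn eqxx hk.
  by rewrite jk hE.
have Rk : R <= k.+1%:R by apply: le_trans hN _; rewrite ler_nat -addnS leq_addr.
have Bk : B <= k%:R by apply: le_trans hN' _; rewrite ler_nat leq_addl.
have := H (M k); rewrite dM => h1 h2.
have h3 : B * R ^+ d <= k%:R * k.+1%:R ^+ d.
  by apply: ler_pM => //; rewrite ?exprn_ge0 // lerXn2r // nnegrE ler0n.
have := le_trans h2 (le_trans h1 h3); rewrite -/d exprS ler_pM2r ?exprn_gt0 ?ltr0n //.
by rewrite ler_nat ltnn.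
Qed.

End Lacunary.

(** * A Liouville multiplier *)

Section Liouville.
Variable R : realType.

Lemma expr_unbounded (rho M : R) : 1 < rho -> exists b : nat, M <= rho ^+ b.
Proof.
move=> rho1; have h0 : 0 < rho - 1 by rewrite subr_gt0.
have bern (b : nat) : 1 + b%:R * (rho - 1) <= rho ^+ b.
  elim: b => [|b IH]; first by rewrite mul0r addr0 expr0.
  rewrite exprS; apply: le_trans (ler_wpM2l _ IH); last by rewrite ltW // (lt_trans ltr01).
  rewrite -natr1 -subr_ge0.
  have -> : rho * (1 + b%:R * (rho - 1)) - (1 + (b%:R + 1) * (rho - 1)) =
    b%:R * (rho - 1) ^+ 2 by ring.
  by rewrite mulr_ge0 ?sqr_ge0.
exists (Num.bound `|M / (rho - 1)|); apply: le_trans (bern _).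
apply: ler_wpDl => //; rewrite -ler_pdivrMr //.
by apply: le_trans (ler_norm _) _; apply: ltW; apply: archi_boundP; apply: normr_ge0.
Qed.

(** As x^v is increasing, its value at an interior point [y] tells which side of [y] misses [c].
    Taking the middle third of that side keeps the inclusions strict. *)
Lemma interval_avoid (l r c : R) (v : nat) : 1 < l -> l < r -> (0 < v)%N ->
  exists l' r', [/\ l < l', l' < r', r' < r & forall x, l' <= x <= r' -> x ^+ v != c].
Proof.
move=> l1 lr v0.
have [y [ly yr]] : exists y, l < y /\ y < r by exists ((l + r) / 2); split; lra.
have mono s t : 0 <= s -> s < t -> s ^+ v < t ^+ v by move=> s0 st; rewrite ltrXn2r -?lt0n.
case: (ltP (y ^+ v) c) => h.
  exists ((2 * l + y) / 3), ((l + 2 * y) / 3); split; try lra.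
  move=> x /andP[h1 h2]; rewrite lt_eqF //; apply: lt_trans h.
  by apply: mono; lra.
exists ((2 * y + r) / 3), ((y + 2 * r) / 3); split; try lra.
move=> x /andP[h1 h2]; rewrite gt_eqF //; apply: le_lt_trans h _.
by apply: mono; lra.
Qed.

(** For large b the ratio r^b / l^b is at least 3, so some 9 * 2^a lies between l^b and r^b. Its
    b-th root y is inside the interval, and points slightly to the right of y satisfy both
    requirements. *)
Lemma interval_approx (l r : R) (N k : nat) : 1 < l -> l < r ->
  exists l' r' (a b : nat), [/\ l < l', l' < r', r' < r, (N < a)%N &
    forall x, l' <= x <= r' -> 0 < x ^+ b - 9 * 2 ^+ a /\
      (x ^+ b - 9 * 2 ^+ a) * k.+1%:R ^+ (2 * (a + b)).+1 <= 2 ^+ a].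
Proof.
move=> l1 lr; have l0 : 0 < l by lra.
have [b1 hb1] := expr_unbounded (9 * 2 ^+ N) l1.
have rl1 : 1 < r / l by rewrite ltr_pdivlMr // mul1r.
have [b2 hb2] := expr_unbounded 3 rl1.
pose b := (b1 + b2).+1.
have lb : 9 * 2 ^+ N <= l ^+ b.
  apply: le_trans hb1 _; rewrite ler_weXn2l // ?(ltW l1) // /b -addnS leq_addr //.
have rb : 3 * l ^+ b <= r ^+ b.
  rewrite -ler_pdivlMr ?exprn_gt0 // -expr_div_n; apply: le_trans hb2 _.
  by rewrite ler_weXn2l // ?(ltW rl1) // /b ltnW // ltnS leq_addl.
have two1 : 1 < (2 : R) by rewrite ltr1n.
have [a0 ha0] := expr_unbounded (l ^+ b) two1.
have exa : exists a, l ^+ b < 9 * 2 ^+ a.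
  exists a0; apply: le_lt_trans ha0 _.
  have : (0 : R) < 2 ^+ a0 by rewrite exprn_gt0.
  lra.
case: (ex_minnP exa) => a la amin.
have Na : (N < a)%N.
  rewrite -(ltr_eXn2l (x := 2 : R)) ?ltr1n //.
  by rewrite -(ltr_pM2l (x := 9)) //; apply: le_lt_trans lb la.
have ar : 9 * 2 ^+ a < r ^+ b.
  have a1 : (0 < a)%N by apply: leq_ltn_trans Na.
  have : ~~ (l ^+ b < 9 * 2 ^+ a.-1).
    by apply/negP => /amin; rewrite leqNgt prednK // leqnn.
  rewrite -leNgt => h; apply: lt_le_trans rb.
  rewrite -(prednK a1) exprS; have : 0 < l ^+ b by rewrite exprn_gt0.
  lra.
pose c : R := 9 * 2 ^+ a.
have [y /andP[ly yr] /rootP] : exists2 y, l <= y <= r & root ('X^b - c%:P) y.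
  apply: poly_ivt; first exact: ltW.
  by rewrite !hornerE /c; apply/andP; split; lra.
rewrite !hornerE => /eqP; rewrite subr_eq0 => /eqP yc.
have y0 : 0 < y by lra.
have yltr : y < r.
  rewrite lt_neqAle yr andbT; apply/eqP => e.
  by move: ar; rewrite -/c -yc e ltxx.
pose V : R := k.+1%:R ^+ (2 * (a + b)).+1.
have V0 : 0 < V by rewrite exprn_gt0 // ltr0n.
(* A Lipschitz constant: x^b - y^b <= (x - y) L for y <= x <= r. *)
pose L : R := b%:R * r ^+ b.
have r1 : 1 < r by lra.
have L0 : 0 < L by rewrite mulr_gt0 ?ltr0n // exprn_gt0 //; lra.
pose et := Num.min ((r - y) / 2) (2 ^+ a / (V * L)).
have et0 : 0 < et.
  rewrite lt_min; apply/andP; split; apply: divr_gt0 => //.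
  - by rewrite subr_gt0.
  - by rewrite exprn_gt0.
  - by rewrite mulr_gt0.
have et1 : et <= (r - y) / 2 by rewrite ge_min lexx.
have et2 : et * (V * L) <= 2 ^+ a.
  have VL0 : 0 < V * L by apply: mulr_gt0.
  by rewrite -(ler_pdivlMr _ _ VL0) /et ge_min lexx orbT.
clearbody et.
exists (y + et / 2), (y + et), a, b; split=> //; try lra.
move=> x /andP[x1 x2].
have xy : y < x by lra.
have xr : x <= r by lra.
rewrite -/c -yc -/V; split.
  by rewrite subr_gt0 ltrXn2r // ltW.
rewrite subrXX; apply: le_trans et2; rewrite [V * L]mulrC mulrA.
rewrite ler_pM2r //; apply: ler_pM => //; try lra.
  by apply: sumr_ge0 => i _; rewrite mulr_ge0 // exprn_ge0 //; lra.
apply: le_trans (_ : \sum_(i < b) r ^+ b <= _); last by rewrite sumr_const card_ord /L mulr_natl.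
apply: ler_sum => i _.
apply: le_trans (_ : r ^+ (b.-1 - i) * r ^+ i <= _).
  by apply: ler_pM; rewrite ?exprn_ge0 ?lerXn2r ?nnegrE //; lra.
have hi : (i <= b.-1)%N by have := ltn_ord i; rewrite ltnS.
by rewrite -exprD subnK // ler_weXn2l ?(ltW r1) // leq_pred.
Qed.

Definition mult_indep (x : R) := forall v i j i' j' : nat, (0 < v)%N ->
  x ^+ v * (2 ^+ i * 3 ^+ j) != 2 ^+ i' * 3 ^+ j'.

(** The conditions of [mult_indep] are countable, so they are numbered by codes in order to be met
    one at a time; a number that codes nothing imposes nothing. *)
Definition avoids (n : nat) (x : R) :=
  if choice.unpickle n is Some (v, i, j, (i', j')) then
    (0 < v)%N -> x ^+ v * (2 ^+ i * 3 ^+ j) != 2 ^+ i' * 3 ^+ j'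
  else True.

Lemma interval_avoids (l r : R) n : 1 < l -> l < r ->
  exists l' r', [/\ l < l', l' < r', r' < r & forall x, l' <= x <= r' -> avoids n x].
Proof.
move=> l1 lr; rewrite /avoids; case: (choice.unpickle n) => [[[[v i] j] [i' j']]|]; last first.
  by exists ((2 * l + r) / 3), ((l + 2 * r) / 3); split=> //; lra.
case: (posnP v) => [->|v0].
  by exists ((2 * l + r) / 3), ((l + 2 * r) / 3); split=> //; lra.
have [l' [r' [h1 h2 h3 h4]]] := interval_avoid (2 ^+ i' * 3 ^+ j' / (2 ^+ i * 3 ^+ j)) l1 lr v0.
exists l', r'; split=> // x /h4 ne _; apply: contraNneq ne => <-.
by rewrite mulfK // mulf_neq0 ?expf_neq0 ?pnatr_eq0.
Qed.

(** Nested intervals: stage k escapes the relation with code k and secures the k-th approximation,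
    both on a whole subinterval. The limit is extremely well approximated and still multiplicatively
    independent of 2 and 3. *)
Lemma liouville_exists : exists (x : R) (a b : nat -> nat),
  [/\ 1 < x, mult_indep x,
     forall k, (0 < a k)%N,
     forall k, (2 * (a k + b k) < a k.+1 + b k.+1)%N &
     forall k, 0 < x ^+ b k - 9 * 2 ^+ a k /\
       (x ^+ b k - 9 * 2 ^+ a k) * k.+1%:R ^+ (2 * (a k + b k)).+1 <= 2 ^+ a k].
Proof.
pose st := (R * R * (nat * nat))%type.
pose good (s : st) := 1 < s.1.1 /\ s.1.1 < s.1.2.
pose next (ks : nat * st) (s' : st) := good ks.2 ->
  [/\ ks.2.1.1 <= s'.1.1, s'.1.2 <= ks.2.1.2, good s', (2 * (ks.2.2.1 + ks.2.2.2) < s'.2.1)%N &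
   forall x, s'.1.1 <= x <= s'.1.2 -> avoids ks.1 x /\ (0 < x ^+ s'.2.2 - 9 * 2 ^+ s'.2.1 /\
       (x ^+ s'.2.2 - 9 * 2 ^+ s'.2.1) * ks.1.+1%:R ^+ (2 * (s'.2.1 + s'.2.2)).+1 <= 2 ^+ s'.2.1)].
have /choice [f hf] : forall ks, exists s', next ks s'.
  move=> [k [[l r] [a b]]]; rewrite /next /good /=.
  case: (pselect (1 < l /\ l < r)) => [[l1 lr]|ng]; last by exists (l, r, (a, b)) => /ng.
  have [l1' [r1' [h1 h2 h3 h4]]] := interval_avoids k l1 lr.
  have [l2' [r2' [a' [b' [g1 g2 g3 g4 g5]]]]] :=
    interval_approx (2 * (a + b)) k (lt_trans l1 h1) h2.
  exists (l2', r2', (a', b')) => _ /=; split=> //; try lra.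
  move=> x hx; split; last exact: g5.
  by apply: h4; case/andP: hx => ? ?; apply/andP; split; lra.
pose s := fix s k : st := if k is k'.+1 then f (k', s k') else (2, 3, (0%N, 0%N)).
have gs k : good (s k).
  elim: k => [|k IH] /=; first by rewrite /good /=; lra.
  by have [_ _ g _ _] := hf (k, s k) IH.
have step k := hf (k, s k) (gs k).
have inc j k : (j <= k)%N -> (s j).1.1 <= (s k).1.1 /\ (s k).1.2 <= (s j).1.2.
  elim: k => [|k IH]; first by rewrite leqn0 => /eqP->.
  rewrite leq_eqVlt => /orP[/eqP-> //|/IH[h1 h2]].
  by have [g1 g2 _ _ _] := step k; split; [apply: le_trans h1 g1 | apply: le_trans g2 h2].
have cross j k : (s j).1.1 <= (s k).1.2.
  have [_ g] := gs (maxn j k).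
  have [h1 _] := inc _ _ (leq_maxl j k); have [_ h2] := inc _ _ (leq_maxr j k).
  by apply: le_trans h1 (le_trans (ltW g) h2).
pose E : set R := fun y => exists k, y = (s k).1.1.
have supE : has_sup E.
  by split; [exists (s 0%N).1.1; exists 0%N | exists (s 0%N).1.2 => y [k ->]].
pose x := sup E.
have xin k : (s k).1.1 <= x <= (s k).1.2.
  apply/andP; split; first by apply: sup_upper_bound => //; exists k.
  by apply: ge_sup; [case: supE | move=> y [j ->]].
(* The indices are shifted because stage 0 carries placeholder exponents; those of step k are stored
   in stage k + 1. *)
exists x, (fun k => (s k.+1).2.1), (fun k => (s k.+1).2.2); split.
- by have /andP[h _] := xin 0%N; apply: lt_le_trans h; rewrite /=; lra.
- move=> v i j i' j' v0.
  have [_ _ _ _ H] := step (choice.pickle (v, i, j, (i', j'))).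
  have [] := H x (xin _.+1); rewrite /avoids choice.pickleK; by move=> /(_ v0).
- by move=> k; have [_ _ _ h _] := step k; apply: leq_ltn_trans h.
- by move=> k; have [_ _ _ h _] := step k.+1; apply: leq_trans h _; apply: leq_addr.
- by move=> k; have [_ _ _ _ H] := step k; have [] := H x (xin k.+1).
Qed.

End Liouville.

(** * Deck transformations of squares *)

Section DeckGroup.
Variables (R : realType) (p : nat).
Local Notation C := R[i].
Local Notation lz j := (lshift p j).
Local Notation rw j := (rshift p j).
Variables (V : fmap C (p + p) p) (v : 'I_p -> C).
Hypothesis V0 : vanishes0 V.
Hypothesis cV : cvm V.
Hypothesis V_lin : forall j k, V j U_(rw k)%MM = v j * (j == k)%:R.
Hypothesis v0 : forall j, v j != 0.

Definition squares : fmap C (p + p) p := fun j => V j ^+ 2.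

(* The coordinates (z', V) on the complexification. *)
Variable invariants : fmap C (p + p) (p + p).
Local Notation Th := invariants.
Hypothesis invariants_l : forall j, Th (lz j) = fid C (lz j).
Hypothesis invariants_r : forall j, Th (rw j) = V j.

Lemma vanishes0_invariants : vanishes0 Th.
Proof.
by move=> i; case: (split_ordP i) => j ->; rewrite ?invariants_l ?invariants_r ?vanishes0_fid ?V0.
Qed.

Lemma cvm_invariants : cvm Th.
Proof.
apply/cvmP => i; case: (split_ordP i) => j ->; rewrite ?invariants_l ?invariants_r.
  exact: geo_fid.
by move/cvmP: cV.
Qed.

Lemma V_neq0 j : V j != 0.
Proof.
by apply/eqP => e; have := V_lin j j; rewrite e eqxx mulr1 => /esym/eqP; rewrite (negbTE (v0 j)).
Qed.

Lemma linpart_invariants : linpart Th \in unitmx.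
Proof.
have -> : linpart Th = block_mx 1%:M 0 (\matrix_(j, k) V j U_(lz k)%MM) (diag_mx (\row_j v j)).
  apply/matrixP => i k; rewrite mxE.
  case: (split_ordP i) => a ->; case: (split_ordP k) => b ->;
    rewrite ?invariants_l ?invariants_r ?block_mxEul ?block_mxEur ?block_mxEdl ?block_mxEdr !mxE.
  - by rewrite fidE coef_mon mnmU_inj eq_lshift.
  - by rewrite fidE coef_mon mnmU_inj eq_lrshift.
  - by [].
  - by rewrite V_lin; case: (a =P b) => [->|_]; rewrite ?mulr1 ?mulr0.
rewrite unitmxE det_lblock det1 mul1r det_diag unitfE.
by apply/prodf_neq0 => j _; rewrite mxE.
Qed.

Variable (Ti : fmap C (p + p) (p + p)).
Hypothesis Ti0 : vanishes0 Ti.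
Hypothesis TTi : fcomp Th Ti = @fid C (p + p).
Hypothesis TiT : fcomp Ti Th = @fid C (p + p).
Hypothesis cTi : cvm Ti.

Let Th0 := vanishes0_invariants.

Implicit Types e : {ffun 'I_p -> bool}.

Definition signs e (i : 'I_(p + p)) : C :=
  match split i with inl j => 1 | inr j => (-1) ^+ e j end.

Lemma signs_l e j : signs e (lz j) = 1.
Proof. by rewrite /signs (unsplitK (inl _ j)). Qed.

Lemma signs_r e j : signs e (rw j) = (-1) ^+ e j.
Proof. by rewrite /signs (unsplitK (inr _ j)). Qed.

Lemma invariants_inj n (F F' : fmap C n (p + p)) : vanishes0 F -> vanishes0 F' ->
  (forall i, comp1 (Th i) F = comp1 (Th i) F') -> F = F'.
Proof.
move=> F0 F'0 H.
have e : fcomp Th F = fcomp Th F' by apply: fmap_ext => i; rewrite !fcompE H.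
have h (G : fmap C n (p + p)) (G0 : vanishes0 G) : fcomp Ti (fcomp Th G) = G.
  apply: (etrans (esym (fcompA Ti Th0 G0))).
  exact: (etrans (congr1 (fun H => fcomp H G) TiT) (fcomp_idl G0)).
by have := etrans (esym (h F F0)) (etrans (congr1 (fcomp Ti) e) (h F' F'0)).
Qed.

Let d0 e := vanishes0_dmap (signs e).

Let unit_Ti : linpart Ti \in unitmx.
Proof.
have : linpart Th *m linpart Ti = 1%:M.
  by rewrite -(linpart_comp Th0 Ti0) TTi linpart_fid.
by move=> /mulmx1_unit[].
Qed.

Lemma flip_exists e : exists F : fmap C (p + p) (p + p),
  [/\ vanishes0 F, cvm F, linpart F \in unitmx &
      forall i, comp1 (Th i) F = cst _ (signs e i) * Th i].
Proof.
have dT0 : vanishes0 (fcomp (dmap (signs e)) Th) by apply: vanishes0_comp.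
exists (fcomp Ti (fcomp (dmap (signs e)) Th)); split.
- exact: vanishes0_comp.
- apply: (cvm_comp dT0 cTi).
  by apply: (cvm_comp Th0 _ cvm_invariants); rewrite dmapE; apply: cvm_linmap.
- rewrite (linpart_comp Ti0 dT0) (linpart_comp (d0 e) Th0).
  rewrite unitmx_mul unit_Ti unitmx_mul linpart_invariants andbT.
  rewrite dmapE linpart_linmap unitmxE det_diag unitfE.
  by apply/prodf_neq0 => i _; rewrite mxE /signs; case: split => j; rewrite ?oner_eq0 ?signr_eq0.
move=> i; rewrite -fcompE -(fcompA Th Ti0 dT0) TTi (fcomp_idl dT0) fcompE.
by rewrite /dmap comp1M // comp1_cst // comp1_fid.
Qed.

Variable flip : {ffun 'I_p -> bool} -> fmap C (p + p) (p + p).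
Hypothesis vanishes0_flip : forall e, vanishes0 (flip e).
Hypothesis cvm_flip : forall e, cvm (flip e).
Hypothesis unit_flip : forall e, linpart (flip e) \in unitmx.
Hypothesis invariants_flip : forall e i, comp1 (Th i) (flip e) = cst _ (signs e i) * Th i.

Lemma flip_inj : injective flip.
Proof.
move=> e e' ee; apply/ffunP => j.
have := invariants_flip e (rw j); rewrite ee invariants_flip signs_r signs_r invariants_r.
rewrite mulrC [RHS]mulrC => /(fps_mulfI (V_neq0 j)).
move=> /(congr1 (fun f : fps C (p + p) => f 0%MM)); rewrite /= !coef_cst eqxx !mulr1.
by move=> /signr_inj ->.
Qed.

Lemma pi1_l j : pi1 squares (lz j) = fid C (lz j).
Proof. by rewrite /pi1 (unsplitK (inl _ j)). Qed.

Lemma pi1_r j : pi1 squares (rw j) = V j ^+ 2.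
Proof. by rewrite /pi1 (unsplitK (inr _ j)). Qed.

Lemma signs2 e j : ((-1) ^+ e j : C) ^+ 2 = 1.
Proof. by rewrite -exprM mulnC exprM sqrrN expr1n expr1n. Qed.

Lemma flip_deck e : deck_transformation squares (flip e).
Proof.
have f0 := vanishes0_flip e.
split; first by split; [split | apply: cvm_convergent].
apply: fmap_ext => i; rewrite fcompE; case: (split_ordP i) => j ->.
  by rewrite pi1_l -invariants_l invariants_flip signs_l rmorph1 mul1r.
rewrite pi1_r comp1X // -invariants_r invariants_flip signs_r exprMn -rmorphXn signs2.
by rewrite rmorph1 mul1r.
Qed.

(** A deck transformation fixes z' and preserves each V_j^2. In an integral domain this leaves V_j
    or - V_j, and the coordinates (z', V) then determine it. *)
Lemma deckP F : deck_transformation squares F <-> exists e, F = flip e.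
Proof.
split=> [[[[F0 _] _] HF]|[e ->]]; last exact: flip_deck.
have H i : comp1 (pi1 squares i) F = pi1 squares i by rewrite -fcompE HF.
have Hr j : exists b : bool, comp1 (V j) F = cst _ ((-1) ^+ b) * V j.
  have := H (rw j); rewrite pi1_r comp1X // => /eqP; rewrite -subr_eq0 subr_sqr.
  move=> /eqP /fps_mul_eq0 [] /eqP; rewrite ?subr_eq0 ?addr_eq0 => /eqP ->.
    by exists false; rewrite expr0 rmorph1 mul1r.
  by exists true; rewrite expr1 rmorphN rmorph1 mulN1r.
have /choice [b hb] := Hr.
exists (finfun b); apply: (invariants_inj F0 (vanishes0_flip _)) => i.
rewrite invariants_flip; case: (split_ordP i) => j ->.
  by rewrite signs_l rmorph1 mul1r invariants_l; have := H (lz j); rewrite pi1_l.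
by rewrite signs_r ffunE invariants_r.
Qed.

Definition single j : {ffun 'I_p -> bool} := [ffun k => k == j].

Definition reflections j := flip (single j).

Lemma flip_comp e e' : fcomp (flip e) (flip e') = flip [ffun j => e j (+) e' j].
Proof.
have f0 := vanishes0_flip.
apply: (invariants_inj (vanishes0_comp (f0 e) (f0 e')) (f0 _)) => i.
apply: (etrans (esym (comp1A (Th i) (f0 e) (f0 e')))); rewrite invariants_flip comp1M // comp1_cst //.
rewrite !invariants_flip mulrA -rmorphM; congr (cst _ _ * _).
case: (split_ordP i) => j ->; rewrite ?signs_l ?mulr1 // !signs_r ffunE signr_addb.
by [].
Qed.

Lemma flip0 : flip [ffun=> false] = @fid C (p + p).
Proof.
have f0 := vanishes0_flip [ffun=> false].
apply: (invariants_inj f0 (@vanishes0_fid C _)) => i.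
rewrite invariants_flip comp1_id.
by case: (split_ordP i) => j ->; rewrite ?signs_l ?signs_r ?ffunE ?expr0 rmorph1 mul1r.
Qed.

Lemma flip_generated e : Defs.generated reflections (flip e).
Proof.
have [n] := ubnP #|[set j | e j]|; elim: n e => // n IH e; rewrite ltnS => hn.
case: (pickP (fun j => e j)) => [j ej|ne]; last first.
  have -> : e = [ffun=> false] by apply/ffunP => j; rewrite ffunE ne.
  by rewrite flip0; apply: Defs.generated_id.
pose e' : {ffun 'I_p -> bool} := [ffun k => e k && (k != j)].
have -> : flip e = fcomp (reflections j) (flip e').
  rewrite /reflections flip_comp; congr flip; apply/ffunP => k; rewrite !ffunE.
  by case: eqP => [->|_]; rewrite ?ej //= andbT.
apply: Defs.generated_comp; apply: IH; apply: leq_trans hn.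
apply: proper_card; apply/properP; split.
  by apply/fintype.subsetP => k; rewrite !inE ffunE => /andP[].
by exists j; rewrite !inE ?ffunE ?ej ?eqxx.
Qed.

Lemma reflections_fix j : fixes_hypersurface (reflections j).
Proof.
(* Inclusion of the hyperplane with vanishing coordinate [rw j], the index skipped by [lift].
   Through [Ti] it parametrizes V_j = 0. *)
pose A : 'M[C]_(p + p, (p + p).-1) := \matrix_(i, k) (i == lift (rw j) k)%:R.
have A0 := vanishes0_linmap A.
exists (fcomp Ti (linmap A)); split.
- exact: vanishes0_comp.
- by apply: cvm_convergent; apply: (cvm_comp A0 cTi); apply: cvm_linmap.
- rewrite (linpart_comp Ti0 A0) linpart_linmap eqmxMfull ?row_full_unit ?unit_Ti //.
  apply/eqP; rewrite eqn_leq rank_leq_col /=.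
  have e : A^T *m A = 1%:M.
    apply/matrixP => k l; rewrite !mxE (bigD1 (lift (rw j) k)) //= big1 => [|i ne].
      by rewrite !mxE eqxx mul1r addr0 (inj_eq lift_inj).
    by rewrite !mxE (negbTE ne) mul0r.
  by rewrite -[leqLHS](mxrank1 C) -e mxrankM_maxr.
have r0 := vanishes0_flip (single j).
have TA0 : vanishes0 (fcomp Ti (linmap A)) by apply: vanishes0_comp.
apply: (invariants_inj (vanishes0_comp r0 TA0) TA0) => i.
apply: (etrans (esym (comp1A (Th i) r0 TA0))); rewrite invariants_flip comp1M // comp1_cst //.
have -> : comp1 (Th i) (fcomp Ti (linmap A)) = linmap A i.
  by rewrite -(comp1A (Th i) Ti0 A0) -fcompE TTi comp1_fid.
case: (split_ordP i) => k ->; first by rewrite signs_l rmorph1 mul1r.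
rewrite signs_r ffunE; case: eqP => [->|_]; last by rewrite expr0 rmorph1 mul1r.
rewrite linmapE big1 ?mulr0 // => l _; rewrite mxE.
by rewrite (negbTE (neq_lift _ _)) rmorph0 mul0r.
Qed.

Lemma reflections_generators : deck_generators squares reflections.
Proof.
split=> [j|j|F /deckP[e ->]]; [exact: flip_deck | exact: reflections_fix | exact: flip_generated].
Qed.

Lemma invariants_tau1 i : vanishes0 (tau1 reflections) /\
  comp1 (Th i) (tau1 reflections) =
    cst _ (signs [ffun=> true] i) * Th i.
Proof.
pose d j := signs (single j).
have key (r : seq 'I_p) : vanishes0 (\big[@fcomp C _ _ _ / @fid C _]_(j <- r) reflections j) /\
   forall i, comp1 (Th i) (\big[@fcomp C _ _ _ / @fid C _]_(j <- r) reflections j) =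
     cst _ (\prod_(j <- r) d j i) * Th i.
  elim: r => [|j r [IH0 IH]].
    by rewrite big_nil; split=> [|k]; [apply: vanishes0_fid | rewrite big_nil comp1_id rmorph1 mul1r].
  rewrite big_cons; have f0 := vanishes0_flip (single j); split=> [|k]; first exact: vanishes0_comp.
  apply: (etrans (esym (comp1A (Th k) f0 IH0))); rewrite invariants_flip comp1M //.
  rewrite comp1_cst // IH mulrA -rmorphM.
  by rewrite big_cons.
rewrite /tau1; have [h1 h2] := key (index_enum 'I_p); split=> //.
rewrite h2; congr (cst _ _ * _); case: (split_ordP i) => k ->.
  by rewrite signs_l big1 // => j _; rewrite /d signs_l.
rewrite signs_r ffunE (bigD1 k) //= /d signs_r ffunE eqxx expr1 big1 ?mulr1 // => j ne.
by rewrite signs_r ffunE eq_sym (negbTE ne) expr0.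
Qed.

Lemma coef_mul_lin n (f : fps C n) a b : ordge 1 f ->
  (f * f) (U_(a) + U_(b))%MM =
    \sum_i \sum_k f U_(i)%MM * f U_(k)%MM * ((U_(i) + U_(k))%MM == (U_(a) + U_(b))%MM)%:R.
Proof.
move=> f1; pose L : fps C n := \sum_i cst n (f U_(i)%MM) * mon C U_(i)%MM.
have L1 : ordge 1 L.
  by apply: ordge_sum => i _; apply/ordgeMl/ordge_mon; rewrite mdeg1.
have fL : ordge 2 (f - L).
  apply: ordge2P => [|j]; first by rewrite fcoefB f1 ?L1 ?mdeg0 ?subrr.
  rewrite fcoefB /L fcoef_sum (bigD1 j) //= fcoefCM coef_mon eqxx mulr1 big1 ?addr0 ?subrr // => i ne.
  by rewrite fcoefCM coef_mon mnmU_inj (negbTE ne) mulr0.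
have e : (f * f - L * L) (U_(a) + U_(b))%MM = 0.
  have -> : f * f - L * L = (f - L) * (f + L) by ring.
  by apply: (ordgeM (d := 2) (e := 1)) => //; [apply: ordgeD | rewrite mdegD !mdeg1].
have -> : (f * f) (U_(a) + U_(b))%MM = (L * L) (U_(a) + U_(b))%MM.
  by apply/eqP; rewrite -subr_eq0 -fcoefB e.
rewrite /L mulr_suml fcoef_sum; apply: eq_bigr => i _; rewrite mulr_sumr fcoef_sum.
apply: eq_bigr => k _.
have -> : cst n (f U_(i)%MM) * mon C U_(i)%MM * (cst n (f U_(k)%MM) * mon C U_(k)%MM) =
   cst n (f U_(i)%MM * f U_(k)%MM) * mon C (U_(i) + U_(k))%MM.
  by rewrite rmorphM monD; ring.
by rewrite fcoefCM coef_mon.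
Qed.

Lemma mnm_pair_eq n (i k a b : 'I_n) : (U_(i) + U_(k))%MM = (U_(a) + U_(b))%MM ->
  (i = a /\ k = b) \/ (i = b /\ k = a).
Proof.
move=> e; have h x := congr1 (fun m : 'X_{1..n} => m x) e.
have {}h x : ((i == x) + (k == x) = (a == x) + (b == x))%N by have := h x; rewrite !mnmDE !mnm1E.
case: (eqVneq i a) => [ia|ne].
  left; split=> //; subst i; have := h k; rewrite eqxx => /addnI.
  by case: eqP => // ->.
have := h i; rewrite eqxx [a == i]eq_sym (negbTE ne) add0n; case: (b =P i) => // bi.
right; split=> //; subst b; have := h k; rewrite eqxx addnC => /addIn.
by case: eqP => // ->.
Qed.

Lemma qform_squares j w : qform squares j w = v j ^+ 2 * w 0 j ^+ 2.
Proof.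
have V1 : ordge 1 (V j) by apply/ordge1P; apply: V0.
have coefE (k l : 'I_p) : squares j (U_(rw k) + U_(rw l))%MM =
    v j ^+ 2 * ((k == j) && (l == j))%:R.
  rewrite /squares expr2 coef_mul_lin //.
  case: (boolP ((k == j) && (l == j))) => [/andP[/eqP-> /eqP->]|ne].
    rewrite mulr1 (bigD1 (rw j)) //= [X in _ + X]big1 => [|i ni]; last first.
      rewrite big1 // => i' _; case: eqP => [/mnm_pair_eq|]; last by rewrite mulr0.
      by case=> -[e _]; rewrite e eqxx in ni.
    rewrite (bigD1 (rw j)) //= big1 => [|i' ni]; last first.
      case: eqP => [/mnm_pair_eq|]; last by rewrite mulr0.
      by case=> -[_ e]; rewrite e eqxx in ni.
    by rewrite eqxx V_lin eqxx !mulr1 !addr0 expr2.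
  rewrite mulr0 big1 // => i _; rewrite big1 // => i' _.
  case: eqP => [/mnm_pair_eq h|]; last by rewrite mulr0.
  have kl : V j U_(rw k)%MM * V j U_(rw l)%MM = 0.
    rewrite !V_lin; move: ne; rewrite negb_and => /orP[] /negbTE h'.
      by rewrite [j == k]eq_sym h' mulr0 mul0r.
    by rewrite [j == l]eq_sym h' !mulr0.
  case: h => -[-> ->]; first by rewrite kl mul0r.
  by rewrite [V j _ * _]mulrC kl mul0r.
rewrite /qform (bigD1 j) //= [X in _ + X]big1 ?addr0 => [|k ne]; last first.
  by rewrite big1 // => l _; rewrite coefE (negbTE ne) mulr0 !mul0r.
rewrite (bigD1 j) //= [X in _ + X]big1 ?addr0 => [|l /andP[_ ne]]; last first.
  by rewrite coefE (negbTE ne) andbF mulr0 !mul0r.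
by rewrite coefE eqxx mulr1 expr2 mulrA.
Qed.

Lemma squares_max : max_deck_transformations squares.
Proof.
split=> [w H|].
  apply/rowP => j; have := H j; rewrite qform_squares => /eqP.
  rewrite mulf_eq0 !expf_eq0 /= (negbTE (v0 j)) /= => /eqP->.
  by rewrite mxE.
have cN : #|{ffun 'I_p -> bool}| = (2 ^ p)%N by rewrite card_ffun card_bool card_ord.
rewrite -cN.
pose f (k : 'I_#|{ffun 'I_p -> bool}|) := flip (enum_val k).
have finj : injective f by move=> k l /flip_inj /enum_val_inj.
have -> : [set F | deck_transformation squares F]%classic = (f @` [set: _])%classic.
  apply/seteqP; split=> [F /deckP[e ->]|_ [k _ <-]]; last exact: flip_deck.
  by exists (enum_rank e) => //; rewrite /f enum_rankK.
apply: (card_eq_trans (inj_card_eq _)); first by move=> k l _ _; apply: finj.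
by rewrite card_eq_sym; apply: card_II.
Qed.

Lemma squares_germ : exists M, real_analytic_germ M squares.
Proof.
exists (fun z => forall j : 'I_p,
  has_sum (squares j) (row_mx (lsubmx z) (map_mx Num.conj (lsubmx z))) (z 0 (rshift p j))).
split; last by exists 1.
  by apply/convergentP/cvmP => j; apply: geoX; move/cvmP: cV.
move=> j m hm; apply: (ordgeX (d := 1)); last by rewrite mul1n ltnS.
by apply/ordge1P; apply: V0.
Qed.

End DeckGroup.

(** * The model dynamics *)

Lemma fps_inverse (C : numClosedFieldType) n (f : fps C n) : f 0%MM != 0 ->
  exists h, f * h = 1 /\ h 0%MM = (f 0%MM)^-1.
Proof.
set c := f 0%MM => c0.
have f1 : ordge 1 (f - cst n c).
  by apply/ordge1P; rewrite fcoefB coef_cst eqxx mulr1 subrr.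
pose Gam (F : unit -> fps C n) (_ : unit) := cst n c^-1 * (1 - (f - cst n c) * F tt).
have [F F' d H i|F HF] := @fps_fixpoint C unit n Gam.
  have -> : Gam F' i - Gam d i = - (cst n c^-1 * ((f - cst n c) * (F' tt - d tt))).
    by rewrite /Gam; ring.
  by apply/ordgeN/ordgeMl; rewrite -add1n; apply: ordgeM.
have e : cst n c * F tt = 1 - (f - cst n c) * F tt.
  by rewrite -{1}HF /Gam mulrA -rmorphM mulfV // rmorph1 mul1r.
have fF : f * F tt = 1.
  have -> : f * F tt = cst n c * F tt + (f - cst n c) * F tt by ring.
  by rewrite e; ring.
exists (F tt); split=> //.
have := congr1 (fun g : fps C n => g 0%MM) fF.
rewrite /= coef_mul_lead ?mdeg0 // fcoef1 eqxx -/c => e0.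
by apply: (mulfI c0); rewrite e0 mulfV.
Qed.

Section BaseMap.
Variables (C : numClosedFieldType) (q : nat) (kap : 'I_q.+1 -> C).
Hypothesis kap0 : forall j, kap j != 0.
Local Notation p := q.+1.
Local Notation base := (widen_ord (leqnSn q)).
Local Notation X j := (fid C (lshift p j)).
Local Notation Y j := (fid C (rshift p j)).
Local Notation Xb j := (fid C (lshift q j)).
Local Notation Yb j := (fid C (rshift q j)).

Definition kapb (j : 'I_q) := kap (base j).

Definition kfun_base j : fps C (q + q) := cst _ (kapb j) * (1 + Xb j * Yb j).

(** Keeping the last factor constant ensures that no product X_3 Y_3 enters a multiplier, so that
    all multipliers are series in the base coordinates. *)
Definition kfun j : fps C (p + p) :=
  if j == ord_max then cst _ (kap j) else cst _ (kap j) * (1 + X j * Y j).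

Lemma K_base j : kfun (base j) = cst _ (kapb j) * (1 + X (base j) * Y (base j)).
Proof.
rewrite /kfun ifN //; apply: contraTneq (ltn_ord j) => /(congr1 val) /= ->.
by rewrite ltnn.
Qed.

Lemma K_max : kfun ord_max = cst _ (kap ord_max).
Proof. by rewrite /kfun eqxx. Qed.

Lemma ord_baseP (j : 'I_p) : j != ord_max -> exists i : 'I_q, j = base i.
Proof.
move=> ne; have h : (j < q)%N.
  rewrite ltn_neqAle -ltnS ltn_ord andbT; apply: contraNneq ne => e.
  by apply/eqP/val_inj.
by exists (Ordinal h); apply: val_inj.
Qed.

Lemma ordge_K j : ordge 2 (kfun j - cst _ (kap j)).
Proof.
rewrite /kfun; case: eqP => _; first by rewrite subrr.
have -> : cst _ (kap j) * (1 + X j * Y j) - cst _ (kap j) = cst (p + p) (kap j) * (X j * Y j).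
  by ring.
apply/ordgeMl; apply: (ordgeM (d := 1) (e := 1)); apply/ordge1P; exact: vanishes0_fid.
Qed.

Lemma Kb0 j : kfun_base j 0%MM = kapb j.
Proof.
rewrite /kfun_base fcoefCM fcoefD fcoef1 eqxx coef_mul_lead ?mdeg0 //.
by rewrite vanishes0_fid mul0r addr0 mulr1.
Qed.

Lemma base_map_exists : exists Tb : fmap C (q + q) (q + q),
  [/\ vanishes0 Tb, forall i, ordge 2 (Tb i - dmap (pairwt kapb) i),
     forall j, kfun_base j * Tb (lshift q j) = Xb j & forall j, Tb (rshift q j) = kfun_base j * Yb j].
Proof.
have kb0 j : kfun_base j 0%MM != 0 by rewrite Kb0; apply: kap0.
have /choice [iv hiv] : forall j, exists h, kfun_base j * h = 1 /\ h 0%MM = (kfun_base j 0%MM)^-1.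
  by move=> j; apply: fps_inverse.
pose Tb : fmap C (q + q) (q + q) := fun i => match split i with
  | inl j => Xb j * iv j | inr j => kfun_base j * Yb j end.
have Tl j : Tb (lshift q j) = Xb j * iv j by rewrite /Tb (unsplitK (inl _ j)).
have Tr j : Tb (rshift q j) = kfun_base j * Yb j by rewrite /Tb (unsplitK (inr _ j)).
have f1 i : ordge 1 (fid C i : fps C (q + q)) by apply/ordge1P; apply: vanishes0_fid.
exists Tb; split=> // [i|i|j].
- case: (split_ordP i) => j ->; rewrite ?Tl ?Tr; last rewrite mulrC.
    by rewrite coef_mul_lead ?vanishes0_fid ?mul0r // mdeg0.
  by rewrite coef_mul_lead ?vanishes0_fid ?mul0r // mdeg0.
- case: (split_ordP i) => j ->; rewrite ?Tl ?Tr /dmap ?pairwt_l ?pairwt_r.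
    have -> : Xb j * iv j - cst _ (kapb j)^-1 * Xb j = Xb j * (iv j - cst _ (kapb j)^-1) by ring.
    apply: (ordgeM (d := 1) (e := 1)) => //; apply/ordge1P.
    by have [_ e] := hiv j; rewrite fcoefB e Kb0 coef_cst eqxx mulr1 subrr.
  have -> : kfun_base j * Yb j - cst _ (kapb j) * Yb j = (kfun_base j - cst _ (kapb j)) * Yb j by ring.
  apply: (ordgeM (d := 1) (e := 1)) => //; apply/ordge1P.
  by rewrite fcoefB Kb0 coef_cst eqxx mulr1 subrr.
by rewrite Tl mulrCA; have [-> _] := hiv j; rewrite mulr1.
Qed.

Definition base_proj : fmap C (p + p) (q + q) := fun i => fid C (bidx i).
Local Notation pr := base_proj.

Lemma vanishes0_pr : vanishes0 pr.
Proof. by move=> i; apply: vanishes0_fid. Qed.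

Lemma pr_l j : pr (lshift q j) = X (base j). Proof. by rewrite /base_proj bidx_l. Qed.
Lemma pr_r j : pr (rshift q j) = Y (base j). Proof. by rewrite /base_proj bidx_r. Qed.

Lemma Kb_pr j : comp1 (kfun_base j) pr = kfun (base j).
Proof.
have v := vanishes0_pr.
by rewrite K_base /kfun_base comp1M // comp1_cst // comp1D // comp1_1 // comp1M // !comp1_fid // pr_l pr_r.
Qed.

End BaseMap.

Section Dynamics.
Variables (C : numClosedFieldType) (q : nat) (kap : 'I_q.+1 -> C) (g : fps C (q + q)).
Hypothesis kap0 : forall j, kap j != 0.
Local Notation p := q.+1.
Local Notation base := (widen_ord (leqnSn q)).
Local Notation X j := (fid C (lshift p j)).
Local Notation Y j := (fid C (rshift p j)).
Local Notation K := (kfun kap).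
Local Notation Kb := (kfun_base kap).
Local Notation pr := (@base_proj C q).
Local Notation sw := (swmap p).
Local Notation k3 := (kap ord_max).
Local Notation X3 := (X ord_max).
Local Notation Y3 := (Y ord_max).
Local Notation ghat := (comp1 g pr).

Definition zhat j := K j * X j + Y j.
Definition what j := X j + K j * Y j.
Definition Vhat j := K j * X j - Y j + (if j == ord_max then ghat * zhat j else 0).

Variable tau : fmap C (p + p) (p + p).
Hypothesis tau0 : vanishes0 tau.
Hypothesis tau_z : forall j, comp1 (zhat j) tau = zhat j.
Hypothesis tau_V : forall j, comp1 (Vhat j) tau = - Vhat j.
Hypothesis tauK : fcomp tau tau = @fid C (p + p).

Let sw0 := @vanishes0_swmap C p.
Let pr0 := @vanishes0_pr C q.

Let two_neq0 : cst (p + p) (2 : C) != 0.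
Proof.
apply/eqP => /(congr1 (fun f : fps C (p + p) => f 0%MM)).
by rewrite /= coef_cst eqxx mulr1 => /eqP; rewrite pnatr_eq0.
Qed.

Let K_neq0 j : K j != 0.
Proof.
apply/eqP => e; have := @ordge_K C q kap j 0%MM; rewrite mdeg0 => /(_ isT).
by rewrite e fcoefB coef_cst eqxx mulr1 sub0r => /eqP; rewrite oppr_eq0 (negbTE (kap0 j)).
Qed.

Lemma K_swap j : comp1 (K j) sw = K j.
Proof.
rewrite /kfun; case: eqP => _; first by rewrite comp1_cst.
rewrite comp1M // comp1_cst // comp1D // comp1_1 // comp1M // !comp1_fid // /swmap swap_l swap_r.
by rewrite [Y j * _]mulrC.
Qed.

Lemma X_swap j : comp1 (X j) sw = Y j.
Proof. by rewrite comp1_fid // /swmap swap_l. Qed.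

Lemma Y_swap j : comp1 (Y j) sw = X j.
Proof. by rewrite comp1_fid // /swmap swap_r. Qed.

Lemma base_tau (i : 'I_q) (j := base i) :
  [/\ comp1 (Y j) tau = K j * X j, K j * comp1 (X j) tau = Y j & comp1 (K j) tau = K j].
Proof.
have jm : (j == ord_max) = false.
  apply/eqP => e; have : (i < q)%N := ltn_ord i.
  by move/(congr1 val): e => /= ->; rewrite ltnn.
have Hz := tau_z j; have HV := tau_V j.
rewrite /zhat comp1D // comp1M // in Hz.
rewrite /Vhat jm addr0 comp1B // comp1M // in HV.
set KT := comp1 (K j) tau in Hz HV *; set XT := comp1 (X j) tau in Hz HV *.
set YT := comp1 (Y j) tau in Hz HV *.
have YE : YT = K j * X j.
  apply: (fps_mulfI two_neq0); rewrite -[2]/(1 + 1) rmorphD rmorph1.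
  have -> : (1 + 1) * YT = (KT * XT + YT) - (KT * XT - YT) by ring.
  by rewrite Hz HV; ring.
have XE : KT * XT = Y j.
  apply: (fps_mulfI two_neq0); rewrite -[2]/(1 + 1) rmorphD rmorph1.
  have -> : (1 + 1) * (KT * XT) = (KT * XT + YT) + (KT * XT - YT) by ring.
  by rewrite Hz HV; ring.
have KTE : KT = cst _ (kapb kap i) * (1 + XT * YT).
  by rewrite /KT /j K_base comp1M // comp1_cst // comp1D // comp1_1 // comp1M.
pose ze := X j * Y j; pose ze' := XT * YT.
have cz : cst (p + p) (kapb kap i) != 0.
  apply/eqP => /(congr1 (fun f : fps C (p + p) => f 0%MM)).
  by rewrite /= coef_cst eqxx mulr1 => /eqP; rewrite (negbTE (kap0 _)).
(* Multiplying the two relations gives (1 + ze') ze' = (1 + ze) ze. The difference factors as (ze' -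
   ze)(1 + ze + ze'), whose second factor has constant term 1. *)
have zz : ze' = ze.
  have e : cst (p + p) (kapb kap i) * ((ze' - ze) * (1 + ze + ze')) = 0.
    have -> : cst (p + p) (kapb kap i) * ((ze' - ze) * (1 + ze + ze')) =
       (cst _ (kapb kap i) * (1 + ze')) * ze' - (cst _ (kapb kap i) * (1 + ze)) * ze by ring.
    rewrite {1}/ze' -KTE {1}/ze -(K_base kap i) -/j /ze' mulrA XE YE /ze; ring.
  case: (fps_mul_eq0 e) => [/eqP|]; first by rewrite (negbTE cz).
  case/fps_mul_eq0 => [/eqP|/(congr1 (fun f : fps C (p + p) => f 0%MM))].
    by rewrite subr_eq0 => /eqP.
  rewrite /= !fcoefD fcoef1 eqxx /ze /ze' !coef_mul_lead ?mdeg0 // vanishes0_fid mul0r.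
  rewrite /XT comp1_0E // vanishes0_fid mul0r !addr0 => /eqP; rewrite oner_eq0 //.
have KK : KT = K j by rewrite KTE -/ze' zz /ze /j K_base.
by rewrite YE KK; split=> //; rewrite -KK.
Qed.

Definition half_sigma : fmap C (p + p) (p + p) := fcomp tau sw.
Local Notation T := half_sigma.

Lemma vanishes0_half_sigma : vanishes0 T.
Proof. exact: vanishes0_comp. Qed.

Lemma comp1_T f : comp1 f T = comp1 (comp1 f tau) sw.
Proof. by rewrite comp1A. Qed.

Lemma base_T (i : 'I_q) (j := base i) :
  [/\ comp1 (Y j) T = K j * Y j, K j * comp1 (X j) T = X j & comp1 (K j) T = K j].
Proof.
have [h1 h2 h3] := base_tau i; rewrite -/j in h1 h2 h3.
rewrite !comp1_T h1 h3 comp1M // K_swap X_swap; split=> //.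
by rewrite -{1}(K_swap j) -comp1M // h2 Y_swap.
Qed.

(** Reversibility: [tau] and the swap are involutions, so the swap conjugates T to its inverse. It
    turns an eigenfunction with multiplier mu into one with multiplier 1 / mu. *)
Lemma comp1_T_swap_T f : comp1 (comp1 (comp1 f T) sw) T = comp1 f sw.
Proof.
rewrite !comp1_T (comp1A _ sw0 sw0) swmapK comp1_id (comp1A f tau0 tau0) tauK comp1_id //.
Qed.

Variable Tb : fmap C (q + q) (q + q).
Hypothesis Tb0 : vanishes0 Tb.
Hypothesis Tb_l : forall j, Kb j * Tb (lshift q j) = fid C (lshift q j).
Hypothesis Tb_r : forall j, Tb (rshift q j) = Kb j * fid C (rshift q j).

Let T0 := vanishes0_half_sigma.

Lemma pr_T f : comp1 (comp1 f pr) T = comp1 (comp1 f Tb) pr.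
Proof.
rewrite (comp1A f pr0 T0) (comp1A f Tb0 pr0).
suff -> : fcomp pr T = fcomp Tb pr by [].
apply: fmap_ext => i; rewrite !fcompE; case: (split_ordP i) => j ->.
  have [_ h _] := base_T j.
  rewrite pr_l; apply: (fps_mulfI (K_neq0 (base j))); rewrite h.
  by rewrite -Kb_pr -comp1M // Tb_l comp1_fid // pr_l.
by have [h _ _] := base_T j; rewrite pr_r h Tb_r comp1M // Kb_pr comp1_fid // pr_r.
Qed.

Lemma pr_swap f : comp1 (comp1 f pr) sw = comp1 (comp1 f (swmap q)) pr.
Proof.
have v := @vanishes0_swmap C q.
rewrite (comp1A f pr0 sw0) (comp1A f v pr0).
suff -> : fcomp pr sw = fcomp (swmap q) pr by [].
apply: fmap_ext => i; rewrite !fcompE; case: (split_ordP i) => j ->.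
  by rewrite pr_l X_swap comp1_fid // swap_l pr_r.
by rewrite pr_r Y_swap comp1_fid // swap_r pr_l.
Qed.

Local Notation th := (comp1 (coupling Tb g) pr).

Lemma th_double : cst _ 2 * th = comp1 ghat sw + comp1 ghat T.
Proof.
have v := @vanishes0_swmap C q.
rewrite pr_T pr_swap /coupling comp1M // comp1_cst // comp1D // mulrA -rmorphM.
by rewrite mulfV ?pnatr_eq0 // rmorph1 mul1r.
Qed.

(** Invariance of z_3 and the sign change of V_3 are two linear equations for the images of X_3 and
    Y_3; their sum and difference solve them. The perturbation is the same multiple of z_3 o swap in
    both, up to sign. *)
Lemma third_T :
  cst _ k3 * comp1 X3 T = X3 - th * (X3 + cst _ k3 * Y3) /\
  comp1 Y3 T = cst _ k3 * Y3 + th * (X3 + cst _ k3 * Y3).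
Proof.
have KT f : K ord_max = cst (p + p) k3 by rewrite K_max.
have Hz : comp1 (zhat ord_max) T = cst _ k3 * Y3 + X3.
  by rewrite comp1_T tau_z /zhat K_max comp1D // comp1M // comp1_cst // X_swap Y_swap.
have Hz2 : comp1 (zhat ord_max) T = cst _ k3 * comp1 X3 T + comp1 Y3 T.
  by rewrite /zhat K_max comp1D // comp1M // comp1_cst.
have HV : comp1 (Vhat ord_max) T = - (cst _ k3 * Y3 - X3 + comp1 ghat sw * (cst _ k3 * Y3 + X3)).
  rewrite comp1_T tau_V comp1N // /Vhat eqxx K_max comp1D // comp1B // !comp1M // comp1_cst //.
  by rewrite X_swap Y_swap /zhat K_max comp1D // comp1M // comp1_cst // X_swap Y_swap.
have HV2 : comp1 (Vhat ord_max) T = cst _ k3 * comp1 X3 T - comp1 Y3 T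
    + comp1 ghat T * (cst _ k3 * Y3 + X3).
  by rewrite /Vhat eqxx K_max comp1D // comp1B // !comp1M // comp1_cst // Hz.
set XT := comp1 X3 T in Hz2 HV2 *; set YT := comp1 Y3 T in Hz2 HV2 *.
have D : cst (p + p) (2 : C) = 1 + 1 by rewrite -[2]/(1 + 1) rmorphD rmorph1.
have hth := th_double; rewrite D in hth.
have S1 : cst _ k3 * XT + YT = cst _ k3 * Y3 + X3 by rewrite -Hz2 Hz.
have S2 : cst _ k3 * XT - YT = - (cst _ k3 * Y3 - X3) - (1 + 1) * th * (cst _ k3 * Y3 + X3).
  have -> : cst _ k3 * XT - YT = comp1 (Vhat ord_max) T - comp1 ghat T * (cst _ k3 * Y3 + X3).
    by rewrite HV2; ring.
  by rewrite HV hth; ring.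
split; apply: (fps_mulfI two_neq0); rewrite D.
  have -> : (1 + 1) * (cst _ k3 * XT) = (cst _ k3 * XT + YT) + (cst _ k3 * XT - YT) by ring.
  by rewrite S1 S2; ring.
have -> : (1 + 1) * YT = (cst _ k3 * XT + YT) - (cst _ k3 * XT - YT) by ring.
by rewrite S1 S2; ring.
Qed.

Variables (a b l : fps C (q + q)).
Hypothesis flo : floquet k3 (pairwt (kapb kap)) Tb (coupling Tb g) a b l.
Hypothesis nrb : nonres (pairwt (kapb kap)).

Local Notation ah := (comp1 a pr).
Local Notation bh := (comp1 b pr).
Local Notation lh := (comp1 l pr).
Definition mult : fps C (q + q) := cst _ k3 + l.
Local Notation mh := (comp1 mult pr).

Definition eigY := ah * X3 + (1 + bh) * Y3.
Definition eigX := comp1 eigY sw.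

Lemma floquet_eqs :
  cst _ k3^-1 * comp1 a Tb - cst _ k3 * a = l * a + cst _ k3^-1 * (coupling Tb g * comp1 a Tb)
     - coupling Tb g * (1 + comp1 b Tb) /\
  cst _ k3 * comp1 b Tb - cst _ k3 * b - l = l * b + coupling Tb g * comp1 a Tb
     - cst _ k3 * (coupling Tb g * (1 + comp1 b Tb)).
Proof.
have [_ _ _ [A B _ _]] := flo.
have eA : cst _ k3^-1 * comp1 a (dmap (pairwt (kapb kap))) - cst _ k3 * a
    = resX k3 (pairwt (kapb kap)) Tb (coupling Tb g) a b l.
  by apply: fps_ext => m; rewrite -A fcoefB !fcoefCM comp1_dmap; ring.
have eB : cst _ k3 * comp1 b (dmap (pairwt (kapb kap))) - cst _ k3 * b - l
    = resY k3 (pairwt (kapb kap)) Tb (coupling Tb g) a b l.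
  by apply: fps_ext => m; rewrite -B !fcoefB !fcoefCM comp1_dmap; ring.
split.
  have -> : cst _ k3^-1 * comp1 a Tb - cst _ k3 * a =
    (cst _ k3^-1 * comp1 a (dmap (pairwt (kapb kap))) - cst _ k3 * a)
    + cst _ k3^-1 * (comp1 a Tb - comp1 a (dmap (pairwt (kapb kap)))) by ring.
  by rewrite eA /resX; ring.
have -> : cst _ k3 * comp1 b Tb - cst _ k3 * b - l =
    (cst _ k3 * comp1 b (dmap (pairwt (kapb kap))) - cst _ k3 * b - l)
    + cst _ k3 * (comp1 b Tb - comp1 b (dmap (pairwt (kapb kap)))) by ring.
by rewrite eB /resY; ring.
Qed.

Lemma eigY_T : comp1 eigY T = mh * eigY.
Proof.
have [eA eB] := floquet_eqs; have [eX eY] := third_T.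
move: (coupling Tb g) eA eB eX eY => cp eA eB eX eY.
have {}eA := congr1 (fun f => comp1 f pr) eA; have {}eB := congr1 (fun f => comp1 f pr) eB.
have Dm (f h : fps C (q + q)) : comp1 (f * h) pr = comp1 f pr * comp1 h pr by apply: comp1M.
have Db (f h : fps C (q + q)) : comp1 (f - h) pr = comp1 f pr - comp1 h pr by apply: comp1B.
have Dd (f h : fps C (q + q)) : comp1 (f + h) pr = comp1 f pr + comp1 h pr by apply: comp1D.
have Dc c : comp1 (cst (q + q) c) pr = cst _ c by apply: comp1_cst.
have D1 : comp1 (1 : fps C (q + q)) pr = 1 by apply: comp1_1.
rewrite /= ?(Dm, Db, Dd, Dc, D1) in eA eB.
have kk : cst (p + p) k3^-1 * cst _ k3 = 1 by rewrite -rmorphM mulVf // rmorph1.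
have eX' : comp1 X3 T = cst _ k3^-1 * (X3 - comp1 cp pr * (X3 + cst _ k3 * Y3)).
  by rewrite -eX mulrA kk mul1r.
rewrite /eigY /mult Dd Dc comp1D // !comp1M // comp1D // comp1_1 // eX' eY !pr_T.
set a' := comp1 (comp1 a Tb) pr in eA eB *; set b' := comp1 (comp1 b Tb) pr in eA eB *.
have ck : cst (p + p) k3^-1 * (X3 - comp1 cp pr * (X3 + cst _ k3 * Y3)) =
   cst _ k3^-1 * X3 - comp1 cp pr * (cst _ k3^-1 * X3 + (cst _ k3^-1 * cst _ k3) * Y3) by ring.
rewrite ck kk.
(* [PA] and [PB] compare the coefficients of X_3 and of Y_3 on the two sides. *)
have PA : (cst _ k3^-1 * a' - cst _ k3^-1 * (comp1 cp pr * a') + comp1 cp pr * (1 + b'))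
    = (cst _ k3 + lh) * ah.
  have -> : (cst _ k3^-1 * a' - cst _ k3^-1 * (comp1 cp pr * a') + comp1 cp pr * (1 + b')) =
     (cst _ k3^-1 * a' - cst _ k3 * ah) + cst _ k3 * ah - cst _ k3^-1 * (comp1 cp pr * a')
       + comp1 cp pr * (1 + b').
    by ring.
  by rewrite eA; ring.
have PB : cst _ k3 * (1 + b') + cst _ k3 * (comp1 cp pr * (1 + b')) - comp1 cp pr * a'
    = (cst _ k3 + lh) * (1 + bh).
  have -> : cst _ k3 * (1 + b') + cst _ k3 * (comp1 cp pr * (1 + b')) - comp1 cp pr * a' =
     (cst _ k3 * b' - cst _ k3 * bh - lh) + cst _ k3 + cst _ k3 * bh + lh
       + cst _ k3 * (comp1 cp pr * (1 + b')) - comp1 cp pr * a' by ring.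
  by rewrite eB; ring.
have -> : (cst _ k3 + lh) * (ah * X3 + (1 + bh) * Y3) =
   ((cst _ k3 + lh) * ah) * X3 + ((cst _ k3 + lh) * (1 + bh)) * Y3 by ring.
rewrite -PA -PB; ring.
Qed.

Lemma mult_resonant : resonant_series mult.
Proof.
have [_ _ _ [_ _ _ L]] := flo.
move=> m nr; rewrite /mult fcoefD coef_cst L; last first.
  by apply: contraNneq nr => e; apply: (nonres_resonant nrb).
case: eqP => [m0|_]; last by rewrite mulr0 addr0.
by case/negP: nr; rewrite m0; apply/forallP => j; rewrite !mnm0E.
Qed.

(** A resonant series only sees the products X_j Y_j, and the half map preserves them: it multiplies
    one factor by K_j and divides the other by it. *)
Lemma mult_T : comp1 mh T = mh.
Proof.
rewrite (comp1A _ pr0 T0); apply: resonant_comp1 => //; first exact: mult_resonant.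
  exact: vanishes0_comp.
move=> j; rewrite !fcompE pr_l pr_r; have [h1 h2 _] := base_T j.
by rewrite h1 -[in RHS]h2; ring.
Qed.

Lemma mult_swap : comp1 mh sw = mh.
Proof.
rewrite (comp1A _ pr0 sw0); apply: resonant_comp1 => //; first exact: mult_resonant.
  exact: vanishes0_comp.
by move=> j; rewrite !fcompE pr_l pr_r X_swap Y_swap mulrC.
Qed.

Lemma eigX_T : mh * comp1 eigX T = eigX.
Proof.
have e := comp1_T_swap_T eigY.
by rewrite eigY_T (comp1M _ _ sw0) mult_swap (comp1M _ _ T0) mult_T in e.
Qed.

Definition eigen : fmap C (p + p) (p + p) := fun i => match split i with
  | inl j => if j == ord_max then eigX else X j
  | inr j => if j == ord_max then eigY else Y j end.

Definition mults (j : 'I_p) : fps C (q + q) :=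
  if unlift ord_max j is Some i then Kb i else mult.

Lemma eigen_l j : eigen (lshift p j) = if j == ord_max then eigX else X j.
Proof. by rewrite /eigen (unsplitK (inl _ j)). Qed.

Lemma eigen_r j : eigen (rshift p j) = if j == ord_max then eigY else Y j.
Proof. by rewrite /eigen (unsplitK (inr _ j)). Qed.

Lemma lift_max (i : 'I_q) : lift ord_max i = base i.
Proof. by apply: val_inj; rewrite /= /bump leqNgt ltn_ord. Qed.

Lemma mults_base i : mults (base i) = Kb i.
Proof. by rewrite /mults -lift_max liftK. Qed.

Lemma mults_max : mults ord_max = mult.
Proof. by rewrite /mults unlift_none. Qed.

Lemma base_neq_max i : (base i == ord_max) = false.
Proof. by rewrite -lift_max eq_sym (negbTE (neq_lift _ _)). Qed.

Lemma eigen_T j : [/\ comp1 (mults j) pr * comp1 (eigen (lshift p j)) T = eigen (lshift p j),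
   comp1 (eigen (rshift p j)) T = comp1 (mults j) pr * eigen (rshift p j) &
   comp1 (comp1 (mults j) pr) T = comp1 (mults j) pr].
Proof.
rewrite eigen_l eigen_r; case: (eqVneq j ord_max) => [->|/ord_baseP[i ->]].
  by rewrite mults_max; split; [apply: eigX_T | apply: eigY_T | apply: mult_T].
by rewrite mults_base Kb_pr; have [h1 h2 h3] := base_T i.
Qed.

Definition sigma_hat : fmap C (p + p) (p + p) := fcomp T T.

Lemma eigen_sigma j :
  comp1 (mults j ^+ 2) pr * comp1 (eigen (lshift p j)) sigma_hat = eigen (lshift p j) /\
  comp1 (eigen (rshift p j)) sigma_hat = comp1 (mults j ^+ 2) pr * eigen (rshift p j).
Proof.
have [h1 h2 h3] := eigen_T j.
rewrite /sigma_hat -(comp1A (eigen (lshift p j)) T0 T0) -(comp1A (eigen (rshift p j)) T0 T0).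
rewrite (comp1X _ _ pr0) expr2; split.
  have e := congr1 (fun f => comp1 f T) h1; rewrite /= (comp1M _ _ T0) h3 in e.
  by rewrite -mulrA e h1.
by rewrite h2 (comp1M _ _ T0) h3 h2 mulrA.
Qed.

Lemma eigen_bidx i : eigen (bidx i) = pr i.
Proof.
case: (split_ordP i) => j ->.
  by rewrite bidx_l eigen_l base_neq_max pr_l.
by rewrite bidx_r eigen_r base_neq_max pr_r.
Qed.

Lemma eigen_lin i : ordge 2 (eigen i - fid C i).
Proof.
have [a1 b1 _ _] := flo.
have f1 k : ordge 1 (fid C k : fps C (p + p)) by apply/ordge1P; apply: vanishes0_fid.
have ap : ordge 1 ah by apply: ordge_comp1.
have bp : ordge 1 bh by apply: ordge_comp1.
have hY : ordge 2 (eigY - Y3).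
  have -> : eigY - Y3 = ah * X3 + bh * Y3 by rewrite /eigY; ring.
  by apply: ordgeD; apply: (ordgeM (d := 1) (e := 1)).
case: (split_ordP i) => j ->; rewrite ?eigen_l ?eigen_r; case: eqP => [->|_]; rewrite ?subrr //.
by rewrite -(Y_swap ord_max) /eigX -comp1B //; apply: ordge_comp1.
Qed.

End Dynamics.

(** * Reality *)

Section Conjugation.
Variable C : numClosedFieldType.

Definition conjf n (f : fps C n) : fps C n := fun m => (f m)^*.
Definition conjm n k (F : fmap C n k) : fmap C n k := fun i => conjf (F i).

Lemma conjfD n (f g : fps C n) : conjf (f + g) = conjf f + conjf g.
Proof. by apply: fps_ext => m; rewrite /conjf !fcoefD rmorphD. Qed.

Lemma conjfN n (f : fps C n) : conjf (- f) = - conjf f.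
Proof. by apply: fps_ext => m; rewrite /conjf !fcoefN rmorphN. Qed.

Lemma conjfM n (f g : fps C n) : conjf (f * g) = conjf f * conjf g.
Proof.
apply: fps_ext => m; rewrite /conjf !fcoefME rmorph_sum; apply: eq_bigr => k _.
by rewrite rmorphM.
Qed.

Lemma conjf_cst n c : conjf (cst n c) = cst n c^*.
Proof. by apply: fps_ext => m; rewrite /conjf !coef_cst rmorphM rmorph_nat. Qed.

Lemma conjf1 n : conjf (1 : fps C n) = 1.
Proof. by rewrite -(rmorph1 (cst n)) conjf_cst conjC1. Qed.

Lemma conjf_fid n i : conjf (@fid C n i) = fid C i.
Proof. by apply: fps_ext => m; rewrite /conjf /fid rmorph_nat. Qed.

Lemma conjfX n (f : fps C n) d : conjf (f ^+ d) = conjf f ^+ d.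
Proof. by elim: d => [|d IH]; [rewrite !expr0 conjf1 | rewrite !exprS conjfM IH]. Qed.

Lemma conjf0 n : conjf (0 : fps C n) = 0.
Proof. by rewrite -(rmorph0 (cst n)) conjf_cst conjC0. Qed.

Lemma conjf_ordge n d (f : fps C n) : ordge d f -> ordge d (conjf f).
Proof. by move=> H m hm; rewrite /conjf H ?rmorph0. Qed.

Lemma conjm0 n k (F : fmap C n k) : vanishes0 F -> vanishes0 (conjm F).
Proof. by move=> F0 i; rewrite /conjm /conjf F0 rmorph0. Qed.

Lemma conjf_comp1 n k (f : fps C k) (G : fmap C n k) : vanishes0 G ->
  conjf (comp1 f G) = comp1 (conjf f) (conjm G).
Proof.
move=> G0; apply: ordge_eq => d; apply: (ordge_le (leqnSn d)).
have h1 := conjf_ordge (comp1_eval f (d := d) G0).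
have h2 := comp1_eval (conjf f) (d := d) (conjm0 G0).
have e : conjf (evalp G (trunc d f)) = evalp (conjm G) (trunc d (conjf f)).
  rewrite !evalp_trunc (big_morph _ (@conjfD n) (@conjf0 n)); apply: eq_bigr => m _.
  rewrite conjfM conjf_cst (big_morph _ (@conjfM n) (@conjf1 n)).
  by congr (_ * _); apply: eq_bigr => i _; rewrite conjfX.
have -> : conjf (comp1 f G) - comp1 (conjf f) (conjm G) =
   conjf (comp1 f G - evalp G (trunc d f))
   - (comp1 (conjf f) (conjm G) - evalp (conjm G) (trunc d (conjf f))).
  by rewrite -e conjfD conjfN; ring.
exact: ordgeB.
Qed.

Lemma conjm_comp n k l (F : fmap C k l) (G : fmap C n k) : vanishes0 G ->
  conjm (fcomp F G) = fcomp (conjm F) (conjm G).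
Proof. by move=> G0; apply: fmap_ext => i; rewrite /conjm !fcompE conjf_comp1. Qed.

Lemma conjm_fid n : conjm (@fid C n) = @fid C n.
Proof. by apply: fmap_ext => i; rewrite /conjm conjf_fid. Qed.

Lemma conjm_inverse n (F K : fmap C n n) : vanishes0 F -> vanishes0 K ->
  conjm F = F -> fcomp F K = @fid C n -> fcomp K F = @fid C n -> conjm K = K.
Proof.
move=> F0 K0 rF FK KF; have cK0 := conjm0 K0.
have e : fcomp F (conjm K) = @fid C n.
  rewrite -[in LHS]rF; apply: (etrans (esym (conjm_comp F K0))).
  by rewrite FK conjm_fid.
have e1 := fcompA K F0 cK0.
have e2 : fcomp (fcomp K F) (conjm K) = conjm K by rewrite KF; apply: fcomp_idl.
have e3 : fcomp K (fcomp F (conjm K)) = K by rewrite e; apply: fcomp_idr.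
exact: etrans (esym e2) (etrans e1 e3).
Qed.

Lemma comp1_swap_coef p (f : fps C (p + p)) m : comp1 f (swmap p) m = f (mswap m).
Proof.
have s0 := @vanishes0_swmap C p.
have mK : involutive (@mswap p) by move=> k; apply/mnmP => i; rewrite !mnmE swap_ordK.
pose d := mdeg m; have h := comp1_eval f (d := d) s0.
have := h m (ltnSn _); rewrite fcoefB => /eqP; rewrite subr_eq0 => /eqP->.
rewrite /trunc rmorph_sum fcoef_sum.
have hm : (mdeg (mswap m) < d.+1)%N by rewrite mdeg_mswap.
rewrite (bigD1 (BMultinom hm)) //= big1 ?addr0 => [|k ne].
  rewrite -mul_mpolyC rmorphM /= evalpC evalpX -comp1_mon // comp1_mon_swap mK.
  by rewrite fcoefCM coef_mon eqxx mulr1.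
rewrite -mul_mpolyC rmorphM /= evalpC evalpX -comp1_mon // comp1_mon_swap fcoefCM coef_mon.
case: eqP => [e|]; last by rewrite mulr0.
by case/eqP: ne; apply: val_inj; rewrite /= -e mK.
Qed.

(** With real coefficients the two conjugations cancel and only the exchange of the blocks remains.
    This is why kap and g are kept real. *)
Lemma rho0_conjE p (F : fmap C (p + p) (p + p)) : vanishes0 F -> conjm F = F ->
  rho0_conj F = fcomp (swmap p) (fcomp F (swmap p)).
Proof.
move=> F0 rF; have s0 := @vanishes0_swmap C p.
apply: fmap_ext => i; rewrite fcompE /swmap comp1_fid; last exact: vanishes0_comp.
rewrite fcompE; apply: fps_ext => m; rewrite comp1_swap_coef /rho0_conj.
by rewrite -[in RHS]rF.
Qed.

End Conjugation.

(** * From the model to the submanifold *)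

Section Chart.
Variables (C : numClosedFieldType) (q : nat) (kap : 'I_q.+1 -> C) (g : fps C (q + q)).
Hypothesis kap0 : forall j, kap j != 0.
Hypothesis kap2 : forall j, kap j ^+ 2 != 1.
Hypothesis g1 : ordge 1 g.
Local Notation p := q.+1.
Local Notation X j := (fid C (lshift p j)).
Local Notation Y j := (fid C (rshift p j)).
Local Notation K := (kfun kap).
Local Notation cst := (cst (p + p)).
Local Notation pr := (@base_proj C q).

Definition chart : fmap C (p + p) (p + p) := fun i => match split i with
  | inl j => zhat kap j | inr j => what kap j end.

Lemma chart_l j : chart (lshift p j) = zhat kap j.
Proof. by rewrite /chart (unsplitK (inl _ j)). Qed.

Lemma chart_r j : chart (rshift p j) = what kap j.
Proof. by rewrite /chart (unsplitK (inr _ j)). Qed.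

Let pr0 := @vanishes0_pr C q.

Let f1 k : ordge 1 (fid C k : fps C (p + p)).
Proof. by apply/ordge1P; apply: vanishes0_fid. Qed.

Lemma zhat_lin j : ordge 2 (zhat kap j - (cst (kap j) * X j + Y j)).
Proof.
have -> : zhat kap j - (cst (kap j) * X j + Y j) = (K j - cst (kap j)) * X j by rewrite /zhat; ring.
by apply/ordgeMr/ordge_K.
Qed.

Lemma what_lin j : ordge 2 (what kap j - (X j + cst (kap j) * Y j)).
Proof.
have -> : what kap j - (X j + cst (kap j) * Y j) = (K j - cst (kap j)) * Y j by rewrite /what; ring.
by apply/ordgeMr/ordge_K.
Qed.

Lemma Vhat_lin j : ordge 2 (Vhat kap g j - (cst (kap j) * X j - Y j)).
Proof.
have -> : Vhat kap g j - (cst (kap j) * X j - Y j) =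
   (K j - cst (kap j)) * X j + (if j == ord_max then comp1 g pr * zhat kap j else 0).
  by rewrite /Vhat; ring.
apply: ordgeD; first by apply/ordgeMr/ordge_K.
case: eqP => _ //; apply: (ordgeM (d := 1) (e := 1)); first exact: ordge_comp1.
have -> : zhat kap j = (zhat kap j - (cst (kap j) * X j + Y j)) + (cst (kap j) * X j + Y j) by ring.
apply: ordgeD; first exact: ordge_le (zhat_lin j).
by apply: ordgeD => //; apply: ordgeMl.
Qed.

Lemma vanishes0_chart : vanishes0 chart.
Proof.
move=> i; apply/ordge1P; case: (split_ordP i) => j ->; rewrite ?chart_l ?chart_r.
  by apply: ordgeD => //; apply: ordgeMl.
by apply: ordgeD => //; apply: ordgeMl.
Qed.

Lemma linpart_chart : linpart chart = block_mx (diag_mx (\row_j kap j)) 1%:M 1%:M (diag_mx (\row_j kap j)).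
Proof.
apply/matrixP => i k; rewrite mxE.
have L f h : ordge 2 (f - h) -> f U_(k)%MM = h U_(k)%MM :> C.
  by move=> H; apply/eqP; rewrite -subr_eq0 -fcoefB H // mdeg1.
have lr j j' : (U_(lshift p j) == U_(rshift p j') :> 'X_{1..p + p})%MM = false.
  by rewrite mnmU_inj eq_lrshift.
have rl j j' : (U_(rshift p j) == U_(lshift p j') :> 'X_{1..p + p})%MM = false.
  by rewrite mnmU_inj eq_rlshift.
have ll j j' : (U_(lshift p j) == U_(lshift p j') :> 'X_{1..p + p})%MM = (j == j').
  by rewrite mnmU_inj eq_lshift.
have rr j j' : (U_(rshift p j) == U_(rshift p j') :> 'X_{1..p + p})%MM = (j == j').
  by rewrite mnmU_inj eq_rshift.
case: (split_ordP i) => a ->; rewrite ?chart_l ?chart_r ?(L _ _ (zhat_lin a)) ?(L _ _ (what_lin a));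
  rewrite fcoefD fcoefCM /fid; case: (split_ordP k) => b ->;
  rewrite ?block_mxEul ?block_mxEur ?block_mxEdl ?block_mxEdr !mxE ?lr ?rl ?ll ?rr ?mulr0 ?addr0 ?add0r;
  rewrite ?[b == a]eq_sym //; by case: eqP => [->|]; rewrite ?mulr1 ?mulr0.
Qed.

(** The product with the companion block matrix, with -1 in place of 1, is diagonal with entries
    kap_j^2 - 1. *)
Lemma unit_chart : linpart chart \in unitmx.
Proof.
set d := diag_mx (\row_j kap j).
have e : block_mx d 1%:M 1%:M d *m block_mx d (- 1%:M) (- 1%:M) d
    = block_mx (d *m d - 1%:M) 0 0 (d *m d - 1%:M).
  rewrite mulmx_block !mulmxN !mulmx1 !mul1mx addNr subrr; congr block_mx.
  by rewrite addrC.
have u : d *m d - 1%:M = diag_mx (\row_j (kap j ^+ 2 - 1)).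
  apply/matrixP => i j; rewrite mul_diag_mx !mxE; case: eqP => [->|_].
    by rewrite !mulr1n expr2.
  by rewrite !mulr0n mulr0 subrr.
have : block_mx (d *m d - 1%:M) 0 0 (d *m d - 1%:M) \in unitmx.
  rewrite u unitmxE det_lblock unitrM -!unitmxE unitmxE det_diag unitfE andbb.
  by apply/prodf_neq0 => j _; rewrite mxE subr_eq0.
by rewrite -e unitmx_mul linpart_chart => /andP[].
Qed.

Lemma geo_chart : cvm chart.
Proof.
have gK j : geo (K j).
  rewrite /kfun; case: eqP => _; first exact: geo_cst.
  apply: geoM; first exact: geo_cst.
  apply: geoD; last by apply: geoM; apply: geo_fid.
  by rewrite -(rmorph1 cst); apply: geo_cst.
apply/cvmP => i; case: (split_ordP i) => j ->; rewrite ?chart_l ?chart_r.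
  by apply: geoD; [apply: geoM; [apply: gK|]|]; apply: geo_fid.
by apply: geoD; [|apply: geoM; [apply: gK|]]; apply: geo_fid.
Qed.

Lemma geo_Vhat j : geo g -> geo (Vhat kap g j).
Proof.
move=> hg; have /cvmP gc := geo_chart; have gz j' := gc (lshift p j').
have -> : Vhat kap g j = chart (lshift p j) - Y j - Y j
    + (if j == ord_max then comp1 g pr * chart (lshift p j) else 0).
  by rewrite chart_l /Vhat /zhat; ring.
apply: geoD; first by apply: geoB; [apply: geoB => //|]; apply: geo_fid.
case: eqP => _; last by rewrite -(rmorph0 cst); apply: geo_cst.
apply: geoM => //; apply: cvm_comp1 => //; apply/cvmP => i.
by case: (split_ordP i) => l ->; rewrite ?pr_l ?pr_r; apply: geo_fid.
Qed.

Lemma chart_swap : fcomp chart (swmap p) = fcomp (swmap p) chart.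
Proof.
have s0 := @vanishes0_swmap C p; apply: fmap_ext => i; rewrite !fcompE.
rewrite [RHS]comp1_fid; last exact: vanishes0_chart.
case: (split_ordP i) => j ->; rewrite ?swap_l ?swap_r ?chart_l ?chart_r.
  by rewrite /zhat /what comp1D // comp1M // K_swap X_swap Y_swap addrC.
by rewrite /zhat /what comp1D // comp1M // K_swap X_swap Y_swap addrC.
Qed.

Hypothesis kap_real : forall j, (kap j)^* = kap j.
Hypothesis g_real : conjf g = g.

Let K_real j : conjf (K j) = K j.
Proof.
rewrite /kfun; case: eqP => _; first by rewrite conjf_cst kap_real.
by rewrite conjfM conjf_cst conjfD conjf1 conjfM !conjf_fid kap_real.
Qed.

Lemma chart_real : conjm chart = chart.
Proof.
apply: fmap_ext => i; rewrite /conjm; case: (split_ordP i) => j ->; rewrite ?chart_l ?chart_r.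
  by rewrite /zhat conjfD conjfM K_real !conjf_fid.
by rewrite /what conjfD conjfM K_real !conjf_fid.
Qed.

Lemma Vhat_real j : conjf (Vhat kap g j) = Vhat kap g j.
Proof.
have zr : conjf (zhat kap j) = zhat kap j by rewrite -chart_l -[in RHS]chart_real.
have gr : conjf (comp1 g pr) = comp1 g pr.
  rewrite conjf_comp1 // g_real; congr comp1; apply: fmap_ext => i; rewrite /conjm.
  by case: (split_ordP i) => l ->; rewrite ?pr_l ?pr_r conjf_fid.
rewrite /Vhat conjfD conjfD conjfN conjfM K_real !conjf_fid; congr (_ + _).
by case: eqP => _; rewrite ?conjf0 // conjfM zr gr.
Qed.

Variable P : fmap C (p + p) (p + p).
Hypothesis P0 : vanishes0 P.
Hypothesis chartP : fcomp chart P = @fid C (p + p).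

Definition skew : fmap C (p + p) p := fun j => comp1 (Vhat kap g j) P.
Definition skew_coef j : C := - (2 * kap j) / (kap j ^+ 2 - 1).

Lemma skew_lin j k : skew j U_(rshift p k)%MM = skew_coef j * (j == k)%:R.
Proof.
have k1 : kap j ^+ 2 - 1 != 0 by rewrite subr_eq0.
(* The solution of kap X - Y = al (kap X + Y) + be (X + kap Y), which expresses the linear part of
   V_j through z_j and w_j. *)
pose al := (kap j ^+ 2 + 1) / (kap j ^+ 2 - 1); pose be := skew_coef j.
have e1 : al * kap j + be = kap j by rewrite /al /be /skew_coef; field.
have e2 : al + be * kap j = -1 by rewrite /al /be /skew_coef; field.
have h : ordge 2 (Vhat kap g j - (cst al * chart (lshift p j) + cst be * chart (rshift p j))).
  have c1 : cst (kap j) = cst al * cst (kap j) + cst be by rewrite -rmorphM -rmorphD e1.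
  have c2 : -1 = cst al + cst be * cst (kap j) by rewrite -rmorphM -rmorphD e2 rmorphN rmorph1.
  have -> : Vhat kap g j - (cst al * chart (lshift p j) + cst be * chart (rshift p j)) =
     (Vhat kap g j - (cst (kap j) * X j - Y j)) - cst al * (zhat kap j - (cst (kap j) * X j + Y j))
       - cst be * (what kap j - (X j + cst (kap j) * Y j)).
    transitivity (Vhat kap g j - ((cst al * cst (kap j) + cst be) * X j
         + (cst al + cst be * cst (kap j)) * Y j)
       - cst al * (zhat kap j - (cst (kap j) * X j + Y j))
       - cst be * (what kap j - (X j + cst (kap j) * Y j))).
      by rewrite chart_l chart_r; ring.
    by rewrite -c1 -c2 mulN1r.
  apply: ordgeB; [apply: ordgeB|]; first exact: Vhat_lin.
    by apply: ordgeMl; apply: zhat_lin.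
  by apply: ordgeMl; apply: what_lin.
have := ordge_comp1 P0 h; rewrite (comp1B _ _ P0) (comp1D (cst al * _) _ P0).
rewrite !(comp1M (cst _) _ P0) !(comp1_cst _ P0).
rewrite -!(fcompE chart) chartP => /(_ U_(rshift p k)%MM); rewrite mdeg1 => /(_ isT).
rewrite fcoefB fcoefD !fcoefCM /fid !mnmU_inj eq_rlshift eq_rshift mulr0 add0r => /eqP.
by rewrite subr_eq0 => /eqP; rewrite eq_sym.
Qed.

Lemma vanishes0_skew : vanishes0 skew.
Proof.
move=> j; apply/ordge1P/ordge_comp1 => //.
have -> : Vhat kap g j = (Vhat kap g j - (cst (kap j) * X j - Y j)) + (cst (kap j) * X j - Y j) by ring.
apply: ordgeD; first exact: ordge_le (Vhat_lin j).
by apply: ordgeB => //; apply: ordgeMl.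
Qed.

End Chart.

Lemma fcompKl (C : numClosedFieldType) n k l (F : fmap C k n) (K : fmap C n k) (G : fmap C l n) :
  vanishes0 K -> vanishes0 G -> fcomp F K = @fid C n -> fcomp F (fcomp K G) = G.
Proof.
move=> K0 G0 e; have h := fcompA F K0 G0.
exact: etrans (esym h) (etrans (congr1 (fun H => fcomp H G) e) (fcomp_idl G0)).
Qed.

Lemma fcompKr (C : numClosedFieldType) n k l (F : fmap C k n) (K : fmap C n k) (H : fmap C n l) :
  vanishes0 F -> vanishes0 K -> fcomp F K = @fid C n -> fcomp (fcomp H F) K = H.
Proof.
move=> F0 K0 e; have h := fcompA H F0 K0.
exact: etrans h (etrans (congr1 (fcomp H) e) (fcomp_idr H)).
Qed.

(** The involution is moved to the model coordinates, where the swap [s] keeps its form because it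
    commutes with the chart. There t s t s becomes the square of tau s. *)
Lemma conjugate_involution (C : numClosedFieldType) n (F P t s : fmap C n n) :
  vanishes0 F -> vanishes0 P -> vanishes0 t -> vanishes0 s ->
  fcomp F P = @fid C n -> fcomp P F = @fid C n -> fcomp t t = @fid C n ->
  fcomp F s = fcomp s F -> exists tau : fmap C n n,
  [/\ tau = fcomp P (fcomp t F), fcomp F tau = fcomp t F, fcomp tau tau = @fid C n &
      fcomp P (fcomp t (fcomp s (fcomp t s))) = fcomp (fcomp (fcomp tau s) (fcomp tau s)) P].
Proof.
move=> F0 P0 t0 s0 FP PF tK Fs.
have tF0 := vanishes0_comp t0 F0; have ts0 := vanishes0_comp t0 s0.
have sP0 := vanishes0_comp s0 P0.
have tau0 := vanishes0_comp P0 tF0.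
have Ftau := fcompKl P0 tF0 FP.
have tauP : fcomp (fcomp P (fcomp t F)) P = fcomp P t.
  exact: etrans (fcompA P tF0 P0) (congr1 (fcomp P) (fcompKr t F0 P0 FP)).
have [tau tauE] : exists tau, tau = fcomp P (fcomp t F) by eexists.
rewrite -tauE in tau0 Ftau tauP.
have tau_s0 := vanishes0_comp tau0 s0.
have sP : fcomp P s = fcomp s P.
  have e : fcomp F (fcomp s P) = s.
    apply: etrans (esym (fcompA F s0 P0)) _.
    exact: etrans (congr1 (fun G => fcomp G P) Fs) (fcompKr s F0 P0 FP).
  exact: etrans (congr1 (fcomp P) (esym e)) (fcompKl F0 sP0 PF).
have key : fcomp (fcomp tau s) P = fcomp P (fcomp t s).
  apply: etrans (fcompA tau s0 P0) _; apply: etrans (congr1 (fcomp tau) (esym sP)) _.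
  apply: etrans (esym (fcompA tau P0 s0)) _.
  exact: etrans (congr1 (fun G => fcomp G s) tauP) (fcompA P t0 s0).
exists tau; split=> [//|//||].
  apply: etrans (congr1 (fun G => fcomp G tau) tauE) _.
  apply: etrans (fcompA P tF0 tau0) _; apply: etrans (congr1 (fcomp P) _) PF.
  apply: etrans (fcompA t F0 tau0) _; apply: etrans (congr1 (fcomp t) Ftau) _.
  exact: fcompKl t0 F0 tK.
apply: esym; apply: etrans (fcompA (fcomp tau s) tau_s0 P0) _.
apply: etrans (congr1 (fcomp (fcomp tau s)) key) _.
apply: etrans (esym (fcompA (fcomp tau s) P0 ts0)) _.
apply: etrans (congr1 (fun G => fcomp G (fcomp t s)) key) _.
apply: etrans (fcompA P ts0 ts0) _.
exact (congr1 (fcomp P) (fcompA t s0 ts0)).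
Qed.

Section DeckModel.
Variables (R : realType) (q : nat).
Local Notation C := R[i].
Variables (kap : 'I_q.+1 -> C) (g : fps C (q + q)).
Hypothesis kap0 : forall j, kap j != 0.
Hypothesis kap2 : forall j, kap j ^+ 2 != 1.
Hypothesis g1 : ordge 1 g.
Hypothesis kap_real : forall j, (kap j)^* = kap j.
Hypothesis g_real : conjf g = g.
Hypothesis geo_g : geo g.
Local Notation p := q.+1.
Local Notation Phi := (chart kap).
Local Notation sw := (swmap p).

Lemma deck_model_exists : exists (M : set 'rV[C]_(p + p)) (E : fmap C (p + p) p)
    (t : 'I_p -> fmap C (p + p) (p + p)) (P tau : fmap C (p + p) (p + p)),
  [/\ real_analytic_germ M E, max_deck_transformations E & deck_generators E t] /\
  [/\ vanishes0 P, fcomp Phi P = @fid C (p + p), fcomp P Phi = @fid C (p + p),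
      vanishes0 (sigma t) & fcomp P (sigma t) = fcomp (sigma_hat tau) P] /\
  [/\ vanishes0 tau, forall j, comp1 (zhat kap j) tau = zhat kap j,
      forall j, comp1 (Vhat kap g j) tau = - Vhat kap g j & fcomp tau tau = @fid C (p + p)].
Proof.
have Phi0 := vanishes0_chart kap; have s0 := @vanishes0_swmap C p.
have [P [P0 PhiP PPhi cP]] := inverse_exists Phi0 (unit_chart kap2).
have {}cP := cP (geo_chart kap).
pose V := skew kap g P; have V0 : vanishes0 V := vanishes0_skew kap g1 P0.
have V_lin := skew_lin kap2 g1 P0 PhiP.
have v0 j : skew_coef kap j != 0.
  by rewrite mulf_neq0 ?oppr_eq0 ?mulf_neq0 ?pnatr_eq0 ?invr_eq0 ?subr_eq0.
have cV : cvm V by apply/cvmP => j; apply: cvm_comp1 => //; apply: geo_Vhat.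
pose Th : fmap C (p + p) (p + p) := fun i => match split i with
  | inl j => fid C (lshift p j) | inr j => V j end.
have Th_l j : Th (lshift p j) = fid C (lshift p j) by rewrite /Th (unsplitK (inl _ j)).
have Th_r j : Th (rshift p j) = V j by rewrite /Th (unsplitK (inr _ j)).
have Th0 := vanishes0_invariants V0 Th_l Th_r.
have [Ti [Ti0 TTi TiT cTi]] := inverse_exists Th0 (linpart_invariants V_lin v0 Th_l Th_r).
have {}cTi := cTi (cvm_invariants cV Th_l Th_r).
have /choice [flip hflip] := flip_exists V0 cV V_lin v0 Th_l Th_r Ti0 TTi cTi.
have fl0 e : vanishes0 (flip e) by have [] := hflip e.
have flc e : cvm (flip e) by have [] := hflip e.
have flu e : linpart (flip e) \in unitmx by have [] := hflip e.
have flT e : forall i, comp1 (Th i) (flip e) = cst (p + p) (signs R e i) * Th i by have [] := hflip e.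
have [M HM] := squares_germ V0 cV.
pose t := reflections flip; pose t1 := tau1 t.
have t10 : vanishes0 t1 by have [] := invariants_tau1 fl0 flT (lshift p ord0).
have t1T i : comp1 (Th i) t1 = cst (p + p) (signs R [ffun=> true] i) * Th i.
  by have [] := invariants_tau1 fl0 flT i.
have inj := invariants_inj V0 Th_l Th_r TiT.
have t1l j : comp1 (fid C (lshift p j)) t1 = fid C (lshift p j).
  by have := t1T (lshift p j); rewrite signs_l rmorph1 mul1r Th_l.
have t1r j : comp1 (V j) t1 = - V j.
  by have := t1T (rshift p j); rewrite signs_r ffunE expr1 rmorphN rmorph1 mulN1r Th_r.
have t1K : fcomp t1 t1 = @fid C (p + p).
  apply: (inj _ _ _ (vanishes0_comp t10 t10) (@vanishes0_fid C _)) => i.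
  apply: (etrans (esym (comp1A (Th i) t10 t10))); rewrite comp1_id.
  case: (split_ordP i) => j ->; rewrite ?Th_l ?Th_r; first by rewrite !t1l.
  by rewrite t1r comp1N // t1r opprK.
have rP : conjm P = P.
  by apply: (conjm_inverse Phi0 P0 _ PhiP PPhi); apply: chart_real.
have rV j : conjf (V j) = V j.
  by rewrite /V /skew (conjf_comp1 _ P0) Vhat_real // rP.
have rTh i : conjf (Th i) = Th i.
  by case: (split_ordP i) => j ->; rewrite ?Th_l ?Th_r ?conjf_fid ?rV.
have rt1 : conjm t1 = t1.
  apply: (inj _ _ _ (conjm0 t10) t10) => i.
  rewrite -[in LHS]rTh -(conjf_comp1 _ t10) t1T conjfM conjf_cst rTh.
  by congr (cst _ _ * _); rewrite /signs; case: split => j; rewrite ?conjC1 // rmorphXn rmorphN1.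
have sE : sigma t = fcomp t1 (fcomp sw (fcomp t1 sw)).
  by rewrite /sigma -/t1 (rho0_conjE t10 rt1).
have ts0 : vanishes0 (fcomp t1 sw) by apply: vanishes0_comp.
have sts0 : vanishes0 (fcomp sw (fcomp t1 sw)) by apply: vanishes0_comp.
have sig0 : vanishes0 (sigma t) by rewrite sE; apply: vanishes0_comp.
have tP0 : vanishes0 (fcomp t1 Phi) by apply: vanishes0_comp.
have [tau [tauE PhiT tauK sP]] := conjugate_involution Phi0 P0 t10 s0 PhiP PPhi t1K (chart_swap kap).
have tau0 : vanishes0 tau by rewrite tauE; apply: vanishes0_comp.
exists M, (squares V), t, P, tau; split; [|split]; split.
- exact HM.
- exact: (squares_max V0 V_lin v0 Th_l Th_r TiT fl0 flc flu flT).
- exact: (reflections_generators V0 Th_l Th_r Ti0 TTi TiT cTi fl0 flc flu flT).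
- exact P0.
- exact PhiP.
- exact PPhi.
- exact sig0.
- exact (etrans (congr1 (fcomp P) sE) sP).
- exact tau0.
- move=> j; have := congr1 (fun F : fmap C (p + p) (p + p) => F (lshift p j)) PhiT.
  rewrite /= !fcompE chart_l => ->.
  have -> : t1 (lshift p j) = fid C (lshift p j) by rewrite -[RHS](t1l j) (comp1_fid _ t10).
  by rewrite (comp1_fid _ Phi0) chart_l.
- move=> j; rewrite tauE; apply: etrans (esym (comp1A (Vhat kap g j) P0 tP0)) _.
  apply: etrans (esym (comp1A (V j) t10 Phi0)) _; rewrite t1r (comp1N _ Phi0); congr (- _).
  by apply: etrans (comp1A (Vhat kap g j) P0 Phi0) _; rewrite PPhi comp1_id.
- exact tauK.
Qed.

End DeckModel.

(** * Divergence of every normal form *)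

Section ResonantAlgebra.
Variables (C : numClosedFieldType) (p : nat).
Implicit Types f h : fps C (p + p).

Lemma resonantD (m m' : 'X_{1..p + p}) : resonant m -> resonant m' -> resonant (m + m')%MM.
Proof.
move=> /forallP H /forallP H'; apply/forallP => j.
by rewrite !mnmDE (eqP (H j)) (eqP (H' j)).
Qed.

Lemma resonant_seriesM f h :
  resonant_series f -> resonant_series h -> resonant_series (f * h).
Proof.
move=> Hf Hh m nm; rewrite fcoefME big1 // => k /eqP e.
case: (boolP (resonant k.1)) => [r1|/Hf->]; last by rewrite mul0r.
case: (boolP (resonant k.2)) => [r2|/Hh->]; last by rewrite mulr0.
by rewrite e resonantD in nm.
Qed.

Lemma resonant_series_cst c : resonant_series (cst (p + p) c : fps C (p + p)).
Proof.
move=> m nm; rewrite coef_cst; case: eqP => [e|]; last by rewrite mulr0.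
by case/negP: nm; rewrite e; apply/forallP => j; rewrite !mnm0E.
Qed.

Lemma resonant_seriesX f d : resonant_series f -> resonant_series (f ^+ d).
Proof.
move=> Hf; elim: d => [|d IH]; last by rewrite exprS; apply: resonant_seriesM.
by rewrite expr0 -(rmorph1 (cst (p + p))); apply: resonant_series_cst.
Qed.

End ResonantAlgebra.

Lemma kfun_base_resonant (C : numClosedFieldType) q (kap : 'I_q.+1 -> C) j :
  resonant_series (kfun_base kap j).
Proof.
apply: resonant_seriesM; first exact: resonant_series_cst.
have h1 := @resonant_series_cst C q 1; rewrite rmorph1 in h1.
move=> m nm; rewrite fcoefD h1 // add0r.
rewrite !fidE -monD coef_mon; case: eqP => // e; case/negP: nm; rewrite -e.
apply/forallP => k; rewrite !mnmDE !mnm1E.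
by rewrite eq_lshift eq_rshift eq_lrshift eq_rlshift addn0.
Qed.

Section ConjugatedForm.
Variables (C : numClosedFieldType) (n : nat).

(** In the application [a] is the linear part of the chart, [b] its inverse, and [shat] the model
    map. The lemma conjugates a normal form with diagonalized linear part directly to the model. *)
Lemma fcomp_transport (a b star Psi P S shat : fmap C n n) : vanishes0 a -> vanishes0 b -> vanishes0 star ->
  vanishes0 Psi -> vanishes0 P -> vanishes0 S -> vanishes0 shat -> fcomp a b = @fid C n ->
  fcomp Psi star = fcomp S Psi -> fcomp P S = fcomp shat P ->
  fcomp (fcomp P (fcomp Psi a)) (fcomp b (fcomp star a))
    = fcomp shat (fcomp P (fcomp Psi a)).
Proof.
move=> a0 b0 r0 Q0 P0 S0 h0 ab e1 e2.
have ra := vanishes0_comp r0 a0; have Qa := vanishes0_comp Q0 a0.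
have bra := vanishes0_comp b0 ra.
apply: etrans (fcompA P Qa bra) _.
have e3 : fcomp (fcomp Psi a) (fcomp b (fcomp star a)) = fcomp S (fcomp Psi a).
  apply: etrans (fcompA Psi a0 bra) _; apply: etrans (congr1 (fcomp Psi) (fcompKl b0 ra ab)) _.
  apply: etrans (esym (fcompA Psi r0 a0)) _.
  apply: etrans (congr1 (fun G => fcomp G a) e1) _; exact (fcompA S Q0 a0).
apply: etrans (congr1 (fcomp P) e3) _; apply: etrans (esym (fcompA P S0 Qa)) _.
apply: etrans (congr1 (fun G => fcomp G (fcomp Psi a)) e2) _; exact (fcompA shat P0 Qa).
Qed.

Lemma fcomp_conj_commute (a b star l d : fmap C n n) : vanishes0 a -> vanishes0 b -> vanishes0 star ->
  vanishes0 l -> vanishes0 d -> fcomp a b = @fid C n -> fcomp b a = @fid C n ->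
  fcomp star l = fcomp l star -> fcomp a d = fcomp l a ->
  fcomp (fcomp b (fcomp star a)) d = fcomp d (fcomp b (fcomp star a)).
Proof.
move=> a0 b0 r0 l0 d0 ab ba e1 e2.
have ra := vanishes0_comp r0 a0; have la := vanishes0_comp l0 a0; have db := vanishes0_comp d0 b0.
have e3 : fcomp b l = fcomp d b.
  have h1 : fcomp a (fcomp d b) = l.
    apply: etrans (esym (fcompA a d0 b0)) _; apply: etrans (congr1 (fun G => fcomp G b) e2) _.
    exact (fcompKr l a0 b0 ab).
  apply: etrans (congr1 (fcomp b) (esym h1)) _; exact (fcompKl a0 db ba).
apply: etrans (fcompA b ra d0) _.
have e4 : fcomp (fcomp star a) d = fcomp l (fcomp star a).
  apply: etrans (fcompA star a0 d0) _; apply: etrans (congr1 (fcomp star) e2) _.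
  apply: etrans (esym (fcompA star l0 a0)) _.
  apply: etrans (congr1 (fun G => fcomp G a) e1) _; exact (fcompA l r0 a0).
apply: etrans (congr1 (fcomp b) e4) _; apply: etrans (esym (fcompA b l0 ra)) _.
apply: etrans (congr1 (fun G => fcomp G (fcomp star a)) e3) _; exact (fcompA d b0 ra).
Qed.

End ConjugatedForm.

Section Divergence.
Variables (C : numClosedFieldType) (q : nat) (kap : 'I_q.+1 -> C) (g : fps C (q + q)).
Local Notation p := q.+1.
Local Notation lam := (fun j => kap j ^+ 2).
Hypothesis kap0 : forall j, kap j != 0.
Hypothesis nrb : nonres (pairwt (kapb kap)).
Hypothesis nrl : nonres (pairwt lam).
Variable Tb : fmap C (q + q) (q + q).
Hypothesis Tb0 : vanishes0 Tb.
Hypothesis Tb_l : forall j, kfun_base kap j * Tb (lshift q j) = fid C (lshift q j).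
Hypothesis Tb_r : forall j, Tb (rshift q j) = kfun_base kap j * fid C (rshift q j).
Variables a b l : fps C (q + q).
Hypothesis flo : floquet (kap ord_max) (pairwt (kapb kap)) Tb (coupling Tb g) a b l.
Variable tau : fmap C (p + p) (p + p).
Hypothesis tau0 : vanishes0 tau.
Hypothesis tau_z : forall j, comp1 (zhat kap j) tau = zhat kap j.
Hypothesis tau_V : forall j, comp1 (Vhat kap g j) tau = - Vhat kap g j.
Hypothesis tauK : fcomp tau tau = @fid C (p + p).
Variables F P S : fmap C (p + p) (p + p).
Hypothesis F0 : vanishes0 F.
Hypothesis P0 : vanishes0 P.
Hypothesis S0 : vanishes0 S.
Hypothesis FP : fcomp F P = @fid C (p + p).
Hypothesis PF : fcomp P F = @fid C (p + p).
Local Notation shat := (sigma_hat tau).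
Hypothesis PS : fcomp P S = fcomp shat P.
Local Notation A := (linpart F).
Local Notation E := (eigen a b).
Local Notation G := (fun j => mults kap l j ^+ 2).
Local Notation D := (pairwt lam).
Local Notation DM := (diag_mx (\row_i D i)).

Let l0 : l 0%MM = 0.
Proof. by have [_ _ l1 _] := flo; apply/ordge1P. Qed.

Let lam0 j : lam j != 0.
Proof. by rewrite expf_neq0. Qed.

Let shat0 : vanishes0 shat.
Proof. by apply: vanishes0_comp; apply: vanishes0_half_sigma. Qed.

Let E0 : vanishes0 E.
Proof.
move=> i; have := eigen_lin flo i => /(_ 0%MM); rewrite mdeg0 fcoefB => /(_ isT) /eqP.
by rewrite subr_eq0 vanishes0_fid => /eqP.
Qed.

Let E1 : linpart E = 1%:M.
Proof.
rewrite -linpart_fid; apply/matrixP => i k; rewrite !mxE; apply/eqP.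
by rewrite -subr_eq0 -fcoefB (eigen_lin flo) // mdeg1.
Qed.

Let mults0 j : mults kap l j 0%MM = kap j.
Proof.
case: (eqVneq j ord_max) => [->|/ord_baseP[i ->]]; last by rewrite mults_base Kb0.
by rewrite mults_max /mult fcoefD coef_cst eqxx mulr1 l0 addr0.
Qed.

Let G0 j : G j 0%MM = lam j.
Proof. by rewrite /= !expr2 coef_mul_lead ?mdeg0 // mults0. Qed.

Let E_pr : (fun i => E (bidx i)) = @base_proj C q.
Proof. by apply: fmap_ext => i; apply: eigen_bidx. Qed.

(** The eigenfunctions of the model are tangent to the identity, so [lin_conj] reads this linear
    part off their multipliers without computing [tau]. *)
Lemma linpart_sigma_hat : linpart shat = DM.
Proof.
have := lin_conj (kap := lam) (x := E) (S := shat) (G := G) lam0 E0 shat0 G0.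
rewrite E1 mul1mx mulmx1; apply=> j; rewrite E_pr.
  by have [] := eigen_sigma kap0 tau0 tau_z tau_V tauK Tb0 Tb_l Tb_r flo nrb j.
by have [] := eigen_sigma kap0 tau0 tau_z tau_V tauK Tb0 Tb_l Tb_r flo nrb j.
Qed.

Lemma linpart_chart_inverse : A *m linpart P = 1%:M.
Proof. by rewrite -(linpart_comp F0 P0) FP linpart_fid. Qed.

Lemma linpart_sigma : linpart S *m A = A *m DM.
Proof.
have e := congr1 (@linpart C _ _) PS.
rewrite (linpart_comp P0 S0) (linpart_comp shat0 P0) linpart_sigma_hat in e.
have AP := linpart_chart_inverse; have PA := mulmx1C AP.
rewrite -[LHS]mul1mx -AP -mulmxA; congr (_ *m _).
by rewrite mulmxA e -mulmxA PA mulmx1.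
Qed.

Let lG j : geo (G j) -> j = ord_max -> geo l.
Proof.
move=> h e; rewrite {}e /= mults_max /mult in h.
have k0 := kap0 ord_max; set k := kap ord_max in h k0.
have -> : l = cst _ k * (cst _ k^-1 * l) by rewrite mulrA -rmorphM mulfV // rmorph1 mul1r.
apply: geoM; first exact: geo_cst.
apply: geo_sqrt; first by rewrite fcoefCM l0 mulr0.
have -> : (1 + cst _ k^-1 * l) ^+ 2 = cst _ (k^-1 ^+ 2) * (cst _ k + l) ^+ 2.
  rewrite rmorphXn -exprMn mulrDr -rmorphM mulVf // rmorph1 //.
by apply: geoM => //; apply: geo_cst.
Qed.

(** The contrapositive form of divergence. The eigenfunctions of the model, pulled back by the
    formal conjugacy [H], are eigenfunctions of the diagonalized normal form [Sn], with multipliers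
    of the shape required by [paired_normal_form]. *)
Lemma normal_form_divergent Psi star : vanishes0 Psi -> linpart Psi \in unitmx ->
  vanishes0 star -> fcomp Psi star = fcomp S Psi ->
  fcomp star (linmap (linpart S)) = fcomp (linmap (linpart S)) star ->
  cvm star -> geo l.
Proof.
move=> Q0 uQ r0 e1 e2 cr; apply: (lG _ (erefl ord_max)).
pose la := linmap A; pose lb := linmap (linpart P).
have a0 : vanishes0 la by apply: vanishes0_linmap.
have b0 : vanishes0 lb by apply: vanishes0_linmap.
have AP := linpart_chart_inverse; have PA := mulmx1C AP.
have lc (B B' : 'M[C]_(p + p)) : fcomp (linmap B) (linmap B') = linmap (B *m B').
  exact: fcomp_linmap.
have ab : fcomp la lb = @fid C (p + p) by rewrite lc AP linmap1.
have ba : fcomp lb la = @fid C (p + p) by rewrite lc PA linmap1.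
pose H := fcomp P (fcomp Psi la); pose Sn := fcomp lb (fcomp star la).
have Qa := vanishes0_comp Q0 a0; have ra := vanishes0_comp r0 a0.
have H0 : vanishes0 H by apply: vanishes0_comp.
have Sn0 : vanishes0 Sn by apply: vanishes0_comp.
have HS : fcomp H Sn = fcomp shat H := fcomp_transport a0 b0 r0 Q0 P0 S0 shat0 ab e1 PS.
have dD : dmap D = linmap DM by rewrite dmapE.
have comm : fcomp Sn (dmap D) = fcomp (dmap D) Sn.
  apply: (fcomp_conj_commute a0 b0 r0 (vanishes0_linmap (linpart S)) (vanishes0_dmap D) ab ba e2).
  by rewrite dD !lc linpart_sigma.
have H1 : linpart H \in unitmx.
  rewrite (linpart_comp P0 Qa) (linpart_comp Q0 a0) linpart_linmap !unitmx_mul uQ.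
  by have [-> ->] := mulmx1_unit AP.
have cS : cvm Sn.
  by apply: (cvm_comp ra); [apply: cvm_linmap | apply: (cvm_comp a0 cr); apply: cvm_linmap].
move: H Sn H0 Sn0 HS comm H1 cS => H Sn H0 Sn0 HS comm H1 cS.
pose x := fcomp E H.
have x0 : vanishes0 x by apply: vanishes0_comp.
have gE j : comp1 (G j) (fun i => x (bidx i)) = comp1 (comp1 (G j) (@base_proj C q)) H.
  rewrite (comp1A _ (@vanishes0_pr C q) H0); congr comp1; apply: fmap_ext => i.
  by rewrite /x !fcompE eigen_bidx.
have xS i : comp1 (x i) Sn = comp1 (comp1 (E i) shat) H.
  rewrite /x fcompE (comp1A _ H0 Sn0) HS; exact (esym (comp1A (E i) shat0 H0)).
have eig := eigen_sigma kap0 tau0 tau_z tau_V tauK Tb0 Tb_l Tb_r flo nrb.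
apply: (paired_normal_form (kap := lam) (x := x) (S := Sn) (G := G) lam0 nrl x0 _ Sn0 cS comm _ G0).
- by rewrite (linpart_comp E0 H0) E1 mul1mx.
- move=> j; apply: resonant_seriesX; case: (eqVneq j ord_max) => [->|/ord_baseP[i ->]].
    by rewrite mults_max; apply: mult_resonant flo nrb.
  by rewrite mults_base; apply: kfun_base_resonant.
- by move=> j; rewrite mults_base /kfun_base exprMn rmorphXn.
- by move=> j; rewrite gE xS -comp1M //; have [-> _] := eig j; rewrite -fcompE.
- by move=> j; rewrite gE xS; have [_ ->] := eig j; rewrite comp1M // -(fcompE E).
Qed.

End Divergence.

(** * Spectrum and independence of the multipliers *)

Section Spectrum.
Variables (C : numClosedFieldType) (p : nat) (lam : 'I_p -> C) (S A : 'M[C]_(p + p)).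
Hypothesis lam0 : forall j, lam j != 0.
Hypothesis uA : A \in unitmx.
Hypothesis SA : S *m A = A *m diag_mx (\row_i pairwt lam i).

Lemma char_poly_diagonalizable :
  char_poly S = \prod_(j < p) (('X - (lam j)%:P) * ('X - ((lam j)^-1)%:P)).
Proof.
have e0 := SA; set D := diag_mx _ in e0.
have e : char_poly_mx S *m map_mx polyC A = map_mx polyC A *m char_poly_mx D.
  by rewrite /char_poly_mx mulmxBl mulmxBr -!map_mxM e0 scalar_mxC.
have dA : \det (map_mx polyC A) != 0 by rewrite det_map_mx polyC_eq0 -unitfE -unitmxE.
have : char_poly S = char_poly D.
  have := congr1 determinant e; rewrite !det_mulmx [RHS]mulrC => /(mulIf dA) //.
move=> ->; rewrite char_poly_trig ?diag_mx_is_trig //.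
rewrite big_split_ord /= -big_split; apply: eq_bigr => j _.
by rewrite /D !mxE !eqxx !mulr1n pairwt_l pairwt_r mulrC.
Qed.

Lemma nonresonant_diagonalizable :
  (forall e e' : 'I_p -> nat, \prod_j lam j ^+ e j = \prod_j lam j ^+ e' j -> e =1 e') ->
  nonresonant S.
Proof.
move=> ind; exists lam; first exact: char_poly_diagonalizable.
move=> Q [j Qj]; apply/eqP => e1.
(* Positive and negative parts of the exponents, where [Negz n] stands for - n - 1. An integral
   relation becomes an equality of products with natural exponents. *)
pose e k := if Q k is Posz n then n else 0%N; pose e' k := if Q k is Negz n then n.+1 else 0%N.
have : e =1 e'.
  apply: ind; transitivity ((\prod_j lam j ^ Q j) * \prod_j lam j ^+ e' j); last by rewrite e1 mul1r.
  rewrite -big_split; apply: eq_bigr => k _ /=.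
  rewrite /e /e'; case: (Q k) => n /=; first by rewrite expr0 mulr1 exprnP.
  by rewrite NegzE -exprnN mulVf ?expr0 // expf_neq0.
by move=> /(_ j); rewrite /e /e'; case: (Q j) Qj => [[]|].
Qed.

Lemma pure_elliptic_diagonalizable : (forall j, lam j \is Num.real) -> pure_elliptic S.
Proof.
move=> rl mu; rewrite eigenvalue_root_char char_poly_diagonalizable.
rewrite /root horner_prod => /eqP/eqP/prodf_eq0 [j _].
rewrite hornerM !hornerXsubC mulf_eq0 !subr_eq0 => /orP[] /eqP-> //.
by rewrite rpredV.
Qed.

End Spectrum.

Section Independence.
Variables (C : numClosedFieldType).

Lemma nonres_of_indep p (kap : 'I_p -> C) : (forall j, kap j != 0) ->
  (forall e e' : 'I_p -> nat, \prod_j kap j ^+ e j = \prod_j kap j ^+ e' j -> e =1 e') ->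
  nonres (pairwt kap).
Proof.
move=> k0 ind m m' e j.
have P0 (f : 'I_p -> nat) : \prod_j kap j ^+ f j != 0.
  by apply/prodf_neq0 => i _; rewrite expf_neq0.
have h := wt_pairwt m k0; have h' := wt_pairwt m' k0.
have : (fun j => m (rshift p j) + m' (lshift p j))%N =1 (fun j => m' (rshift p j) + m (lshift p j))%N.
  apply: ind; under eq_bigr do rewrite exprD; under [RHS]eq_bigr do rewrite exprD.
  by rewrite !big_split /= -h -h' e; ring.
by move=> /(_ j) /= ->; rewrite addnC.
Qed.

Variables (q : nat) (kap : 'I_q.+1 -> C).
Hypothesis kap0 : forall j, kap j != 0.
Hypothesis indep : forall e e' : 'I_q.+1 -> nat,
  \prod_j kap j ^+ e j = \prod_j kap j ^+ e' j -> e =1 e'.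

Definition extend (e : 'I_q -> nat) k (j : 'I_q.+1) : nat :=
  if unlift ord_max j is Some i then e i else k.

Lemma indep_base (e e' : 'I_q -> nat) k k' :
  (\prod_j kapb kap j ^+ e j) * kap ord_max ^+ k = (\prod_j kapb kap j ^+ e' j) * kap ord_max ^+ k' ->
  e =1 e' /\ k = k'.
Proof.
move=> h; have E : extend e k =1 extend e' k'.
  apply: indep; rewrite !big_ord_recr /= /extend unlift_none.
  under eq_bigr do rewrite -lift_max liftK.
  under [in RHS]eq_bigr do rewrite -lift_max liftK.
  under eq_bigr do rewrite lift_max.
  by under [in RHS]eq_bigr do rewrite lift_max.
split=> [j|]; first by have := E (lift ord_max j); rewrite /extend liftK.
by have := E ord_max; rewrite /extend unlift_none.
Qed.

Lemma nonres_lam : nonres (pairwt (fun j => kap j ^+ 2)).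
Proof.
apply: nonres_of_indep => [j|e e' h]; first by rewrite expf_neq0.
move=> j; have : (fun j => 2 * e j)%N =1 (fun j => 2 * e' j)%N.
  by apply: indep; under eq_bigr do rewrite exprM; rewrite h; apply: eq_bigr => i _; rewrite exprM.
by move=> /(_ j) /eqP; rewrite eqn_pmul2l // => /eqP.
Qed.

Lemma kapb0 j : kapb kap j != 0. Proof. exact: kap0. Qed.

Lemma nonres_kapb : nonres (pairwt (kapb kap)).
Proof.
apply: nonres_of_indep => [|e e' h]; first exact: kapb0.
by apply: (proj1 (@indep_base e e' 0 0 _)); rewrite h.
Qed.

(** A vanishing divisor would mean a base weight equal to the square of the last multiplier, a
    multiplicative relation. *)
Lemma small_neq0_kapb m : (kap ord_max)^-1 * wt (pairwt (kapb kap)) m - kap ord_max != 0.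
Proof.
apply/eqP => /eqP; rewrite subr_eq0 => /eqP e.
have {}e : wt (pairwt (kapb kap)) m = kap ord_max ^+ 2.
  by rewrite expr2 -[X in _ = X * _]e mulrC mulrA mulfV // mul1r.
have := wt_pairwt m kapb0; rewrite e => h.
have [] // := @indep_base (fun j => m (rshift q j)) (fun j => m (lshift q j)) 0 2 _.
by rewrite -h expr0 mulr1 mulrC.
Qed.

Lemma wt_mswap m : wt (pairwt (kapb kap)) m * wt (pairwt (kapb kap)) (mswap m) = 1.
Proof.
set w := pairwt _.
have h := wt_pairwt m kapb0; have h' := wt_pairwt (mswap m) kapb0; rewrite -/w in h h'.
set L := \prod_j kapb kap j ^+ m (lshift q j) in h.
set R := \prod_j kapb kap j ^+ m (rshift q j) in h.
have eL : \prod_j kapb kap j ^+ (mswap m) (rshift q j) = L.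
  by apply: eq_bigr => j _; rewrite mnmE swap_r.
have eR : \prod_j kapb kap j ^+ (mswap m) (lshift q j) = R.
  by apply: eq_bigr => j _; rewrite mnmE swap_l.
rewrite eL eR in h'.
have LR : L * R != 0.
  by rewrite mulf_neq0 //; apply/prodf_neq0 => j _; rewrite expf_neq0 // kapb0.
apply: (mulIf LR); rewrite mul1r -[RHS]mulrC -{2}h -{2}h'; ring.
Qed.

End Independence.

(** * The multipliers 2, x, 3 and their small divisors *)

Section Multipliers.
Variables (R : realType) (x : R).
Hypothesis x1 : 1 < x.
Hypothesis xind : mult_indep x.
Local Notation C := R[i].
Local Open Scope complex_scope.

Lemma expn23_inj i j i' j' : (2 ^ i * 3 ^ j = 2 ^ i' * 3 ^ j')%N -> i = i' /\ j = j'.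
Proof.
move=> e; have h r := congr1 (logn r) e.
have {}h r : (logn r (2 ^ i) + logn r (3 ^ j) = logn r (2 ^ i') + logn r (3 ^ j'))%N.
  by rewrite -!lognM ?expn_gt0 // h.
have := h 2%N; have := h 3%N; rewrite !lognX !logn_prime //= !muln0 !muln1 !addn0 !add0n.
by move=> -> ->.
Qed.

Lemma mult_indep_inj v i j v' i' j' :
  x ^+ v * (2 ^+ i * 3 ^+ j) = x ^+ v' * (2 ^+ i' * 3 ^+ j') -> [/\ v = v', i = i' & j = j'].
Proof.
have x0 : x != 0 by rewrite gt_eqF // (lt_trans ltr01).
wlog le : v i j v' i' j' / (v' <= v)%N => [H e|e].
  case: (leqP v' v) => [/H|/ltnW/H]; first exact.
  by move=> h; have [-> -> ->] := h _ _ _ _ (esym e).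
have {}e : x ^+ (v - v') * (2 ^+ i * 3 ^+ j) = 2 ^+ i' * 3 ^+ j'.
  by apply: (mulfI (expf_neq0 v' x0)); rewrite /= [LHS]mulrA -[in LHS]exprD subnKC.
have : (v - v' == 0)%N.
  by rewrite -leqn0 leqNgt; apply/negP => h; have := xind i j i' j' h; rewrite e eqxx.
move=> /eqP h; rewrite h expr0 mul1r -!natrX -!natrM in e.
have {}h : v = v' by apply/eqP; rewrite eqn_leq le -subn_eq0 h andbT.
by move: e => /eqP; rewrite eqr_nat => /eqP/expn23_inj[].
Qed.

(** Square roots of the eigenvalues of sigma greater than 1. The last entry is the 3 whose square
    the weights of the base monomials approach. *)
Definition roots (j : 'I_3) : C := (tnth [tuple 2; x; 3] j)%:C.

Lemma roots_gt0 j : 0 < roots j.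
Proof.
by rewrite /roots ltcR; case: j => [[|[|[|]]]] //= h; rewrite /tnth /= ?ltr0n // (lt_trans ltr01).
Qed.

Lemma roots_neq0 j : roots j != 0. Proof. by rewrite gt_eqF ?roots_gt0. Qed.

Lemma roots_real j : roots j \is Num.real. Proof. by rewrite gtr0_real ?roots_gt0. Qed.

Lemma roots_sq j : roots j ^+ 2 != 1.
Proof.
have h1 : 1 < roots j.
  by rewrite /roots ltcR; case: j => [[|[|[|]]]] //= h; rewrite /tnth /= ?ltr1n.
by rewrite gt_eqF // expr_gt1 // ltW // (lt_trans ltr01).
Qed.

Lemma roots_indep (e e' : 'I_3 -> nat) :
  \prod_j roots j ^+ e j = \prod_j roots j ^+ e' j -> e =1 e'.
Proof.
have E (f : 'I_3 -> nat) : \prod_j roots j ^+ f j =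
   (x ^+ f (inord 1) * (2 ^+ f (inord 0) * 3 ^+ f (inord 2)))%:C.
  rewrite !big_ord_recl big_ord0 mulr1 !rmorphM !rmorphXn /roots /=.
  have -> : inord 0 = ord0 :> 'I_3 by apply: val_inj; rewrite /= inordK.
  have -> : inord 1 = lift ord0 ord0 :> 'I_3 by apply: val_inj; rewrite /= inordK.
  have -> : inord 2 = lift ord0 (lift ord0 ord0) :> 'I_3 by apply: val_inj; rewrite /= inordK.
  by rewrite /tnth /= mulrCA.
rewrite !E => /complexI/mult_indep_inj[h1 h0 h2] j.
rewrite -(inord_val j); move: (j : nat) (ltn_ord j) => [|[|[|]]] //.
Qed.

Variables (a b : nat -> nat).
Hypothesis a0 : forall k, (0 < a k)%N.
Hypothesis ab_lac : forall k, (2 * (a k + b k) < a k.+1 + b k.+1)%N.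
Hypothesis ab_close : forall k, 0 < x ^+ b k - 9 * 2 ^+ a k /\
  (x ^+ b k - 9 * 2 ^+ a k) * k.+1%:R ^+ (2 * (a k + b k)).+1 <= 2 ^+ a k.

(** X_1^a Y_2^b. The exponent a on the first member of its pair puts 2^a in the denominator of the
    weight. *)
Definition modes k : 'X_{1..2 + 2} :=
  (U_(lshift 2 ord0) *+ a k + U_(rshift 2 ord_max) *+ b k)%MM.

Lemma mdeg_modes k : mdeg (modes k) = (a k + b k)%N.
Proof. by rewrite mdegD !mdegMn !mdeg1 !mul1n. Qed.

Lemma modes_swap k : modes k != mswap (modes k).
Proof.
apply/eqP => /(congr1 (fun m : 'X_{1..2 + 2} => m (lshift 2 ord0))).
rewrite /= [RHS]mnmE swap_l !mnmDE !mulmnE !mnm1E !eqxx !eq_lrshift !eq_rlshift eq_rshift /= mul1n !mul0n.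
by rewrite !addn0 ?add0n => e; have := a0 k; rewrite e ltnn.
Qed.

Definition near9 k : R := x ^+ b k / 2 ^+ a k.

Lemma wt_modes k : wt (pairwt (kapb roots)) (modes k) = (near9 k)%:C.
Proof.
have wtMn (w : 'I_(2 + 2) -> C) i n : wt w (U_(i) *+ n)%MM = w i ^+ n.
  by elim: n => [|n IH]; rewrite ?mulm0n ?wt0 // mulmS wtD wtU IH exprS.
rewrite /modes wtD !wtMn pairwt_l pairwt_r /near9 rmorphM fmorphV !rmorphXn mulrC exprVn.
by congr (_ ^+ _ / _ ^+ _).
Qed.

Lemma near9_gt k : 9 < near9 k.
Proof.
have [h _] := ab_close k; rewrite /near9 ltr_pdivlMr ?exprn_gt0 ?ltr0n //.
by rewrite -subr_gt0.
Qed.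

(** With y = om - 9 the bracket collapses to 3 om / y - 3 / (9 om - 1) - 3, since the two
    contributions with denominators om - 1 and 1/om - 1 add up to -3. From y <= 1 / V the first term
    is at least 27 V, the others cost at most 4, and om / 2 exceeds 4. *)
Lemma near9_large k (om := near9 k) : 4 * (k.+1%:R : R) ^+ (2 * (a k + b k)).+1 <=
  om / 2 * (om / (3^-1 * om - 3) - 3 * om / (om - 1)
     + (om^-1 / (3^-1 * om^-1 - 3) - 3 * om^-1 / (om^-1 - 1))).
Proof.
set V := _ ^+ _; have om9 := near9_gt k; rewrite -/om in om9.
have V1 : 1 <= V by rewrite exprn_ege1 // ler1n.
have close : (om - 9) * V <= 1.
  have [_ h] := ab_close k; have t0 : 0 < (2 : R) ^+ a k by rewrite exprn_gt0 ?ltr0n.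
  rewrite -(ler_pM2l t0) mulr1; apply: le_trans h; rewrite mulrA /om /near9 mulrBr mulrCA mulfV ?gt_eqF //.
  by rewrite mulr1 [_ * 9]mulrC.
pose y := om - 9; have y0 : 0 < y by rewrite subr_gt0.
have n1 : y != 0 by rewrite gt_eqF.
have n2 : 9 * om - 1 != 0 by apply: lt0r_neq0; lra.
have n3 : om - 1 != 0 by apply: lt0r_neq0; lra.
have n4 : om != 0 by apply: lt0r_neq0; lra.
have -> : om / (3^-1 * om - 3) - 3 * om / (om - 1)
     + (om^-1 / (3^-1 * om^-1 - 3) - 3 * om^-1 / (om^-1 - 1)) =
   3 * om / y - 3 / (9 * om - 1) - 3.
  have n5 : 1 + -1 * om != 0 by apply: ltr0_neq0; lra.
  have n6 : 1 + -3 * (3 * om) != 0 by apply: ltr0_neq0; lra.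
  by rewrite /y; field; rewrite n2 n3 n4 n5 n6 (_ : om - 9 != 0).
have b1 : V <= y^-1 by rewrite -[y^-1]mul1r ler_pdivlMr // mulrC.
have b2 : 3 / (9 * om - 1) <= 1 by rewrite ler_pdivrMr; lra.
have b3 : 27 * V <= 3 * om / y.
  by apply: ler_pM => //; lra.
nra.
Qed.

Lemma modes_large k (om := wt (pairwt (kapb roots)) (modes k)) :
  4 * (k.+1%:R : C) ^+ (2 * mdeg (modes k)).+1 <=
  `| om / 2 * (second_order (roots ord_max) om + second_order (roots ord_max) om^-1) |.
Proof.
have r3 : roots ord_max = (3 : R)%:C by [].
have /= h := near9_large k; rewrite -lecR in h.
rewrite mdeg_modes /om wt_modes /second_order r3; apply: le_trans (real_ler_norm _).
  move: h; congr (_ <= _); first by rewrite !(rmorphM, rmorphXn, rmorph_nat).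
  by rewrite !(rmorphM, rmorphD, rmorphN, fmorphV, rmorph_nat, rmorph1).
have re (y : R) : (y%:C : C) \is Num.real by rewrite complex_real.
by repeat first [apply: re | apply: rpred1 | apply: rpred_nat | apply: rpredM | apply: rpredB
  | apply: rpredD | rewrite rpredV].
Qed.

End Multipliers.

Lemma complex_archimedean (R : realType) (r : R[i]) : 0 <= r -> exists N : nat, r <= N%:R.
Proof.
case: r => u v; rewrite lecE /= => /andP[/eqP-> u0].
exists (Num.bound u); rewrite -(rmorph_nat (real_complex R)) lecE /= eqxx /=.
exact: ltW (archi_boundP u0).
Qed.

Lemma lacunary_real (C : numClosedFieldType) q (mQ : nat -> 'X_{1..q + q}) (h : nat -> C) :
  (forall k, h k \is Num.real) -> conjf (lacunary mQ h) = lacunary mQ h.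
Proof.
move=> hr; apply: fps_ext => m; rewrite /conjf conj_Creal // /lacunary.
by apply: rpred_sum => k _; rewrite rpredM ?rpred_nat.
Qed.

Theorem theorem1p4 (R : realType) :
  exists (M : set 'rV[R[i]]_(3 + 3)) (E : fmap R[i] (3 + 3) 3)
         (t : 'I_3 -> fmap R[i] (3 + 3) (3 + 3)),
    real_analytic_germ M E /\
    max_deck_transformations E /\
    deck_generators E t /\
    nonresonant (linpart (sigma t)) /\
    pure_elliptic (linpart (sigma t)) /\
    forall Psi sigma_star : fmap R[i] (3 + 3) (3 + 3),
      formal_biholomorphism Psi ->
      vanishes0 sigma_star ->
      fcomp Psi sigma_star = fcomp (sigma t) Psi ->
      fcomp sigma_star (linmap (linpart (sigma t)))
        = fcomp (linmap (linpart (sigma t))) sigma_star ->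
      diverges sigma_star.
Proof.
have [x [a [b [x1 xind a0 ab_lac ab_close]]]] := liouville_exists R.
pose kap := roots x; pose w := pairwt (kapb kap); pose mQ := modes a b.
have kap0 : forall j, kap j != 0 := roots_neq0 x1.
have ind : forall e e' : 'I_3 -> nat, _ -> e =1 e' := roots_indep x1 xind.
have lam0 j : kap j ^+ 2 != 0 by rewrite expf_neq0.
(* [A] will be the linear part of the chart, whose columns are eigenvectors for the eigenvalues
   kap_j^-2 and kap_j^2. *)
have spec S A : A \in unitmx -> S *m A = A *m diag_mx (\row_i pairwt (fun j => kap j ^+ 2) i) ->
    nonresonant S /\ pure_elliptic S.
  move=> uA SA; split.
    apply: (nonresonant_diagonalizable lam0 uA SA) => e e' ee j.
    have : (fun j => 2 * e j)%N =1 (fun j => 2 * e' j)%N.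
      apply: ind; under eq_bigr do rewrite exprM; under [RHS]eq_bigr do rewrite exprM.
      exact: ee.
    by move=> /(_ j) /eqP; rewrite eqn_pmul2l // => /eqP.
  have rl j : kap j ^+ 2 \is Num.real by rewrite rpredX // roots_real.
  exact (pure_elliptic_diagonalizable uA SA rl).
have mQ0 : (0 < mdeg (mQ 0%N))%N by rewrite mdeg_modes addn_gt0 a0.
have mQ_lac k : (2 * mdeg (mQ k) < mdeg (mQ k.+1))%N by rewrite !mdeg_modes.
have mQ_wt k : wt w (mQ k) != 1.
  rewrite wt_modes gt_eqF // (@ltcR _ 1) (lt_trans _ (near9_gt ab_close k)) //.
  by rewrite -[1]/(1%:R) ltr_nat.
have [Tb [Tb0 Tb1 Tb_l Tb_r]] := base_map_exists kap0.
have [h [hb hdiv]] := exists_divergent Tb0 Tb1 (kap0 ord_max) (small_neq0_kapb kap0 ind)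
  (wt_mswap kap0) mQ0 mQ_lac (modes_swap b a0) mQ_wt (modes_large ab_close)
  (@complex_archimedean R).
have [h1 hr] : (forall k, `|h k| <= 1) /\ (forall k, h k \is Num.real).
  by split=> k; have [] := hb k.
pose g := lacunary mQ h.
have g1 : ordge 1 g := ordge1_lacunary mQ0 mQ_lac h.
have [fa [fb [fl flo]]] := floquet_exists Tb0 Tb1 (kap0 ord_max) (small_neq0_kapb kap0 ind)
  (coupling_ordge Tb0 g1).
have [M [E [t [P [tau [[HM HE Ht] [[P0 FP PF S0 PS] [tau0 tz tV tK]]]]]]]] :=
  deck_model_exists kap0 (roots_sq x1) g1 (fun j => conj_Creal (roots_real x1 j))
    (lacunary_real mQ hr) (geo_lacunary mQ0 mQ_lac h1).
have F0 := vanishes0_chart kap.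
have nrb := nonres_kapb kap0 ind; have nrl := nonres_lam kap0 ind.
have SA := linpart_sigma kap0 nrb Tb0 Tb_l Tb_r flo tau0 tz tV tK F0 P0 S0 FP PS.
have uA := unit_chart (roots_sq x1).
exists M, E, t; split; [exact HM|split; [exact HE|split; [exact Ht|split; [|split]]]].
- exact (proj1 (spec _ _ uA SA)).
- exact (proj2 (spec _ _ uA SA)).
move=> Psi star [Q0 uQ] r0 e1 e2 /convergent_cvm cr.
exact (hdiv _ _ _ flo (normal_form_divergent kap0 nrb nrl Tb0 Tb_l Tb_r flo tau0 tz tV tK
  F0 P0 S0 FP PS Q0 uQ r0 e1 e2 cr)).
Qed.
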